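(* Let $r\ge 0$ be an integer, let $\Delta\subseteq\mathbb{R}^k$ be a $k$-dimensional simplicial complex, and let $\Delta'$ be a split subdivision of $\Delta$ obtained by replacing a maximal cell $\sigma\in\Delta_k$ by a subdivision $\Delta''$ of $\sigma$. If both $S^r(\widehat\Delta)$ and $S^r(\widehat\Delta'')$ are free $R$-modules, then $S^r(\widehat\Delta')$ is a free $R$-module.
   Context: $R=\mathbb{R}[x_0,\dots,x_k]$. For a $k$-dimensional (full-dimensional) simplicial complex $\Delta\subseteq\mathbb{R}^k$, $\Delta_i$ is the set of $i$-dimensional faces and $\Delta_i^0$ the set of interior $i$-dimensional faces (those not contained in the boundary $\partial(\Delta)$); all $k$-dimensional faces are considered interior, so $\Delta_k^0=\Delta_k$. $\Delta^0$ denotes the collection of interior faces. $\widehat\Delta\subseteq\mathbb{R}^{k+1}$ is the cone over $\Delta$ (place $\Delta$ in the hyperplane $x_0=1$ and cone from the origin). $S^r(\widehat\Delta)$ is the graded $R$-module of splines of smoothness $r$ on $\widehat\Delta$, i.e. $C^r$ functions on $\widehat\Delta$ that restrict to a polynomial on each maximal cell; it is identified with the tuples $(f_\sigma)_{\sigma\in\Delta_k}\in\bigoplus_{\sigma\in\Delta_k}R$ such that $f_{\sigma_1}-f_{\sigma_2}\in\langle l_{\hat\tau}^{\,r+1}\rangle$ whenever $\sigma_1,\sigma_2$ share an interior facet $\tau$. Here, for $\tau\in\Delta_{k-1}$, $l_{\hat\tau}\in R$ is the homogenization (with respect to $x_0$) of a linear form $l_\tau$ whose vanishing defines the affine span of $\tau$.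 For $\gamma\in\Delta_i^0$ with $i<k$, put $J(\Delta)_\gamma=\langle l_{\hat\tau}^{\,r+1}\mid \gamma\subseteq\tau\in\Delta_{k-1}\rangle\subseteq R$; the same notation is used for $\Delta'$. Simple subdivision: let $\sigma\in\Delta_k$ and let $\Delta''$ be a subdivision of $\sigma$ into a simplicial complex such that $\partial(\sigma)=\partial(\Delta'')$ on $\Delta^0$ (i.e. faces of $\sigma$ that are interior in $\Delta$ are not subdivided; the boundary of $\sigma$ may be modified only on $\sigma\cap\partial(\Delta)$). Replacing $\sigma$ by $\Delta''$ gives a simplicial complex $\Delta'$, called a simple subdivision of $\Delta$. Split subdivision: a simple subdivision $\Delta'$ such that for every $i$ and every $i$-face $\gamma$ of $\partial(\Delta'')$ that is not in $\partial(\Delta')$, one has $J(\Delta')_\gamma=J(\Delta)_\gamma$. *)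

(* Defs.v *)
From HB Require Import structures.
From mathcomp Require Import all_boot all_order all_algebra finmap mpoly.
From mathcomp Require Import boolp classical_sets reals.

Set Implicit Arguments.
Unset Strict Implicit.
Unset Printing Implicit Defensive.

Import Order.TTheory GRing.Theory Num.Theory.
Local Open Scope ring_scope.

Section Freeness.
Variables (A : nzRingType) (M : lmodType A).

Definition lin_span (B : set M) : set M :=
  [set x | exists (s : seq M) (a : M -> A),
     [/\ uniq s, forall b, b \in s -> B b & x = \sum_(b <- s) a b *: b]].

Definition lin_indep (B : set M) : Prop :=
  forall (s : seq M) (a : M -> A),
    uniq s -> (forall b, b \in s -> B b) ->
    \sum_(b <- s) a b *: b = 0 -> forall b, b \in s -> a b = 0.

(* N is (the carrier of) a free submodule of M; the basis is not required
   to be finite. *)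
Definition free_submodule (N : set M) : Prop :=
  exists B : set M, lin_indep B /\ lin_span B = N.

End Freeness.

Definition ideal_gen (A : nzRingType) (G : set A) : set A :=
  @lin_span A A^o G.

Section Complexes.
Variables (R : realType) (k : nat).
Local Notation point := 'rV[R]_k.
Local Notation simplex := {fset 'rV[R]_k}.
Local Notation complex := {fset {fset 'rV[R]_k}}.

Definition aff_indep (V : simplex) : Prop :=
  forall w : point -> R,
    \sum_(v <- V) w v = 0 -> \sum_(v <- V) w v *: v = 0 ->
    forall v, v \in V -> w v = 0.

Definition aff_span (V : simplex) : set point :=
  [set x | exists w : point -> R,
     \sum_(v <- V) w v = 1 /\ x = \sum_(v <- V) w v *: v].

Definition conv_hull (V : simplex) : set point :=
  [set x | exists w : point -> R,
     [/\ forall v, v \in V -> 0 <= w v,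
         \sum_(v <- V) w v = 1 & x = \sum_(v <- V) w v *: v]].

(* A finite geometric simplicial complex in R^k. A face is given by its
   vertex set; the empty face is excluded. As conv_hull of the empty set is
   empty, the last clause says that two faces are disjoint or meet in a
   common face. *)
Definition simplicial_complex (D : complex) : Prop :=
  [/\ forall F, F \in D -> F != fset0 /\ aff_indep F,
      forall F G, F \in D -> (G `<=` F)%fset -> G != fset0 -> G \in D
    & forall F G, F \in D -> G \in D ->
        (conv_hull F `&` conv_hull G = conv_hull (F `&` G)%fset)%classic].

Definition faces (i : nat) (D : complex) : complex :=
  [fset F in D | #|` F| == i.+1]%fset.

(* k-dimensional in R^k: all maximal faces have dimension k. *)
Definition full_dimensional (D : complex) : Prop :=
  D != fset0 /\
  forall F, F \in D -> exists2 G, G \in faces k D & (F `<=` G)%fset.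

Definition support (D : complex) : set point :=
  [set x | exists2 F, F \in D & conv_hull F x].

Definition cells_at (D : complex) (F : simplex) : complex :=
  [fset G in faces k D | (F `<=` G)%fset]%fset.

(* The subcomplex generated by the (k-1)-simplices (those with k vertices)
   lying in exactly one k-dimensional face. *)
Definition boundary (D : complex) : complex :=
  [fset F in D | [exists T : D,
     [&& #|` val T| == k, (F `<=` val T)%fset
       & #|` cells_at D (val T)| == 1%N]]]%fset.

Definition interior_faces (D : complex) : complex :=
  (D `\` boundary D)%fset.

Definition simplex_complex (S : simplex) : complex :=
  (fpowerset S `\ fset0)%fset.

Local Notation poly := {mpoly R[k.+1]}.

(* a0 + \sum_i a_i x_i is an affine form vanishing exactly on the affine span
   of T, and l is its homogenization; 'X_ord0 is the homogenizing variable.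
   For T a (k-1)-simplex, l is unique up to a nonzero scalar. *)
Definition facet_form (T : simplex) (l : poly) : Prop :=
  exists (a0 : R) (a : 'rV[R]_k),
    l = a0 *: 'X_ord0 + \sum_(i < k) a 0 i *: 'X_(lift ord0 i) /\
    forall x : point, a0 + \sum_(i < k) a 0 i * x 0 i = 0 <-> aff_span T x.

(* The ideal J(D)_F; facets contribute all the scalar multiples of their
   form, which does not affect the ideal generated. *)
Definition face_ideal (r : nat) (D : complex) (F : simplex) : set poly :=
  ideal_gen [set g | exists (T : simplex) (l : poly),
    [/\ T \in D, #|` T| = k, (F `<=` T)%fset, facet_form T l
      & g = l ^+ r.+1]].

(* The splines of smoothness r on the cone over D, as a subset of the free
   module of tuples of polynomials indexed by the k-dimensional faces of D. *)
Definition splines (r : nat) (D : complex) : set {ffun faces k D -> poly^o} :=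
  [set f | forall (S1 S2 : faces k D) (T : simplex) (l : poly),
     T \in interior_faces D -> #|` T| = k ->
     (T `<=` val S1)%fset -> (T `<=` val S2)%fset -> facet_form T l ->
     ideal_gen [set l ^+ r.+1]%classic (f S1 - f S2)].

Definition subdivides (D2 : complex) (S : simplex) : Prop :=
  [/\ simplicial_complex D2, full_dimensional D2 & support D2 = conv_hull S].

(* All faces of the k-dimensional faces other than S, together with D2. *)
Definition replace_cell (D : complex) (S : simplex) (D2 : complex) : complex :=
  ([fset F in D | [exists G : faces k D,
      (val G != S) && (F `<=` val G)%fset]] `|` D2)%fset.

Definition simple_subdivision (D : complex) (S : simplex) (D2 D1 : complex) :
    Prop :=
  [/\ S \in faces k D,
      subdivides D2 S,
      forall F, F \in interior_faces D ->
        (F \in boundary (simplex_complex S)) = (F \in boundary D2),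
      D1 = replace_cell D S D2
    & simplicial_complex D1].

Definition split_subdivision (r : nat) (D : complex) (S : simplex)
    (D2 D1 : complex) : Prop :=
  simple_subdivision D S D2 D1 /\
  forall F, F \in boundary D2 -> F \notin boundary D1 ->
    face_ideal r D1 F = face_ideal r D F.

End Complexes.

Arguments splines {R k} r D.

(* Main.v *)
Require Import Defs.
From HB Require Import structures.
From mathcomp Require Import all_boot all_order all_algebra finmap mpoly.
From mathcomp Require Import boolp classical_sets reals.
From mathcomp Require Import ring lra zify.

(** Write D for the given complex, D2 for the complex that replaces the cell
    sigma, D1 for the result, and N for r + 1.

    Restriction to D2 maps the splines of D1 to the splines of D2. Its kernel
    is the module of those splines of D that vanish on sigma, which is a direct
    summand of the splines of D: subtracting from f the constant tuple with
    value f_sigma is a projection onto it. A graded direct summand of a finitely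
    generated free module over a polynomial ring is free
    ([graded_projective_free]), so the kernel is free. If restriction is also
    onto, then the splines of D1 are an extension of a free module by a free
    module, hence free ([free_family_extension]). Everything else serves to
    prove that restriction is onto ([inner_surjective]).

    Let g be a spline on D2. It extends to D1 as soon as some tuple u of
    polynomials, one for each cell of D, satisfies the following jump
    conditions: across an interior facet T that is not a facet of sigma, u jumps
    by a multiple of l_T^N, and across a facet T of sigma it jumps from sigma to
    the neighbour by the value of g at T, modulo l_T^N. Consider the
    polynomials a for which the problem obtained by multiplying the right-hand
    sides by a is solvable. They form an ideal I, and the freeness of the
    splines of D enters through one property of I: if x, y and z are linearly
    independent linear forms with x a, y a, z a in I, then a is in I. Indeed
    three solutions u1, u2, u3 give a Koszul cocycle y u1 - x u2, z u1 - x u3,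
    z u2 - y u3 with values in the splines of D; since that module is free and
    x, y, z is a regular sequence, the cocycle is a coboundary, and correcting
    u1 by it makes it divisible by x ([jumps_koszul]). By induction, this
    property reduces the problem to sets of facets whose linear forms span a
    space of dimension at most two ([gluing]): a product of powers of the forms
    lies in I if three independent forms have exponents below N, because each of
    these exponents may be raised, and otherwise the facets whose exponent is at
    least N impose nothing.

    In rank two, at most two facets tau1 and tau2 of sigma carry a condition.
    If there is only one, a function that is constant off sigma solves the
    problem. If there are two, they meet in a ridge gamma, the conditions decouple
    into conditions on the cells around gamma and conditions elsewhere, and one
    has to interpolate between the values g1 and g2 of g at tau1 and tau2 on the
    cells around gamma other than sigma ([bridge_exists]). Looking along gamma,
    these cells are sectors in a plane, and for every facet T containing gamma
    there is a function on them with values in {0, 1}, equal to 1 next to tau1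
    and to 0 next to tau2, that jumps only at T ([facet_cut]). If gamma is on the
    boundary of D1, there is a gap at some T, and this function is all that is
    needed. Otherwise g1 - g2 lies in the ideal J(D2)_gamma, hence in
    J(D1)_gamma, which is J(D)_gamma because the subdivision is split; so g1 - g2
    is a combination of the l_T^N with T in D, and each of its terms is placed at
    its own facet T.

    That g1 - g2 lies in J(D2)_gamma is a telescoping argument around gamma
    inside sigma ([ridge_telescope]). It is carried out without ordering the
    cells: the sum over all ordered pairs (p, q) of sgn(det(p, q)) times the value
    of g on the cell spanned by gamma, p and q vanishes by antisymmetry, and
    grouping its terms by p gives g1 - g2 plus jumps of g across facets. *)

Set Implicit Arguments.
Unset Strict Implicit.
Unset Printing Implicit Defensive.

Import Order.TTheory GRing.Theory Num.Theory.
Local Open Scope fset_scope.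
Local Open Scope ring_scope.

(** * Linear forms and regular sequences *)

(** Locked, because it is itself a finite sum: rewriting with lemmas on sums would
    otherwise unfold it. *)
HB.lock Definition linform (F : fieldType) (n : nat) (c : 'rV[F]_n) : {mpoly F[n]} :=
  \sum_i c 0 i *: 'X_i.

Section LinearForms.
Variables (F : fieldType) (n : nat).
Implicit Types (c d : 'rV[F]_n) (p q s : {mpoly F[n]}).

Definition pairing c d : F := \sum_i c 0 i * d 0 i.

Lemma pairing_is_linear c : scalar (pairing c).
Proof.
move=> a x y; rewrite /pairing mulr_sumr -big_split /=; apply: eq_bigr => i _.
by rewrite !mxE mulrDr mulrCA.
Qed.
HB.instance Definition _ c :=
  GRing.isLinear.Build F 'rV[F]_n F *%R (pairing c) (pairing_is_linear c).

Lemma pairingC c d : pairing c d = pairing d c.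
Proof. by apply: eq_bigr => i _; rewrite mulrC. Qed.

Lemma linformE c : linform c = \sum_i c 0 i *: 'X_i.
Proof. by rewrite linform.unlock. Qed.

Lemma linform_is_linear : linear (@linform F n).
Proof.
move=> a x y; rewrite !linformE scaler_sumr -big_split /=; apply: eq_bigr => i _.
by rewrite !mxE scalerDl scalerA.
Qed.
HB.instance Definition _ :=
  GRing.isLinear.Build F 'rV[F]_n {mpoly F[n]} _ (@linform F n) linform_is_linear.

Lemma linform_coef c i : (linform c)@_U_(i) = c 0 i.
Proof.
rewrite linformE raddf_sum /= (bigD1 i) //= mcoeffZ mcoeffX eqxx mulr1 big1 ?addr0 //.
by move=> j ne; rewrite mcoeffZ mcoeffXU (negbTE ne) mulr0.
Qed.

Lemma linform_eq0 c : (linform c == 0) = (c == 0).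
Proof.
apply/eqP/eqP => [h|->]; last by rewrite raddf0.
by apply/rowP => i; rewrite mxE -linform_coef h mcoeff0.
Qed.

Lemma linform_homog c : linform c \is 1.-homog.
Proof. by rewrite linformE; apply: rpred_sum => i _; rewrite rpredZ // dhomogX /= mdeg1. Qed.

Section Kill.
Variables (I : finType) (c al : I -> 'rV[F]_n).
Hypothesis dual : forall i j, pairing (c i) (al j) = (i == j)%:R.

(** The substitution that projects the linear forms along the span of the [c i]
    onto the forms vanishing on all [al i]. Its kernel is the ideal generated by
    the [c i], which is how divisibility questions modulo that ideal are decided. *)
Definition kill_forms : {mpoly F[n]} -> {mpoly F[n]} :=
  comp_mpoly [tuple 'X_m - \sum_i al i 0 m *: linform (c i) | m < n].

Lemma kill_formsM : {morph kill_forms : p q / p * q}.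
Proof. by move=> p q; rewrite /kill_forms rmorphM. Qed.

Lemma kill_formsE d :
  kill_forms (linform d) = linform (d - \sum_i pairing d (al i) *: c i).
Proof.
have -> : linform (d - \sum_i pairing d (al i) *: c i) =
    linform d - \sum_i pairing d (al i) *: linform (c i).
  rewrite linearB; congr (_ - _); rewrite linear_sum /=; apply: eq_bigr => i _.
  by rewrite linearZ.
rewrite linformE /kill_forms raddf_sum /=.
under eq_bigr => m _ do
  rewrite comp_mpolyZ comp_mpolyXU -tnth_nth tnth_mktuple scalerBr.
rewrite big_split /= sumrN; apply: (f_equal2 (fun a b : {mpoly F[n]} => a - b)) => //.
under [LHS]eq_bigr => m _ do rewrite scaler_sumr.
rewrite exchange_big /=; apply: eq_bigr => i _; rewrite /pairing scaler_suml.
by apply: eq_bigr => m _; rewrite scalerA.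
Qed.

Lemma kill_forms0 i : kill_forms (linform (c i)) = 0.
Proof.
rewrite kill_formsE (bigD1 i) //= dual eqxx scale1r big1 ?addr0 ?subrr ?raddf0 //.
by move=> j ne; rewrite dual eq_sym (negbTE ne) scale0r.
Qed.

(** The polynomials congruent to their image modulo the [c i] are closed under
    sums and products, and they contain the constants and the variables. *)
Lemma kill_forms_sub p :
  exists t : I -> {mpoly F[n]}, p = kill_forms p + \sum_i t i * linform (c i).
Proof.
pose Q p := exists t : I -> {mpoly F[n]},
  p = kill_forms p + \sum_i t i * linform (c i).
have Qc a : Q a%:MP.
  exists (fun=> 0); rewrite /kill_forms comp_mpolyC big1 ?addr0 // => i _.
  by rewrite mul0r.
have QD p1 p2 : Q p1 -> Q p2 -> Q (p1 + p2).
  move=> [t1 h1] [t2 h2]; exists (fun i => t1 i + t2 i).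
  under eq_bigr do rewrite mulrDl.
  by rewrite big_split /= {1}h1 {1}h2 /kill_forms raddfD /= addrACA.
have QM p1 p2 : Q p1 -> Q p2 -> Q (p1 * p2).
  move=> [t1 h1] [t2 h2].
  exists (fun i => t1 i * p2 + kill_forms p1 * t2 i).
  under eq_bigr do rewrite mulrDl -mulrA (mulrC p2) mulrA -(mulrA _ (t2 _)).
  rewrite big_split /= -mulr_suml -mulr_sumr kill_formsM.
  move: (\sum_i t1 i * linform (c i)) h1 => u1 h1.
  move: (\sum_i t2 i * linform (c i)) h2 => u2 h2.
  have -> : u1 = p1 - kill_forms p1 by rewrite {1}h1 addrC addKr.
  have -> : u2 = p2 - kill_forms p2 by rewrite {1}h2 addrC addKr.
  by ring.
have QX m : Q 'X_m.
  exists (fun i => (al i 0 m)%:MP).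
  rewrite /kill_forms comp_mpolyXU -tnth_nth tnth_mktuple.
  under [X in _ + X]eq_bigr do rewrite mul_mpolyC.
  by rewrite subrK.
elim/mpolyind: p => [|a m p _ _ Qp]; first by rewrite -mpolyC0; apply: Qc.
apply: QD Qp; rewrite -mul_mpolyC; apply: (QM); first exact: Qc.
rewrite mpolyXE_id; apply: (big_ind Q) => [||i _]; [exact: (Qc 1)|exact: QM|].
by elim: (m i) => [|e IH]; [exact: (Qc 1)|rewrite exprS; apply: QM].
Qed.

(** The ideal generated by independent linear forms is prime, since it is the
    kernel of an endomorphism of a domain; [d] is a form outside it. *)
Lemma linforms_prime d p (t : I -> {mpoly F[n]}) :
  d != \sum_i pairing d (al i) *: c i ->
  linform d * p = \sum_i t i * linform (c i) ->
  exists t' : I -> {mpoly F[n]}, p = \sum_i t' i * linform (c i).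
Proof.
move=> nd h; have [t' ht'] := kill_forms_sub p; exists t'.
suff k0 : kill_forms p = 0 by rewrite {1}ht' k0 add0r.
have : kill_forms (linform d * p) = 0.
  rewrite h /kill_forms raddf_sum big1 //= => i _.
  by rewrite -/(kill_forms _) kill_formsM kill_forms0 mulr0.
move/eqP; rewrite kill_formsM mulf_eq0 kill_formsE linform_eq0 subr_eq0.
by rewrite (negbTE nd) /= => /eqP.
Qed.
End Kill.

Definition form_free2 c1 c2 := forall a1 a2 : F,
  a1 *: c1 + a2 *: c2 = 0 -> a1 = 0 /\ a2 = 0.

Definition form_free3 c1 c2 c3 := forall a1 a2 a3 : F,
  a1 *: c1 + a2 *: c2 + a3 *: c3 = 0 -> [/\ a1 = 0, a2 = 0 & a3 = 0].

Lemma dual1 c : c != 0 -> exists al, pairing c al = 1.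
Proof.
case/rV0Pn => i ci; exists ((c 0 i)^-1 *: delta_mx 0 i).
rewrite linearZ /= /pairing (bigD1 i) //= mxE !eqxx mulr1 big1 ?addr0.
  exact: mulVf.
by move=> j ne; rewrite mxE (negbTE ne) andbF mulr0.
Qed.

Lemma dual2 c1 c2 : form_free2 c1 c2 ->
  exists al be, [/\ pairing c1 al = 1, pairing c1 be = 0,
                    pairing c2 al = 0 & pairing c2 be = 1].
Proof.
move=> fr.
have [a h1] : exists al, pairing c1 al = 1.
  apply: dual1; apply/eqP => c0; have [] := fr 1 0.
    by rewrite c0 scaler0 scale0r addr0.
  by move/eqP; rewrite oner_eq0.
have [b h2] : exists al, pairing (c2 - pairing c2 a *: c1) al = 1.
  apply: dual1; rewrite subr_eq0; apply/eqP => e.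
  have [] := fr (- pairing c2 a) 1; first by rewrite {2}e scale1r scaleNr addNr.
  by move=> _ /eqP; rewrite oner_eq0.
have {}h2 : pairing c2 b = 1 + pairing c2 a * pairing c1 b.
  move: h2; rewrite pairingC linearB linearZ /= ![pairing b _]pairingC.
  by move=> /eqP; rewrite subr_eq => /eqP.
pose b' := b - pairing c1 b *: a.
have e1 : pairing c1 b' = 0 by rewrite linearB linearZ /= h1 mulr1 subrr.
have e2 : pairing c2 b' = 1.
  by rewrite linearB linearZ /= h2 mulrC; ring.
exists (a - pairing c2 a *: b'), b'; split=> //.
  by rewrite linearB linearZ /= e1 mulr0 subr0.
by rewrite linearB linearZ /= e2 mulr1 subrr.
Qed.

Lemma linform_regular2 c1 c2 p q : form_free2 c1 c2 ->
  linform c2 * p = q * linform c1 -> exists t, p = t * linform c1.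
Proof.
move=> fr e; have [al [_ [h1 _ h2 _]]] := dual2 fr.
have dual (i j : 'I_1) : pairing c1 al = (i == j)%:R.
  by rewrite !ord1 eqxx.
case: (@linforms_prime 'I_1 (fun=> c1) (fun=> al) dual c2 p (fun=> q)).
- rewrite big_ord1 h2 scale0r; apply/eqP => c0.
  have [] := fr 0 1; first by rewrite c0 scaler0 scale0r addr0.
  by move=> _ /eqP; rewrite oner_eq0.
- by rewrite big_ord1.
- by move=> t; rewrite big_ord1; exists (t ord0).
Qed.

Lemma form_free3_2 c1 c2 c3 : form_free3 c1 c2 c3 -> form_free2 c1 c2.
Proof.
by move=> fr a1 a2 e; have [] := fr a1 a2 0; rewrite // scale0r addr0.
Qed.

Lemma linform_regular3 c1 c2 c3 p q1 q2 : form_free3 c1 c2 c3 ->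
  linform c3 * p = q1 * linform c1 + q2 * linform c2 ->
  exists t1 t2, p = t1 * linform c1 + t2 * linform c2.
Proof.
move=> fr e; have [al [be [h1 h2 h3 h4]]] := dual2 (form_free3_2 fr).
pose c (i : 'I_2) := if i == 0 then c1 else c2.
pose d (i : 'I_2) := if i == 0 then al else be.
have dual i j : pairing (c i) (d j) = (i == j)%:R.
  by case: i j => [[|[|//]] ?] [[|[|//]] ?].
case: (@linforms_prime _ c d dual c3 p (fun i => if i == 0 then q1 else q2)).
- rewrite !big_ord_recl big_ord0 addr0 /c /d /=; apply/eqP => e3.
  have [] := fr (pairing c3 al) (pairing c3 be) (-1).
    by rewrite scaleN1r {3}e3 subrr.
  by move=> _ _ /eqP; rewrite oppr_eq0 oner_eq0.
- by rewrite !big_ord_recl big_ord0 addr0.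
- move=> t; rewrite !big_ord_recl big_ord0 addr0 => ->.
  by exists (t ord0), (t (lift ord0 ord0)).
Qed.

(** Cancels the regular element [linform c'] modulo one factor [linform c] at a
    time. *)
Lemma linform_regular_exp c c' p N : form_free2 c c' ->
  (exists h, linform c' * p = h * linform c ^+ N) ->
  exists h, p = h * linform c ^+ N.
Proof.
move=> fr; elim: N p => [|N IH] p; first by exists p; rewrite expr0 mulr1.
case=> h; rewrite exprSr mulrA => e; have [p' ep] := linform_regular2 fr e.
have c0 : linform c != 0.
  rewrite linform_eq0; apply/eqP => c0; have [] := fr 1 0.
    by rewrite c0 scaler0 scale0r addr0.
  by move/eqP; rewrite oner_eq0.
have [|h' e'] := IH p'.
  by exists h; apply: (mulIf c0); rewrite -e ep mulrA.
by exists h'; rewrite ep e' mulrA.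
Qed.

End LinearForms.

(** A nonzero form proportional to both [c1] and [c2] would make these
    dependent. *)
Lemma form_free2_alt (F : fieldType) n (c1 c2 d : 'rV[F]_n) :
  form_free2 c1 c2 -> d != 0 -> form_free2 d c1 \/ form_free2 d c2.
Proof.
move=> fr d0.
have key c : c != 0 -> form_free2 d c \/ exists2 k, k != 0 & d = k *: c.
  move=> c0; case: (pselect (form_free2 d c)) => [|nf]; [by left|right].
  have [a1 /existsNP[a2 /not_implyP[e ne]]] := (existsNP _).2 nf.
  have [a10|a10] := eqVneq a1 0.
    case: ne; split=> //; move: e; rewrite a10 scale0r add0r => /eqP.
    by rewrite scaler_eq0 (negbTE c0) orbF => /eqP.
  have ed : d = (- (a1^-1 * a2)) *: c.
    have e' : a1 *: d = - (a2 *: c) by apply/eqP; rewrite -addr_eq0 e.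
    by rewrite scaleNr -scalerA -scalerN -e' scalerA mulVf // scale1r.
  exists (- (a1^-1 * a2)) => //; apply: contraNneq d0 => k0.
  by rewrite ed k0 scale0r.
have c10 : c1 != 0.
  apply/eqP => c0; have [] := fr 1 0; first by rewrite c0 scaler0 scale0r addr0.
  by move/eqP; rewrite oner_eq0.
have c20 : c2 != 0.
  apply/eqP => c0; have [] := fr 0 1; first by rewrite c0 scaler0 scale0r addr0.
  by move=> _ /eqP; rewrite oner_eq0.
have [|[k k0 e1]] := key _ c10; first by left.
have [|[k' k'0 e2]] := key _ c20; first by right.
have [|ek _] := fr k (- k'); first by rewrite scaleNr -e1 -e2 subrr.
by rewrite ek eqxx in k0.
Qed.

(** * Gluing solutions of jump problems over a free spline module *)

Definition free_family (A : nzRingType) (M : lmodType A) (N : M -> Prop)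
    m (b : 'I_m -> M) : Prop :=
  (forall a : 'I_m -> A, \sum_i a i *: b i = 0 -> forall i, a i = 0) /\
  (forall x, N x <-> exists a : 'I_m -> A, x = \sum_i a i *: b i).

Section Gluing.
Variables (F : fieldType) (n : nat) (X Phi : finType) (inc : Phi -> pred X).
Variables (c : Phi -> 'rV[F]_n) (N : nat).
Hypothesis c_neq0 : forall T, c T != 0.
Local Notation poly := {mpoly F[n]}.
Local Notation tuples := {ffun X -> poly^o}.
(** The value of [f] seen in the polynomial ring rather than in its regular
    module; this keeps ring computations away from the module structure. *)
Definition ev (f : tuples) (S : X) : poly := f S.

Lemma evD f g S : ev (f + g) S = ev f S + ev g S.
Proof. by rewrite /ev ffunE. Qed.
Lemma evN f S : ev (- f) S = - ev f S.
Proof. by rewrite /ev ffunE. Qed.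
Lemma evZ (a : poly) f S : ev (a *: f) S = a * ev f S.
Proof. by rewrite /ev ffunE. Qed.
Lemma ev_sum m (a : 'I_m -> poly) (b : 'I_m -> tuples) S :
  ev (\sum_i a i *: b i) S = \sum_i a i * ev (b i) S.
Proof.
elim/big_rec2: _ => [|i y1 y2 _ <-]; first by rewrite /ev ffunE.
by rewrite evD evZ.
Qed.

Implicit Types (u f : tuples) (T : Phi) (z : X -> Phi -> poly).

Definition facet_dvd T (p : poly) := exists h, p = h * linform (c T) ^+ N.

Lemma facet_dvd0 T : facet_dvd T 0.
Proof. by exists 0; rewrite mul0r. Qed.

Lemma facet_dvdD T p q : facet_dvd T p -> facet_dvd T q -> facet_dvd T (p + q).
Proof. by move=> [h ->] [h' ->]; exists (h + h'); rewrite mulrDl. Qed.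

Lemma facet_dvdM T p q : facet_dvd T q -> facet_dvd T (p * q).
Proof. by move=> [h ->]; exists (p * h); rewrite mulrA. Qed.

Lemma facet_dvdN T p : facet_dvd T p -> facet_dvd T (- p).
Proof. by move=> [h ->]; exists (- h); rewrite mulNr. Qed.

Lemma facet_dvdB T p q : facet_dvd T p -> facet_dvd T q -> facet_dvd T (p - q).
Proof. by move=> hp hq; apply: facet_dvdD hp _; apply: facet_dvdN. Qed.

Definition spline f := forall T S1 S2, inc T S1 -> inc T S2 ->
  facet_dvd T (ev f S1 - ev f S2).

(** [z S T] prescribes the jump at [T] seen from the cell [S]: [u] solves the
    problem for [a] if adding [a * z] makes it satisfy the spline condition at [T]. *)
Definition jumps (a : poly) z T u := forall S1 S2, inc T S1 -> inc T S2 ->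
  facet_dvd T (ev u S1 + a * z S1 T - (ev u S2 + a * z S2 T)).

(** The ideal of the [a] with a solvable jump problem has depth at least three:
    the differences of the three solutions form a Koszul cocycle of splines, and
    over the regular sequence of three independent forms a cocycle with values in
    a free module is a coboundary. *)
Lemma jumps_koszul m (b : 'I_m -> tuples) z a c1 c2 c3 (u1 u2 u3 : tuples) :
  free_family spline b -> form_free3 c1 c2 c3 ->
  (forall T, jumps (linform c1 * a) z T u1) ->
  (forall T, jumps (linform c2 * a) z T u2) ->
  (forall T, jumps (linform c3 * a) z T u3) ->
  exists u, forall T, jumps a z T u.
Proof.
move=> [bfree bspan] fr.
have reg3 := linform_regular3 fr; have frr := form_free3_2 fr.
have reg2 p q := @linform_regular2 _ _ c1 c2 p q frr.
have rexp T p : facet_dvd T (linform c1 * p) -> facet_dvd T (linform c2 * p) ->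
    facet_dvd T p.
  move=> d1 d2; have [f|f] := form_free2_alt frr (c_neq0 T).
    exact: linform_regular_exp f d1.
  exact: linform_regular_exp f d2.
have x10 : linform c1 != 0.
  rewrite linform_eq0; apply/eqP => c0; have [] := frr 1 0.
    by rewrite c0 scaler0 scale0r addr0.
  by move/eqP; rewrite oner_eq0.
move: (linform c1) (linform c2) (linform c3) reg3 reg2 rexp x10 {fr frr}.
move=> x1 x2 x3 reg3 reg2 rexp x10 h1 h2 h3.
have spl y1 y2 (v1 v2 : tuples) : (forall T, jumps (y1 * a) z T v1) ->
    (forall T, jumps (y2 * a) z T v2) -> spline (y2 *: v1 - y1 *: v2).
  move=> k1 k2 T S1 S2 i1 i2.
  have := facet_dvdB (facet_dvdM y2 (k1 T _ _ i1 i2)) (facet_dvdM y1 (k2 T _ _ i1 i2)).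
  by congr facet_dvd; rewrite !evD !evN !evZ; ring.
have spl' y1 y2 (v1 v2 : tuples) : (forall T, jumps (y1 * a) z T v1) ->
    (forall T, jumps (y2 * a) z T v2) -> exists A : 'I_m -> poly,
    forall S, y2 * ev v1 S - y1 * ev v2 S = \sum_i A i * ev (b i) S.
  move=> k1 k2; have [A e] := (bspan _).1 (spl _ _ _ _ k1 k2).
  by exists A => S; rewrite -ev_sum -e evD evN !evZ.
have [A3 e3] := spl' _ _ _ _ h1 h2.
have [A2 e2] := spl' _ _ _ _ h1 h3.
have [A1 e1] := spl' _ _ _ _ h2 h3.
(* The Koszul relation, read off in coordinates by independence of the basis. *)
have kos i : x3 * A3 i = - A1 i * x1 + A2 i * x2.
  have : x3 * A3 i - A2 i * x2 + A1 i * x1 = 0.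
    apply: (bfree (fun i => x3 * A3 i - A2 i * x2 + A1 i * x1)).
    apply/ffunP => S; rewrite -/(ev _ S) ev_sum ffunE.
    transitivity (x3 * (x2 * ev u1 S - x1 * ev u2 S)
       - x2 * (x3 * ev u1 S - x1 * ev u3 S) + x1 * (x3 * ev u2 S - x2 * ev u3 S)).
      rewrite e1 e2 e3 !mulr_sumr -sumrB -big_split /=; apply: eq_bigr => j _.
      by move: (ev _ _); move=> ?; ring.
    by ring.
  by move=> h; apply: subr0_eq; rewrite -[RHS]h; ring.
have [t ht] : exists t : 'I_m -> poly * poly, forall i, A3 i = (t i).1 * x1 + (t i).2 * x2.
  have key i : exists t : poly * poly, A3 i = t.1 * x1 + t.2 * x2.
    by have [t1 [t2 e]] := reg3 _ _ _ (kos i); exists (t1, t2).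
  by have [t ht] := fin_all_exists key; exists t.
have [p evp sp] : exists2 p, forall S, ev p S = \sum_i (t i).2 * ev (b i) S & spline p.
  exists (\sum_i (t i).2 *: b i) => [S|]; first exact: ev_sum.
  by apply/bspan; exists (fun i => (t i).2).
have [q evq sq] : exists2 q, forall S, ev q S = \sum_i (t i).1 * ev (b i) S & spline q.
  exists (\sum_i (t i).1 *: b i) => [S|]; first exact: ev_sum.
  by apply/bspan; exists (fun i => (t i).1).
(* The splines p and q correct u1 and u2 to multiples w x1 and w x2 of one tuple w. *)
have epq S : x2 * (ev u1 S - ev p S) = (ev u2 S + ev q S) * x1.
  rewrite evp evq.
  have := e3 S.
  have -> : \sum_i A3 i * ev (b i) S =
    x1 * (\sum_i (t i).1 * ev (b i) S) + x2 * (\sum_i (t i).2 * ev (b i) S).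
    rewrite !mulr_sumr -big_split /=; apply: eq_bigr => i _; rewrite ht.
    by move: (ev _ _); move=> ?; ring.
  move: (\sum_i _) (\sum_i _) => s1 s2 e; apply: subr0_eq.
  by move/eqP: e; rewrite -subr_eq0 => /eqP <-; ring.
have [w hw] : exists w : X -> poly, forall S, ev u1 S - ev p S = w S * x1.
  by have [w hw] := fin_all_exists (fun S => reg2 _ _ (epq S)); exists w.
have hw2 S : ev u2 S + ev q S = w S * x2.
  by apply: (mulIf x10); rewrite -epq hw; ring.
exists [ffun S => w S] => T S1 S2 i1 i2.
have evw S : ev [ffun S => w S] S = w S by rewrite /ev ffunE.
rewrite !evw.
apply: rexp.
  have := facet_dvdB (h1 T _ _ i1 i2) (sp T _ _ i1 i2); congr facet_dvd.
  transitivity (w S1 * x1 - w S2 * x1 + x1 * a * (z S1 T - z S2 T)); last by ring.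
  by rewrite -!hw; ring.
have := facet_dvdD (h2 T _ _ i1 i2) (sq T _ _ i1 i2); congr facet_dvd.
transitivity (w S1 * x2 - w S2 * x2 + x2 * a * (z S1 T - z S2 T)); last by ring.
by rewrite -!hw2; ring.
Qed.

(** By induction on the total amount by which the exponents fall short of [N], the
    problem multiplied by any product of powers of the forms is solvable: if
    three independent forms have exponents below [N], [jumps_koszul] applies, and
    if not, then the hypothesis applies to the facets with exponents below [N],
    while at the others the right-hand side is divisible by the required power. *)
Lemma gluing m (b : 'I_m -> tuples) z :
  free_family spline b ->
  (forall U : pred Phi,
     (forall T1 T2 T3, U T1 -> U T2 -> U T3 -> ~ form_free3 (c T1) (c T2) (c T3)) ->
     exists u, forall T, U T -> jumps 1 z T u) ->
  exists u, forall T, jumps 1 z T u.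
Proof.
move=> bfree loc.
pose a (e : Phi -> nat) : poly := \prod_T linform (c T) ^+ e T.
suff key M : forall e, (\sum_T (N - e T) <= M)%N -> exists u, forall T, jumps (a e) z T u.
  have [u hu] := key _ (fun=> 0%N) (leqnn _); exists u.
  by move: hu; rewrite /a big1.
elim: M => [|M IH] e le.
  have eN T : (N <= e T)%N.
    by move: le; rewrite leqn0 sum_nat_eq0 => /forallP /(_ T); rewrite subn_eq0.
  exists 0 => T S1 S2 i1 i2; rewrite /a (bigD1 T) //= -(subnK (eN T)) exprD.
  set y := \prod_(_ | _) _; set x := linform (c T).
  by exists (y * x ^+ (e T - N) * (z S1 T - z S2 T)); rewrite /ev !ffunE; ring.
case: (pselect (exists T1 T2 T3, [/\ (e T1 < N)%N, (e T2 < N)%N, (e T3 < N)%N &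
    form_free3 (c T1) (c T2) (c T3)])) => [[T1 [T2 [T3 [l1 l2 l3 fr]]]]|nfr].
  (* Raising an exponent that is below N decreases the deficit. *)
  have step T0 : (e T0 < N)%N ->
      exists u, forall T, jumps (linform (c T0) * a e) z T u.
    move=> l0; pose e' T := (e T + (T == T0))%N.
    have -> : linform (c T0) * a e = a e'.
      rewrite /a (bigD1 T0) //= [RHS](bigD1 T0) //= /e' eqxx addn1 exprS mulrA.
      by congr (_ * _); apply: eq_bigr => T /negbTE ->; rewrite addn0.
    apply: IH; move: le; rewrite (bigD1 T0) //= [X in _ -> (X <= _)%N](bigD1 T0) //=.
    rewrite {1}/e' eqxx.
    have -> : (\sum_(T | T != T0) (N - e' T) = \sum_(T | T != T0) (N - e T))%N.
      by apply: eq_bigr => T /negbTE ne; rewrite /e' ne addn0.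
    move: (\sum_(_ | _) _)%N => w; lia.
  have [u1 h1] := step _ l1; have [u2 h2] := step _ l2; have [u3 h3] := step _ l3.
  exact: jumps_koszul bfree fr h1 h2 h3.
have [|u hu] := loc (fun T => (e T < N)%N).
  by move=> T1 T2 T3 l1 l2 l3 fr; apply: nfr; exists T1, T2, T3.
exists (a e *: u) => T S1 S2 i1 i2; rewrite !evZ.
have [lt|ge] := ltnP (e T) N.
  have := facet_dvdM (a e) (hu T lt _ _ i1 i2); congr facet_dvd; ring.
rewrite /a (bigD1 T) //= -(subnK ge) exprD.
set y := \prod_(_ | _) _; set x := linform (c T).
exists (y * x ^+ (e T - N) * (ev u S1 + z S1 T - (ev u S2 + z S2 T))); ring.
Qed.

End Gluing.

(** * Free submodules and finite bases *)

Section FreeFamily.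
Variables (A : nzRingType) (M : lmodType A).
Implicit Types (N : set M) (B : set M).

(** Linear combinations in [lin_span] range over arbitrary duplicate-free
    sequences; this lets two of them be compared over a common one. *)
Lemma sum_widen (r s : seq M) (a : M -> A) :
  {subset r <= s} -> uniq r -> uniq s ->
  \sum_(b <- r) a b *: b = \sum_(b <- s) (if b \in r then a b else 0) *: b.
Proof.
move=> rs ur us.
rewrite [RHS](eq_bigr (fun b => if b \in r then a b *: b else 0)); last first.
  by move=> b _; case: ifP; rewrite ?scale0r.
rewrite -big_mkcond /= -[RHS]big_filter; apply: perm_big; apply: uniq_perm => //.
  exact: filter_uniq.
by move=> x; rewrite mem_filter; case: (boolP (x \in r)) => //= /rs ->.
Qed.

Lemma free_family_submodule N m (b : 'I_m -> M) :
  free_family N b -> free_submodule N.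
Proof.
move=> [bfree bspan].
have binj : injective b.
  move=> i j eij; apply/eqP/contraT => ne.
  have e : \sum_l ((l == i)%:R - (l == j)%:R) *: b l = 0.
    have ne' : j != i by rewrite eq_sym.
    rewrite (bigD1 i) //= (bigD1 j) //= !eqxx (negbTE ne) (negbTE ne').
    rewrite subr0 sub0r scale1r scaleN1r eij addrA subrr add0r big1 //.
    by move=> l /andP[/negbTE -> /negbTE ->]; rewrite subrr scale0r.
  have /eqP := bfree (fun l => (l == i)%:R - (l == j)%:R) e i.
  by rewrite eqxx (negbTE ne) subr0 oner_eq0.
pose s := codom b.
have us : uniq s by rewrite map_inj_uniq ?enum_uniq.
have sum_s (f : M -> M) : \sum_(x <- s) f x = \sum_i f (b i).
  by rewrite big_map big_enum.
exists [set x | exists i, x = b i]%classic; split.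
  move=> r a ur rB e x xr.
  have rs : {subset r <= s} by move=> y /rB [i ->]; apply: codom_f.
  rewrite (@sum_widen _ s) // sum_s in e.
  have [i xi] := rB _ xr.
  by have := bfree (fun i => if b i \in r then a (b i) else 0) e i; rewrite -xi xr.
apply/seteqP; split=> x.
  move=> [r [a [ur rB ->]]].
  have rs : {subset r <= s} by move=> y /rB [i ->]; apply: codom_f.
  rewrite (@sum_widen _ s) // sum_s; apply/bspan.
  by exists (fun i => if b i \in r then a (b i) else 0).
move/bspan => [a ->].
exists s, (fun x => oapp a 0 [pick i | b i == x]); split=> //.
  by move=> y /codomP[i ->]; exists i.
rewrite sum_s; apply: eq_bigr => i _; case: pickP => [j /eqP/binj -> //|].
by move=> /(_ i); rewrite eqxx.
Qed.

(** Finitely many basis elements suffice to express the [g i]. Any further basis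
    element [x] would satisfy a relation, because [Q *: x] is already a combination
    of the others. *)
Lemma free_submodule_family N p (g : 'I_p -> M) (Q : A) : Q != 0 ->
  (forall i, N (g i)) ->
  (forall x, N x -> exists a : 'I_p -> A, Q *: x = \sum_i a i *: g i) ->
  free_submodule N -> exists m (b : 'I_m -> M), free_family N b.
Proof.
move=> Q0 Ng gen [B [Bfree BN]].
have /fin_all_exists[s hs] : forall i, exists s : seq M, [/\ uniq s,
    (forall x, x \in s -> B x) & exists a : M -> A, g i = \sum_(x <- s) a x *: x].
  move=> i; have := Ng i; rewrite -BN => -[s [a [us sB e]]].
  by exists s; split=> //; exists a.
pose r := undup (flatten (codom s)).
have ur : uniq r := undup_uniq _.
have rB x : x \in r -> B x.
  by rewrite mem_undup => /flattenP[t /codomP[i ->]]; have [_ + _] := hs i; apply.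
have /fin_all_exists[c hc] : forall i, exists a : M -> A,
    g i = \sum_(x <- r) a x *: x.
  move=> i; have [us _ [a ->]] := hs i.
  exists (fun x => if x \in s i then a x else 0); apply: sum_widen => // x xs.
  by rewrite mem_undup; apply/flattenP; exists (s i) => //; apply: codom_f.
have Br x : B x -> x \in r.
  move=> Bx; apply/negP => /negP xr.
  have Nx : N x.
    rewrite -BN; exists [:: x], (fun=> 1); split=> //.
      by move=> y; rewrite inE => /eqP ->.
    by rewrite big_seq1 scale1r.
  have [a e] := gen x Nx.
  have := Bfree (x :: r) (fun y => if y == x then Q else - \sum_i a i * c i y).
  move=> /(_ _ _ _ x); rewrite eqxx => H; move: Q0; rewrite H ?eqxx //=.
  - by rewrite xr.
  - by move=> y; rewrite inE => /predU1P[->|/rB].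
  - rewrite big_cons eqxx e.
    transitivity (\sum_i a i *: g i + \sum_(y <- r) (- \sum_i a i * c i y) *: y).
      congr (_ + _); rewrite big_seq [RHS]big_seq; apply: eq_bigr => y yr.
      by case: eqP => // yx; rewrite -yx yr in xr.
    under [X in _ + X]eq_bigr do rewrite scaleNr scaler_suml.
    rewrite sumrN exchange_big /= -sumrB big1 // => i _.
    rewrite {1}hc scaler_sumr -sumrB big1 // => y _.
    by rewrite scalerA subrr.
  - exact: mem_head.
have sum_r (f : M -> A) : \sum_(x <- r) f x *: x = \sum_(i < size r) f r`_i *: r`_i.
  by rewrite (big_nth 0) big_mkord.
exists (size r), (fun i => r`_i); split.
  move=> a e i.
  pose f x := oapp a 0 (insub (index x r)).
  have fE (j : 'I_(size r)) : f r`_j = a j.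
    by rewrite /f index_uniq // valK.
  rewrite -fE; apply: (Bfree r) => //; last exact: mem_nth.
  by rewrite sum_r -[RHS]e; apply: eq_bigr => j _; rewrite fE.
move=> x; split; rewrite -BN.
  move=> [t [a [ut tB ->]]].
  rewrite (@sum_widen t r) ?sum_r //; first by eexists.
  by move=> y /tB /Br.
move=> [a ->].
pose f x := oapp a 0 (insub (index x r)).
exists r, f; split=> //; rewrite sum_r; apply: eq_bigr => j _.
by rewrite /f index_uniq // valK.
Qed.
End FreeFamily.

(** * Graded projective submodules are free *)

Section Graded.
Variables (F : fieldType) (n : nat) (X : finType).
Local Notation poly := {mpoly F[n]}.
Local Notation tuples := {ffun X -> poly^o}.
Implicit Types (f g : tuples) (a p q : poly).

(** The component of degree [e] of a product [p * q] with [q] homogeneous of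
    degree [d] is [comp_above e d p * q]. *)
Definition comp_above e d p : poly :=
  if (d <= e)%N then pihomog mdeg (e - d) p else 0.

Lemma comp_above_homog e d p : comp_above e d p \is (e - d).-homog.
Proof. by rewrite /comp_above; case: ifP => _; rewrite ?pihomogP ?rpred0. Qed.

Lemma pihomogM e d a p : p \is d.-homog ->
  pihomog mdeg e (a * p) = comp_above e d a * p.
Proof.
move=> hp; rewrite /comp_above; elim/mpolyind: a => [|k m a _ _ IH].
  by rewrite mul0r pihomog0; case: ifP; rewrite ?pihomog0 mul0r.
rewrite mulrDl pihomogD IH.
have hm : 'X_[m] * p \is (mdeg m + d).-homog.
  by apply: dhomogM => //; rewrite dhomogX.
suff -> : pihomog mdeg e (k *: 'X_[m] * p) =
    (if (d <= e)%N then pihomog mdeg (e - d) (k *: 'X_[m]) else 0) * p.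
  by case: ifP; rewrite -mulrDl ?addr0 // pihomogD.
rewrite -scalerAl linearZ /=; have [le|lt] := leqP d e.
  rewrite linearZ /= -scalerAl; congr (_ *: _).
  rewrite pihomogX; case: eqP => [em|ne].
    by rewrite pihomog_dE //; move: hm; rewrite em subnK.
  rewrite mul0r; apply: pihomog_ne0 hm.
  by apply/eqP => h; apply: ne; rewrite -h addnK.
rewrite mul0r; rewrite (@pihomog_ne0 _ _ _ _ _ _ _ hm) ?scaler0 //.
by apply/eqP; lia.
Qed.

Lemma homog0_const p : p \is 0.-homog -> p = (p@_0)%:MP.
Proof.
move=> /dhomogP hp; apply/mpolyP => m; rewrite mcoeffC.
have [->|m0] := eqVneq 0%MM m; first by rewrite mulr1.
rewrite mulr0; apply/eqP; rewrite mcoeff_eq0; apply: contra m0 => /hp /= md.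
by rewrite eq_sym -mdeg_eq0 md.
Qed.

Lemma comp_above_all0 d a : (forall e, comp_above e d a = 0) -> a = 0.
Proof.
move=> h; rewrite (pihomog_partitionE (leqnn (mmeasure mdeg a))) big1 // => e _.
by have := h (e + d)%N; rewrite /comp_above leq_addl addnK.
Qed.

Definition hcomp d f : tuples := [ffun S => pihomog mdeg d (ev f S)].

Lemma ev_hcomp d f S : ev (hcomp d f) S = pihomog mdeg d (ev f S).
Proof. by rewrite /ev ffunE. Qed.

Lemma ev_inj f g : (forall S, ev f S = ev g S) -> f = g.
Proof. by move=> h; apply/ffunP => S; apply: h. Qed.

Definition submodule (P : tuples -> Prop) :=
  forall m (a : 'I_m -> poly) (f : 'I_m -> tuples),
    (forall i, P (f i)) -> P (\sum_i a i *: f i).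

Definition generates (P : tuples -> Prop) m (g : 'I_m -> tuples) :=
  (forall i, P (g i)) /\
  forall f, P f -> exists a : 'I_m -> poly, f = \sum_i a i *: g i.

(** The dual basis criterion: a submodule generated by the [g i] is projective
    exactly when such coordinate functionals exist. *)
Definition dual_basis (P : tuples -> Prop) m (g : 'I_m -> tuples)
    (ka : 'I_m -> tuples -> poly) :=
  (forall f, P f -> f = \sum_i ka i f *: g i) /\
  (forall l k (a : 'I_k -> poly) (f : 'I_k -> tuples), (forall i, P (f i)) ->
     ka l (\sum_i a i *: f i) = \sum_i a i * ka l (f i)).

(** Projectivity does not depend on the generating family, so the family may be
    replaced by a minimal homogeneous one. *)
Lemma dual_basis_transfer P m (g : 'I_m -> tuples) ka m' (g' : 'I_m' -> tuples) :
  (forall i, P (g i)) -> dual_basis P g ka -> generates P g' ->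
  exists ka', dual_basis P g' ka'.
Proof.
move=> Pg [kaE kalin] [_ gen].
have [c hc] := fin_all_exists (fun i => gen (g i) (Pg i)).
exists (fun l f => \sum_i ka i f * c i l); split=> [f Pf|l k a f Pf].
  rewrite {1}(kaE f Pf); under [RHS]eq_bigr do rewrite scaler_suml.
  rewrite exchange_big /=; apply: eq_bigr => i _; rewrite {1}hc scaler_sumr.
  by apply: eq_bigr => l _; rewrite scalerA.
under eq_bigr do rewrite kalin // mulr_suml.
rewrite exchange_big /=; apply: eq_bigr => j _; rewrite mulr_sumr.
by apply: eq_bigr => i _; rewrite mulrA.
Qed.

Definition homog_family m (g : 'I_m -> tuples) (d : 'I_m -> nat) :=
  forall i S, ev (g i) S \is (d i).-homog.

Lemma homog_generators P m (g : 'I_m -> tuples) :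
  (forall f d, P f -> P (hcomp d f)) -> generates P g ->
  exists m' (g' : 'I_m' -> tuples) d, generates P g' /\ homog_family g' d.
Proof.
move=> Pc [Pg gen].
pose D := \max_(i < m) \max_(S : X) mmeasure mdeg (ev (g i) S).
have gE i : g i = \sum_(e < D) hcomp e (g i).
  apply: ev_inj => S.
  have le : (mmeasure mdeg (ev (g i) S) <= D)%N.
    apply: leq_trans (leq_bigmax i).
    exact: (leq_bigmax (F := fun S => mmeasure mdeg (ev (g i) S))).
  rewrite [LHS](pihomog_partitionE le).
  elim/big_rec2: _ => [|e y1 y2 _ ->]; first by rewrite /ev ffunE.
  by rewrite evD ev_hcomp.
pose T : finType := ('I_m * 'I_D)%type.
pose w (j : 'I_#|T|) : 'I_m * 'I_D := enum_val j.
exists #|T|, (fun j => hcomp (w j).2 (g (w j).1)), (fun j => (w j).2 : nat).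
split; last by move=> j S; rewrite ev_hcomp pihomogP.
split=> [j|f Pf]; first exact: Pc.
have [a ->] := gen f Pf; exists (fun j => a (w j).1).
rewrite [RHS](reindex (enum_rank : T -> 'I_#|T|)) /=; last first.
  by apply: onW_bij; apply: enum_rank_bij.
rewrite /w; under [RHS]eq_bigr do rewrite enum_rankK.
rewrite -(pair_bigA _ (fun i (e : 'I_D) => a i *: hcomp e (g i))) /=.
by apply: eq_bigr => i _; rewrite {1}gE scaler_sumr.
Qed.

(** A nonzero constant is a unit, so the relation can be solved for the generator
    that it multiplies. *)
Lemma drop_generator P m (g : 'I_m.+1 -> tuples) (B : 'I_m.+1 -> poly) j l e :
  generates P g -> g j = \sum_i B i *: g i -> B l - (j == l)%:R = e%:MP ->
  e != 0 -> generates P (fun i => g (lift l i)).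
Proof.
move=> [Pg gen] gj Bl e0; split=> [i|f Pf]; first exact: Pg.
pose C i : poly := - (e^-1%:MP * (B i - (j == i)%:R)).
have gl S : ev (g l) S = \sum_i C (lift l i) * ev (g (lift l i)) S.
  have rel : \sum_i (B i - (j == i)%:R) * ev (g i) S = 0.
    transitivity (\sum_i B i * ev (g i) S - \sum_i (j == i)%:R * ev (g i) S).
      by rewrite -sumrB; apply: eq_bigr => i _; rewrite mulrBl.
    rewrite -ev_sum -gj (bigD1 j) //= eqxx mul1r big1 ?addr0 ?subrr // => i.
    by rewrite eq_sym => /negbTE ->; rewrite mul0r.
  move: rel; rewrite (bigD1_ord l) //= Bl => /eqP; rewrite addr_eq0 => /eqP h.
  have -> : ev (g l) S = e^-1%:MP * (e%:MP * ev (g l) S).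
    by rewrite mulrA -mpolyCM mulVf // mul1r.
  rewrite h mulrN mulr_sumr -sumrN; apply: eq_bigr => i _.
  by rewrite /C mulNr mulrA.
have [a fE] := gen f Pf.
exists (fun i => a (lift l i) + a l * C (lift l i)); apply: ev_inj => S.
rewrite fE !ev_sum (bigD1_ord l) //= gl mulr_sumr -big_split /=.
by apply: eq_bigr => i _; rewrite mulrDl mulrA addrC.
Qed.

(** A homogeneous generating family of minimal length is a basis. Expressing each
    generator by coordinate functionals and keeping the homogeneous parts gives a
    matrix [E] with [E j l = 0] if the degree of [g j] is smaller than that of
    [g l], and, by minimality, [E j l] is the Kronecker symbol if the degrees are
    equal. A homogeneous relation is annihilated by this unitriangular matrix, so
    it is trivial. *)
Lemma graded_projective_free P m0 (g0 : 'I_m0 -> tuples) ka0 :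
  submodule P -> (forall f d, P f -> P (hcomp d f)) ->
  (forall i, P (g0 i)) -> dual_basis P g0 ka0 ->
  exists m (b : 'I_m -> tuples), free_family P b.
Proof.
move=> Psub Pc Pg0 dual0.
have gen0 : generates P g0.
  by split=> // f Pf; exists (fun i => ka0 i f); apply: dual0.1.
have [m1 [g1 [d1 [gen1 hom1]]]] := homog_generators Pc gen0.
pose Q m := `[< exists (g : 'I_m -> tuples) d, generates P g /\ homog_family g d >].
have exQ : exists m, Q m by exists m1; apply/asboolP; exists g1, d1.
have [m /asboolP[g [d [gen hom]]] mmin] := ex_minnP exQ.
exists m, g.
have [ka [kaE kalin]] := dual_basis_transfer Pg0 dual0 gen.
have [Pg _] := gen.
pose E j l := comp_above (d j) (d l) (ka l (g j)).
have EE j : g j = \sum_l E j l *: g l.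
  apply: ev_inj => S; rewrite ev_sum.
  have := hom j S; rewrite {1 2}(kaE _ (Pg j)) ev_sum => /pihomog_dE <-.
  rewrite linear_sum /=; apply: eq_bigr => l _.
  by rewrite (pihomogM _ _ (hom l S)).
(* By minimality: another constant would make a generator superfluous. *)
have Econst j l : d j = d l -> E j l = (j == l)%:R.
  move=> djl; apply/eqP; rewrite -subr_eq0; apply/contraT => ne.
  have [e he] : exists e, E j l - (j == l)%:R = e%:MP.
    exists ((E j l)@_0 - (j == l)%:R).
    rewrite mpolyCB -homog0_const; first congr (_ - _).
      by case: eqP; rewrite ?mpolyC1 ?mpolyC0.
    have := comp_above_homog (d j) (d l) (ka l (g j)).
    by have -> : (d j - d l = 0)%N by rewrite djl subnn.
  case: m g d gen hom mmin ka kaE kalin Pg E EE j l djl ne he => [|m].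
    by move=> ? ? ? ? ? ? ? ? ? ? ? [].
  move=> g d gen hom mmin ka kaE kalin Pg E EE j l djl ne he.
  have e0 : e != 0 by apply: contraNneq ne => e0; rewrite he e0 mpolyC0.
  have := mmin m; rewrite ltnn; apply; apply/asboolP.
  exists (fun i => g (lift l i)), (fun i => d (lift l i)); split.
    exact: drop_generator gen (EE j) he e0.
  by move=> i S; apply: hom.
split; last by move=> f; split=> [|[a ->]]; [apply: gen.2|apply: Psub].
move=> a rel.
suff key D i : comp_above D (d i) (a i) = 0.
  by move=> i; apply: (@comp_above_all0 (d i)) => D; apply: key.
pose h j := comp_above D (d j) (a j).
have hrel : \sum_j h j *: g j = 0.
  apply: ev_inj => S; rewrite ev_sum.
  transitivity (pihomog mdeg D (ev (\sum_j a j *: g j) S)).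
    rewrite ev_sum linear_sum /=; apply: eq_bigr => j _.
    by rewrite (pihomogM _ _ (hom j S)).
  by rewrite rel /ev ffunE pihomog0.
(* Apply the functional ka l to the relation and take homogeneous parts. *)
have hE l : (d l <= D)%N -> \sum_j h j * E j l = 0.
  move=> dl; have := kalin l _ h g Pg; rewrite hrel.
  have -> : ka l 0 = 0.
    have := kalin l 0%N (fun=> 0) (fun=> 0); rewrite !big_ord0; apply.
    by case.
  move=> /(congr1 (pihomog mdeg (D - d l))); rewrite pihomog0 linear_sum /=.
  move=> e0; rewrite [RHS]e0; apply: eq_bigr => j _.
  rewrite [in RHS]mulrC (pihomogM _ _ (comp_above_homog D (d j) (a j))) mulrC.
  rewrite -/(h j) /E /comp_above; have [djD|djD] := leqP (d j) D; last first.
    have -> : h j = 0 by rewrite /h /comp_above leqNgt djD.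
    by rewrite !mulr0.
  have -> : (D - d j <= D - d l)%N = (d l <= d j)%N by lia.
  by have -> : (D - d l - (D - d j))%N = (d j - d l)%N by lia.
apply/eqP/contraT => hi.
have := @arg_maxnP _ i (fun l => h l != 0) d hi.
case: arg_maxnP => // l hl lmax _.
have dlD : (d l <= D)%N.
  by rewrite leqNgt; apply: contraNN hl; rewrite /h /comp_above ltnNge => /negbTE ->.
have := hE l dlD; rewrite (bigD1 l) //= Econst // eqxx mulr1 big1 ?addr0.
  by move/eqP; rewrite (negbTE hl).
move=> j jl; have [lt|gt|eq] := ltngtP (d j) (d l).
- by rewrite /E /comp_above leqNgt lt mulr0.
- have [->|hj] := eqVneq (h j) 0; first by rewrite mul0r.
  by have /= := lmax j hj; rewrite /geq /= leqNgt gt.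
- by rewrite Econst // (negbTE jl) mulr0.
Qed.
End Graded.

(** * Homogenized points and the intersection of simplices *)

Section Homogenization.
Variables (R : realType) (k : nat).
Local Notation point := 'rV[R]_k.
Local Notation simplex := {fset 'rV[R]_k}.
Local Notation complex := {fset {fset 'rV[R]_k}}.
Implicit Types (x v p q : point) (F G S T : simplex) (D : complex) (w : point -> R).

Definition hom x : 'rV[R]_k.+1 := \row_i oapp (fun j => x 0 j) 1 (unlift ord0 i).

Lemma hom0 x : hom x 0 ord0 = 1.
Proof. by rewrite mxE unlift_none. Qed.

Lemma hom_lift x j : hom x 0 (lift ord0 j) = x 0 j.
Proof. by rewrite mxE liftK. Qed.

Lemma pairing_hom c x :
  pairing c (hom x) = c 0 ord0 + \sum_(j < k) c 0 (lift ord0 j) * x 0 j.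
Proof.
rewrite /pairing big_ord_recl hom0 mulr1; congr (_ + _).
by apply: eq_bigr => j _; rewrite hom_lift.
Qed.

Lemma sum_hom_weight (s : seq point) w :
  (\sum_(v <- s) w v *: hom v) 0 ord0 = \sum_(v <- s) w v.
Proof. by rewrite summxE; apply: eq_bigr => v _; rewrite mxE hom0 mulr1. Qed.

Lemma sum_homE (s : seq point) w (X : 'rV[R]_k.+1) (a : R) x :
  X 0 ord0 = a -> (forall j, X 0 (lift ord0 j) = x 0 j) ->
  (\sum_(v <- s) w v *: hom v = X <->
   \sum_(v <- s) w v = a /\ \sum_(v <- s) w v *: v = x).
Proof.
move=> Xa Xx.
have e0 := sum_hom_weight s w.
have e1 j : (\sum_(v <- s) w v *: hom v) 0 (lift ord0 j) =
    (\sum_(v <- s) w v *: v) 0 j.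
  by rewrite !summxE; apply: eq_bigr => v _; rewrite !mxE liftK.
split=> [h|[h1 h2]].
  split; first by rewrite -e0 h.
  by apply/rowP => j; rewrite -e1 h.
apply/rowP => i; case: (unliftP ord0 i) => [j ->|->].
  by rewrite e1 h2 Xx.
by rewrite e0 h1 Xa.
Qed.

Lemma sum_hom0 (s : seq point) w : \sum_(v <- s) w v *: hom v = 0 <->
   \sum_(v <- s) w v = 0 /\ \sum_(v <- s) w v *: v = 0.
Proof. by apply: sum_homE => [|j]; rewrite !mxE. Qed.

Lemma sum_hom1 (s : seq point) w x : \sum_(v <- s) w v *: hom v = hom x <->
   \sum_(v <- s) w v = 1 /\ \sum_(v <- s) w v *: v = x.
Proof. by apply: sum_homE => [|j]; rewrite ?hom0 ?hom_lift. Qed.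

Lemma aff_indep_hom F w : aff_indep F -> \sum_(v <- F) w v *: hom v = 0 ->
  forall v, v \in F -> w v = 0.
Proof. by move=> ai /sum_hom0[h1 h2]; apply: ai. Qed.

Lemma conv_hullE F x : conv_hull F x <->
  exists w, (forall v, v \in F -> 0 <= w v) /\ \sum_(v <- F) w v *: hom v = hom x.
Proof.
split=> [[w [w0 w1 wx]]|[w [w0 /sum_hom1[w1 wx]]]]; last by exists w.
by exists w; split=> //; apply/sum_hom1.
Qed.

Lemma sum_fsubset (V : lmodType R) (f : point -> V) F G : F `<=` G ->
  \sum_(v <- F) f v = \sum_(v <- G) (if v \in F then f v else 0).
Proof.
move=> FG; rewrite -big_mkcond -[RHS]big_filter; apply: perm_big.
apply: uniq_perm; rewrite ?filter_uniq ?fset_uniq // => v.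
by rewrite mem_filter; case: (boolP (v \in F)) => //= /(fsubsetP FG) ->.
Qed.

Lemma bary_coords F : aff_indep F -> #|` F| = k.+1 ->
  exists be : point -> 'rV[R]_k.+1,
    (forall X, X = \sum_(v <- F) pairing (be v) X *: hom v) /\
    (forall u v, u \in F -> v \in F -> pairing (be v) (hom u) = (v == u)%:R).
Proof.
move=> ai cF.
pose A := \matrix_(i < k.+1) hom F`_i.
have rowA (i : 'I_k.+1) : row i A = hom F`_i by rewrite rowK.
have sumF (f : point -> 'rV[R]_k.+1) : \sum_(v <- F) f v = \sum_(i < k.+1) f F`_i.
  by rewrite (big_nth 0) big_mkord cF.
have Finj (i : 'I_k.+1) : index F`_i F = i by rewrite index_uniq ?fset_uniq ?cF.
have uA : A \in unitmx.
  rewrite -row_free_unit; apply: inj_row_free => X; rewrite mulmx_sum_row => e.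
  pose w v := oapp (fun i => X 0 i) 0 (insub (index v F) : option 'I_k.+1).
  have wE i : w F`_(i : 'I_k.+1) = X 0 i by rewrite /w Finj valK.
  apply/rowP => i; rewrite mxE -wE; apply: (aff_indep_hom ai); last first.
    by apply: mem_nth; rewrite cF.
  by rewrite sumF -[RHS]e; apply: eq_bigr => j _; rewrite rowA wE.
pose be v := oapp (fun i => \row_j invmx A j i) 0 (insub (index v F) : option 'I_k.+1).
have beE i X : pairing (be F`_(i : 'I_k.+1)) X = (X *m invmx A) 0 i.
  by rewrite /be Finj valK /= mxE; apply: eq_bigr => j _; rewrite mxE mulrC.
have span X : X = \sum_(v <- F) pairing (be v) X *: hom v.
  rewrite sumF -{1}[X](mulmxKV uA) mulmx_sum_row; apply: eq_bigr => i _.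
  by rewrite rowA beE.
exists be; split=> // u v uF vF.
apply/eqP; rewrite -subr_eq0; apply/eqP.
apply: (aff_indep_hom (w := fun v => pairing (be v) (hom u) - (v == u)%:R) ai) => //.
under eq_bigr do rewrite scalerBl.
rewrite sumrB -span (bigD1_seq u) ?fset_uniq //= eqxx scale1r big1 ?addr0 ?subrr //.
by move=> x /negbTE ->; rewrite scale0r.
Qed.

(** Adding a large multiple of the vertices of the common part [E] to both sides
    makes all weights nonnegative without changing the equality. After normalizing,
    both sides describe a point of the two simplices, hence of the common face
    [F `&` G], and barycentric coordinates in [F] are unique. This is the only way
    in which the intersection axiom of a complex is used. *)
Lemma overlap D F G E w w' : simplicial_complex D -> F \in D -> G \in D ->
  E `<=` F -> E `<=` G ->
  (forall v, v \in F -> v \notin E -> 0 <= w v) ->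
  (forall v, v \in G -> v \notin E -> 0 <= w' v) ->
  \sum_(v <- F) w v *: hom v = \sum_(v <- G) w' v *: hom v ->
  forall v, v \in F -> v \notin G -> w v = 0.
Proof.
move=> [DF _ DI] FD GD EF EG w0 w'0 e u uF uG.
have aiF := (DF _ FD).2.
(* A weight large enough to dominate all the given ones. *)
pose M := \sum_(v <- F) `|w v| + \sum_(v <- G) `|w' v|.
have sum_le (H : simplex) (h : point -> R) v : v \in H -> `|h v| <= \sum_(v <- H) `|h v|.
  move=> vH; rewrite (bigD1_seq v) ?fset_uniq //= lerDl.
  by apply: sumr_ge0 => *; apply: normr_ge0.
have sum_ge0 (H : simplex) (h : point -> R) : 0 <= \sum_(v <- H) `|h v|.
  by apply: sumr_ge0 => *; apply: normr_ge0.
have shift (h : point -> R) (H : simplex) : \sum_(v <- H) `|h v| <= M ->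
    (forall v, v \in H -> v \notin E -> 0 <= h v) ->
    forall v, v \in H -> 0 <= h v + (if v \in E then M else 0).
  move=> le h0 v vH; case: ifPn => vE; last by rewrite addr0 h0.
  have := sum_le H h v vH; have := ler_norm (- h v); rewrite normrN; lra.
pose W v := w v + (if v \in E then M else 0).
pose W' v := w' v + (if v \in E then M else 0).
have W0 : forall v, v \in F -> 0 <= W v by apply: shift; rewrite ?lerDl.
have W'0 : forall v, v \in G -> 0 <= W' v by apply: shift; rewrite ?lerDr.
have sumE (H : simplex) : E `<=` H ->
    \sum_(v <- H) (if v \in E then M else 0) *: hom v = \sum_(v <- E) M *: hom v.
  move=> EH; rewrite [RHS](sum_fsubset _ EH); apply: eq_bigr => v _.
  by case: ifP; rewrite ?scale0r.
have {}e : \sum_(v <- F) W v *: hom v = \sum_(v <- G) W' v *: hom v.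
  rewrite /W /W'; under eq_bigr do rewrite scalerDl.
  under [RHS]eq_bigr do rewrite scalerDl.
  by rewrite !big_split /= e !sumE.
have uE : u \notin E by apply: contraNN uG => /(fsubsetP EG).
suff : W u = 0 by rewrite /W (negbTE uE) addr0.
pose t := \sum_(v <- F) W v.
have tE : t = \sum_(v <- G) W' v.
  by rewrite /t -!sum_hom_weight e.
have t_ge0 : 0 <= t by rewrite /t big_seq; apply: sumr_ge0.
have [t0|tn0] := eqVneq t 0.
  have := uF; move: t0; rewrite /t big_seq => /eqP; rewrite psumr_eq0 //.
  by move=> /allP /(_ u uF); rewrite uF /= => /eqP.
pose x := \sum_(v <- F) (W v / t) *: v.
have hx : \sum_(v <- F) (W v / t) *: hom v = hom x.
  by apply/sum_hom1; split=> //; rewrite -mulr_suml divff.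
have cF : conv_hull F x.
  by apply/conv_hullE; exists (fun v => W v / t); split=> // v vF; rewrite divr_ge0 ?W0.
have cG : conv_hull G x.
  apply/conv_hullE; exists (fun v => W' v / t); split=> [v vG|].
    by rewrite divr_ge0 ?W'0.
  rewrite -hx; under eq_bigr do rewrite mulrC -scalerA.
  under [RHS]eq_bigr do rewrite mulrC -scalerA.
  by rewrite -!scaler_sumr e.
have : conv_hull (F `&` G) x by rewrite -DI.
move=> /conv_hullE[w2 [_ hw2]].
have : W u / t - (if u \in F `&` G then w2 u else 0) = 0.
  apply: (aff_indep_hom
    (w := fun u => W u / t - (if u \in F `&` G then w2 u else 0)) aiF) => //.
  under eq_bigr do rewrite scalerBl.
  rewrite sumrB hx -hw2 (sum_fsubset _ (fsubsetIl F G)).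
  rewrite -sumrB big1 // => v _; case: ifP; rewrite ?subrr // scale0r subrr //.
rewrite in_fsetI (negbTE uG) andbF subr0 => /eqP.
by rewrite mulf_eq0 invr_eq0 (negbTE tn0) orbF => /eqP.
Qed.

End Homogenization.

(** * Sectors in the plane transverse to a ridge *)

Lemma fset_extend1 (K : choiceType) (G H : {fset K}) :
  G `<=` H -> #|` H| = #|` G|.+1 -> exists2 p, p \notin G & H = p |` G.
Proof.
move=> GH cH; have := cardfsDS GH; rewrite cH subSnn => /eqP/cardfs1P[p hp].
have : p \in H `\` G by rewrite hp inE.
rewrite in_fsetD => /andP[pG pH]; exists p => //.
apply/eqP; rewrite eq_sym eqEfcard fsubUset fsub1set pH GH /=.
by rewrite cardfsU1 pG cH.
Qed.

Lemma sign_cases (R : realDomainType) (a b a' b' : R) : 0 < a -> 0 < b ->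
  a' <= 0 \/ b' <= 0 -> (b * a' - b' * a < 0 -> a' <= 0) /\
  (0 < b * a' - b' * a -> b' <= 0).
Proof.
move=> a0 b0 h; split=> C0; rewrite leNgt; apply/negP => x0.
  have b'0 : b' <= 0 by case: h => //; rewrite leNgt x0.
  have := mulr_gt0 b0 x0; have := mulr_le0_ge0 b'0 (ltW a0); lra.
have a'0 : a' <= 0 by case: h => //; rewrite [b' <= 0]leNgt x0.
have := mulr_gt0 x0 a0; have := mulr_ge0_le0 (ltW b0) a'0; lra.
Qed.

Section Wedge.
Variables (R : realType) (k : nat).
Local Notation point := 'rV[R]_k.
Local Notation simplex := {fset 'rV[R]_k}.
Local Notation complex := {fset {fset 'rV[R]_k}}.
Implicit Types (x y v p q : point) (F G S T : simplex) (D : complex) (w : point -> R).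

Variables (sigma : simplex) (be : point -> 'rV[R]_k.+1) (p1 p2 : point).
Hypothesis be_span : forall X, X = \sum_(v <- sigma) pairing (be v) X *: hom v.
Hypothesis be_dual : forall u v, u \in sigma -> v \in sigma ->
  pairing (be v) (hom u) = (v == u)%:R.
Hypothesis p1s : p1 \in sigma.
Hypothesis p2s : p2 \in sigma.
Hypothesis p12 : p1 != p2.

(** The face of codimension two opposite to the edge [p1 p2]. The barycentric
    coordinates [lam1] and [lam2] of [sigma] with respect to [p1] and [p2] are
    coordinates on the plane obtained by projecting along it, in which [sigma]
    becomes the first quadrant. *)
Definition ridge := sigma `\ p1 `\ p2.
Local Notation gamma := ridge.
Definition lam1 x := pairing (be p1) (hom x).
Definition lam2 x := pairing (be p2) (hom x).
Definition det2 x y := lam1 x * lam2 y - lam2 x * lam1 y.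

Lemma p1_ridge : p1 \notin gamma. Proof. by rewrite !inE eqxx andbF. Qed.
Lemma p2_ridge : p2 \notin gamma. Proof. by rewrite !inE eqxx. Qed.

Lemma sigmaE : sigma = p1 |` (p2 |` gamma).
Proof.
by rewrite /ridge fsetD1K ?fsetD1K // !inE eq_sym p12.
Qed.

Lemma lam_ridge v : v \in gamma -> lam1 v = 0 /\ lam2 v = 0.
Proof.
rewrite !inE => /and3P[v2 v1 vs]; rewrite /lam1 /lam2 !be_dual //.
by rewrite eq_sym (negbTE v1) eq_sym (negbTE v2).
Qed.

Lemma lam_p1 : lam1 p1 = 1 /\ lam2 p1 = 0.
Proof. by rewrite /lam1 /lam2 !be_dual // eqxx eq_sym (negbTE p12). Qed.

Lemma lam_p2 : lam1 p2 = 0 /\ lam2 p2 = 1.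
Proof. by rewrite /lam1 /lam2 !be_dual // eqxx (negbTE p12). Qed.

Lemma lam_kernel X : pairing (be p1) X = 0 -> pairing (be p2) X = 0 ->
  X = \sum_(v <- gamma) pairing (be v) X *: hom v.
Proof.
move=> h1 h2; rewrite {1}[X]be_span {1}sigmaE big_fsetU1; last first.
  by rewrite in_fset1U (negbTE p12) p1_ridge.
by rewrite big_fsetU1 ?p2_ridge //= h1 h2 !scale0r !add0r.
Qed.

Lemma pairing_sum c F w :
  pairing c (\sum_(v <- F) w v *: hom v) = \sum_(v <- F) w v * pairing c (hom v).
Proof. by rewrite linear_sum; apply: eq_bigr => v _; rewrite linearZ. Qed.

(** The version of [overlap] seen in the transverse plane: equality of the two
    coordinates leaves a difference in the span of the ridge, and weights on the
    ridge are free. *)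
Lemma wedge_overlap D F G w w' : simplicial_complex D -> F \in D -> G \in D ->
  gamma `<=` F -> gamma `<=` G ->
  (forall v, v \in F -> v \notin gamma -> 0 <= w v) ->
  (forall v, v \in G -> v \notin gamma -> 0 <= w' v) ->
  \sum_(v <- F) w v * lam1 v = \sum_(v <- G) w' v * lam1 v ->
  \sum_(v <- F) w v * lam2 v = \sum_(v <- G) w' v * lam2 v ->
  forall v, v \in F -> v \notin G -> w v = 0.
Proof.
move=> sD FD GD gF gG w0 w'0 e1 e2 u uF uG.
pose X := \sum_(v <- F) w v *: hom v - \sum_(v <- G) w' v *: hom v.
have hX : X = \sum_(v <- gamma) pairing (be v) X *: hom v.
  by apply: lam_kernel; rewrite linearB /= !pairing_sum;
    apply/eqP; rewrite subr_eq0; apply/eqP.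
pose z v := if v \in gamma then pairing (be v) X else 0.
have ug : u \notin gamma by apply: contraNN uG => /(fsubsetP gG).
have -> : w u = w u - z u by rewrite /z (negbTE ug) subr0.
apply: (overlap (w := fun v => w v - z v) (w' := w') sD FD GD gF gG) => //.
  by move=> v vF vg; rewrite /z (negbTE vg) subr0 w0.
under eq_bigr do rewrite scalerBl.
rewrite sumrB.
have -> : \sum_(v <- F) z v *: hom v = X.
  rewrite [RHS]hX [RHS](sum_fsubset _ gF); apply: eq_bigr => v _.
  by rewrite /z; case: ifP; rewrite ?scale0r.
by rewrite /X opprB addrC subrK.
Qed.

Definition two_weights q a q' a' : point -> R :=
  fun v => if v == q then a else if v == q' then a' else 0.

Lemma two_weights_ge0 q a q' a' v : 0 <= a -> 0 <= a' -> 0 <= two_weights q a q' a' v.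
Proof. by rewrite /two_weights => ? ?; case: ifP => // _; case: ifP. Qed.

Lemma sum_two_weights0 q a q' a' (f : point -> R) :
  (forall v, v \in gamma -> f v = 0) ->
  \sum_(v <- gamma) two_weights q a q' a' v * f v = 0.
Proof. by move=> f0; rewrite big_seq big1 // => v vg; rewrite f0 // mulr0. Qed.

Lemma sum_two_weights1 q a q' a' (f : point -> R) :
  (forall v, v \in gamma -> f v = 0) -> q \notin gamma ->
  \sum_(v <- q |` gamma) two_weights q a q' a' v * f v = a * f q.
Proof.
by move=> f0 qg; rewrite big_fsetU1 //= sum_two_weights0 // addr0 /two_weights eqxx.
Qed.

Lemma sum_two_weights2 q a q' a' (f : point -> R) :
  (forall v, v \in gamma -> f v = 0) -> q \notin gamma -> q' \notin gamma ->
  q != q' ->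
  \sum_(v <- q |` (q' |` gamma)) two_weights q a q' a' v * f v = a * f q + a' * f q'.
Proof.
move=> f0 qg q'g qq'; rewrite big_fsetU1 ?in_fset1U ?negb_or ?qq' //=.
by rewrite big_fsetU1 //= sum_two_weights0 // addr0 /two_weights eqxx eq_sym (negbTE qq') eqxx.
Qed.

Let lam1_ridge0 v : v \in gamma -> lam1 v = 0. Proof. by case/lam_ridge. Qed.
Let lam2_ridge0 v : v \in gamma -> lam2 v = 0. Proof. by case/lam_ridge. Qed.

(** If the determinant vanished, some nontrivial combination of [q] and [q']
    would lie in the span of the ridge, against affine independence. *)
Lemma det2_neq0 q q' : aff_indep (q |` (q' |` gamma)) ->
  q \notin gamma -> q' \notin gamma -> q != q' -> det2 q q' != 0.
Proof.
move=> ai qg q'g qq'; apply/eqP => d0.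
have key (x y : R) : x * lam1 q + y * lam1 q' = 0 ->
    x * lam2 q + y * lam2 q' = 0 -> x = 0 /\ y = 0.
  move=> e1 e2.
  pose X := x *: hom q + y *: hom q'.
  have hX : X = \sum_(v <- gamma) pairing (be v) X *: hom v.
    by apply: lam_kernel; rewrite linearD /= !linearZ.
  pose w v := if v \in gamma then - pairing (be v) X else two_weights q x q' y v.
  have w0 v : v \in q |` (q' |` gamma) -> w v = 0.
    apply: (aff_indep_hom ai).
    rewrite big_fsetU1 ?in_fset1U ?negb_or ?qq' //= big_fsetU1 //=.
    have -> : \sum_(v <- gamma) w v *: hom v = - X.
      rewrite [in RHS]hX -sumrN big_seq [RHS]big_seq; apply: eq_bigr => u ug.
      by rewrite /w ug scaleNr.
    rewrite /w (negbTE qg) (negbTE q'g) /two_weights eqxx eq_sym (negbTE qq') eqxx.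
    by rewrite addrA subrr.
  have := w0 q; have := w0 q'; rewrite /w (negbTE qg) (negbTE q'g) /two_weights !eqxx.
  rewrite eq_sym (negbTE qq') !inE !eqxx ?orbT /=.
  by move=> h1 h2; rewrite h1 // h2.
have [e1 e2] : lam1 q' = 0 /\ - lam1 q = 0.
  by apply: key; move: d0; rewrite /det2; lra.
have [e3 e4] : lam2 q' = 0 /\ - lam2 q = 0.
  by apply: key; move: d0; rewrite /det2; lra.
have [] : (1 : R) = 0 /\ (0 : R) = 0 by apply: key; lra.
by move=> /eqP; rewrite oner_eq0.
Qed.

Lemma card_ridge : #|` sigma| = #|` gamma|.+2.
Proof.
by rewrite {1}sigmaE !cardfsU1 in_fset1U negb_or p12 p1_ridge p2_ridge.
Qed.

Lemma cell_over_ridge s q r : gamma `<=` s -> #|` s| = #|` sigma| ->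
  q \in s -> r \in s -> q \notin gamma -> r \notin gamma -> q != r ->
  s = q |` (r |` gamma).
Proof.
move=> gs cs qs rs qg rg qr; apply/eqP; rewrite eq_sym eqEfcard.
rewrite !fsubUset !fsub1set qs rs gs /= cs card_ridge !cardfsU1.
by rewrite in_fset1U negb_or qr qg rg.
Qed.

Section Sector.
Variables (D : complex) (T : simplex) (Pa Pb t : R).
Hypothesis D_complex : simplicial_complex D.
Hypothesis sigmaD : sigma \in D.
Hypothesis t_gt0 : 0 < t.
Hypothesis P_outside : Pa < 0 \/ Pb < 0.
Hypothesis dP : Pb - t * Pa != 0.
Hypothesis P_avoids : forall q q', q \notin gamma -> q' \notin gamma -> q != q' ->
  q |` (q' |` gamma) \in D -> q |` gamma != T -> q' |` gamma != T ->
  forall x y c : R, 0 <= x -> 0 <= y -> 0 < c ->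
  x * lam1 q + y * lam1 q' = c * Pa -> x * lam2 q + y * lam2 q' = c * Pb -> False.

(** The open cone spanned by the direction [(1, t)], which points into [sigma],
    and the direction [(Pa, Pb)]. Its two boundary rays cut the plane in two; a
    cell other than [sigma] can only be crossed by the ray through [(Pa, Pb)]. *)
Definition in_sector q :=
  (0 < (lam1 q * Pb - lam2 q * Pa) / (Pb - t * Pa)) &&
  (0 < (lam2 q - t * lam1 q) / (Pb - t * Pa)).

(** If the sector contained [q] and not [q'], the segment joining them would meet
    one of the boundary rays: the first lies inside [sigma], which does not overlap
    with [s], and the second is kept away from [s] by [P_avoids]. *)
Lemma sector_step s q q' : s \in D -> s != sigma -> #|` s| = #|` sigma| ->
  s = q |` (q' |` gamma) -> q \notin gamma -> q' \notin gamma -> q != q' ->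
  q |` gamma != T -> q' |` gamma != T -> in_sector q -> in_sector q'.
Proof.
move=> sD ss cs sE qg q'g qq' qT q'T /andP[a0 b0]; apply/contraT => nW.
have ai : aff_indep (q |` (q' |` gamma)).
  by have [H _ _] := D_complex; rewrite -sE; apply: (H _ sD).2.
have d2 := det2_neq0 ai qg q'g qq'.
have gs : gamma `<=` s by rewrite sE fsubsetU // fsubsetU1 orbT.
move: nW a0 b0; rewrite /in_sector.
set a' := (lam1 q' * _ - _) / _; set b' := (lam2 q' - _) / _.
set a := (lam1 q * _ - _) / _; set b := (lam2 q - _) / _.
have e1 : lam1 q = a + b * Pa by rewrite /a /b; field.
have e2 : lam2 q = a * t + b * Pb by rewrite /a /b; field.
have e1' : lam1 q' = a' + b' * Pa by rewrite /a' /b'; field.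
have e2' : lam2 q' = a' * t + b' * Pb by rewrite /a' /b'; field.
move: a' b' a b e1 e2 e1' e2' => a' b' a b e1 e2 e1' e2' nW a0 b0.
have dE : det2 q q' = - (b * a' - b' * a) * (Pb - t * Pa).
  by rewrite /det2 e1 e2 e1' e2'; ring.
have nW' : a' <= 0 \/ b' <= 0.
  by move: nW; rewrite negb_and -!leNgt => /orP[]; [left|right].
(* The sign of this determinant tells which boundary ray the segment meets. *)
have [C0|C0|C0] := ltgtP (b * a' - b' * a) 0.
- have a'0 : a' <= 0 by exact: (sign_cases a0 b0 nW').1.
  exfalso; apply: (P_avoids qg q'g qq' _ qT q'T (x := - a') (y := a)
    (c := - (b * a' - b' * a))); rewrite -?sE //; try lra.
    by rewrite e1 e1'; ring.
  by rewrite e2 e2'; ring.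
- have b'0 : b' <= 0 by exact: (sign_cases a0 b0 nW').2.
  set C := _ - _ in C0.
  have ov := @wedge_overlap D sigma s (two_weights p1 C p2 (C * t)) (two_weights q (- b') q' b)
    D_complex sigmaD sD _ gs _ _ _ _.
  have gsig : gamma `<=` sigma by rewrite sigmaE fsubsetU // fsubsetU1 orbT.
  have {}ov v : v \in sigma -> v \notin s -> two_weights p1 C p2 (C * t) v = 0.
    apply: ov => //.
    + by move=> u _ _; apply: two_weights_ge0; [exact: ltW|apply: mulr_ge0; exact: ltW].
    + by move=> u _ _; apply: two_weights_ge0; lra.
    + rewrite sE {1}sigmaE !sum_two_weights2 ?p1_ridge ?p2_ridge //.
      by rewrite lam_p1.1 lam_p2.1 e1 e1' /C; ring.
    + rewrite sE {1}sigmaE !sum_two_weights2 ?p1_ridge ?p2_ridge //.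
      by rewrite lam_p1.2 lam_p2.2 e2 e2' /C; ring.
  have p1s' : p1 \in s.
    apply/contraT => /(ov _ p1s); rewrite /two_weights eqxx => C00.
    by rewrite C00 ltxx in C0.
  have p2s' : p2 \in s.
    apply/contraT => /(ov _ p2s); rewrite /two_weights eqxx eq_sym (negbTE p12) => /eqP.
    by rewrite mulf_eq0 !gt_eqF.
  move: ss; rewrite (cell_over_ridge gs cs p1s' p2s' p1_ridge p2_ridge p12).
  by rewrite -sigmaE eqxx.
- by rewrite dE C0 oppr0 mul0r eqxx in d2.
Qed.

(** The direction [(1, t)] lies strictly between [p1] and [p2], and [(Pa, Pb)]
    does not lie between them. *)
Lemma in_sector_p12 : in_sector p1 = ~~ in_sector p2.
Proof.
rewrite /in_sector lam_p1.1 lam_p1.2 lam_p2.1 lam_p2.2.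
rewrite !mul1r !mul0r subr0 sub0r mulr1 sub0r mulr0 subr0 mul1r.
have [neg|pos] : Pb - t * Pa < 0 \/ 0 < Pb - t * Pa.
- by apply/orP; rewrite -neq_lt.
- have i0 : (Pb - t * Pa)^-1 < 0 by rewrite invr_lt0.
  have Pb0 : Pb < 0.
    case: P_outside => // Pa0.
    have : t * Pa < 0 by rewrite pmulr_rlt0. lra.
  have -> : (0 < (Pb - t * Pa)^-1) = false by rewrite ltNge ltW.
  by rewrite !nmulr_lgt0 // oppr_lt0 t_gt0 Pb0 andbF.
- have i0 : 0 < (Pb - t * Pa)^-1 by rewrite invr_gt0.
  have Pa0 : Pa < 0.
    case: P_outside => // Pb0; rewrite ltNge; apply/negP => Pa0.
    have := mulr_ge0 (ltW t_gt0) Pa0; lra.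
  have tF : (t < 0) = false by rewrite ltNge ltW.
  by rewrite !pmulr_lgt0 // !oppr_gt0 Pa0 i0 tF andbF.
Qed.

Lemma sector_of_cell s q : s \in D -> s != sigma -> #|` s| = #|` sigma| ->
  q |` gamma `<=` s -> q \notin gamma -> q |` gamma != T ->
  has (fun r => [&& r \notin gamma, r |` gamma != T & in_sector r]) s = in_sector q.
Proof.
move=> sD ss cs qs qg qT; move: qs; rewrite fsubUset fsub1set => /andP[qs gs].
apply/hasP/idP => [[r rs /and3P[rg rT]]|Wq]; last by exists q; rewrite ?qg ?qT.
have [<- //|rq] := eqVneq r q.
apply: (@sector_step s) => //.
exact: cell_over_ridge.
Qed.
End Sector.

(** The indicator of the sector, or its complement, whichever contains the cells
    next to [p1]. The slope [t] only has to avoid the direction opposite to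
    [(Pa, Pb)]. *)
Lemma wedge_indicator D T Pa Pb : simplicial_complex D -> sigma \in D ->
  Pa < 0 \/ Pb < 0 -> T != p1 |` gamma -> T != p2 |` gamma ->
  (forall q q', q \notin gamma -> q' \notin gamma -> q != q' ->
    q |` (q' |` gamma) \in D -> q |` gamma != T -> q' |` gamma != T ->
    forall x y c : R, 0 <= x -> 0 <= y -> 0 < c ->
    x * lam1 q + y * lam1 q' = c * Pa -> x * lam2 q + y * lam2 q' = c * Pb -> False) ->
  exists b : simplex -> bool, [/\
    forall s s' q, s \in D -> s != sigma -> #|` s| = #|` sigma| ->
      s' \in D -> s' != sigma -> #|` s'| = #|` sigma| ->
      q |` gamma `<=` s -> q |` gamma `<=` s' -> q \notin gamma ->
      q |` gamma != T -> b s = b s',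
    forall s, s \in D -> s != sigma -> #|` s| = #|` sigma| ->
      p1 |` gamma `<=` s -> b s = true
  & forall s, s \in D -> s != sigma -> #|` s| = #|` sigma| ->
      p2 |` gamma `<=` s -> b s = false].
Proof.
move=> sD sigD Pout T1 T2 Pav.
have [t t0 dP] : exists2 t, 0 < t & Pb - t * Pa != 0.
  have [h|h] := eqVneq (Pb - 1 * Pa) 0; last by exists 1; rewrite ?ltr01.
  by exists 2; rewrite ?ltr0n //; apply/eqP; case: Pout; lra.
pose b0 (s : simplex) :=
  has (fun r => [&& r \notin gamma, r |` gamma != T & in_sector Pa Pb t r]) s.
have b0E := sector_of_cell sD sigD t0 dP Pav.
exists (fun s => in_sector Pa Pb t p1 (+) b0 s (+) true); split.
- move=> s s' q sD1 ss cs s'D ss' cs' qs qs' qg qT.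
  by rewrite /b0 !(b0E _ q).
- move=> s sD1 ss cs ps; rewrite /b0 (b0E _ p1) ?p1_ridge // 1?eq_sym //.
  by rewrite addbb.
- move=> s sD1 ss cs ps; rewrite /b0 (b0E _ p2) ?p2_ridge // 1?eq_sym //.
  by rewrite (in_sector_p12 t0 Pout dP) addNb addbb.
Qed.
End Wedge.

(** * Facets of a subdivided simplex *)

Section NearZero.
Variable R : realFieldType.
Implicit Types (P Q : R -> Prop).

Definition near0 P := exists2 e : R, 0 < e & forall x, 0 < x -> x < e -> P x.

Lemma near0_and P Q : near0 P -> near0 Q -> near0 (fun x => P x /\ Q x).
Proof.
move=> [e e0 he] [d d0 hd]; exists (Num.min e d); first by rewrite lt_min e0.
by move=> x x0; rewrite lt_min => /andP[xe xd]; split; [apply: he|apply: hd].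
Qed.

Lemma near0_all (I : eqType) (s : seq I) (P : I -> R -> Prop) :
  (forall i, i \in s -> near0 (P i)) -> near0 (fun x => forall i, i \in s -> P i x).
Proof.
elim: s => [|i s IH] h; first by exists 1; rewrite ?ltr01.
have [||e e0 he] := @near0_and (P i) (fun x => forall j, j \in s -> P j x).
- by apply: h; rewrite mem_head.
- by apply: IH => j js; apply: h; rewrite inE js orbT.
exists e => // x x0 xe j; have [Pi Ps] := he x x0 xe.
by rewrite inE => /predU1P[->|/Ps].
Qed.

Lemma near0_affine_gt0 (a b : R) : 0 < a -> near0 (fun x => 0 < a + x * b).
Proof.
move=> a0; have n0 : 0 < `|b| + 1 by apply: ltr_wpDl.
exists (a / (`|b| + 1)) => [|x x0]; first exact: divr_gt0.
rewrite ltr_pdivlMr // => h.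
have : x * - b <= x * `|b| by rewrite ler_pM2l // -normrN ler_norm.
lra.
Qed.

Lemma near0_affine_lt0 (a b : R) : a < 0 -> near0 (fun x => a + x * b < 0).
Proof.
move=> a0; have [|e e0 he] := @near0_affine_gt0 (- a) (- b); first by rewrite oppr_gt0.
by exists e => // x x0 xe; have := he x x0 xe; rewrite mulrN -opprD oppr_gt0.
Qed.
End NearZero.

Section Convex.
Variables (R : realType) (k : nat).
Local Notation point := 'rV[R]_k.
Local Notation simplex := {fset 'rV[R]_k}.
Local Notation complex := {fset {fset 'rV[R]_k}}.
Implicit Types (x y v p q : point) (F G S T : simplex) (D : complex) (w : point -> R).

Definition coords F (be : point -> 'rV[R]_k.+1) :=
  (forall X, X = \sum_(v <- F) pairing (be v) X *: hom v) /\
  (forall u v, u \in F -> v \in F -> pairing (be v) (hom u) = (v == u)%:R).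

Lemma conv_hull_sub F G x : F `<=` G -> conv_hull F x -> conv_hull G x.
Proof.
move=> FG /conv_hullE[w [w0 e]]; apply/conv_hullE.
exists (fun v => if v \in F then w v else 0); split=> [v vG|].
  by case: ifP => // /w0.
by rewrite -e (sum_fsubset _ FG); apply: eq_bigr => v _; case: ifP; rewrite ?scale0r.
Qed.

Lemma conv_hull_vertex F v : v \in F -> conv_hull F v.
Proof.
move=> vF; apply/conv_hullE; exists (fun u => (u == v)%:R); split=> // .
rewrite (bigD1_seq v) ?fset_uniq //= eqxx scale1r big1 ?addr0 // => u /negbTE ->.
by rewrite scale0r.
Qed.

Lemma conv_hull_coords F be x : coords F be ->
  conv_hull F x <-> forall v, v \in F -> 0 <= pairing (be v) (hom x).
Proof.
move=> [span dual]; split=> [/conv_hullE[w [w0 e]] v vF|h]; last first.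
  by apply/conv_hullE; exists (fun v => pairing (be v) (hom x)).
rewrite -e pairing_sum (bigD1_seq v) ?fset_uniq //= dual // eqxx mulr1.
rewrite big_seq_cond big1 ?addr0 ?w0 // => u /andP[uF uv].
by rewrite dual // eq_sym (negbTE uv) mulr0.
Qed.

Lemma hom_line z q (e : R) : hom (z + e *: (z - q)) = hom z + e *: (hom z - hom q).
Proof.
apply/rowP => i; case: (unliftP ord0 i) => [j ->|->].
  by rewrite hom_lift !mxE !liftK.
by rewrite hom0 !mxE unlift_none subrr mulr0 addr0.
Qed.

Lemma facesP D i F : reflect (F \in D /\ #|` F| = i.+1) (F \in faces i D).
Proof. by rewrite !inE /=; apply: (iffP andP) => -[? /eqP]. Qed.

(** [overlap] for the point mass at a vertex of [F]. *)
Lemma complex_conv_sub D F G : simplicial_complex D -> F \in D -> G \in D ->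
  (forall v, v \in F -> conv_hull G v) -> F `<=` G.
Proof.
move=> sD FD GD h; apply/fsubsetP => v vF; apply/contraT => vG.
have /conv_hullE[w [w0 e]] := h v vF.
have E : \sum_(u <- F) (u == v)%:R *: hom u = \sum_(u <- G) w u *: hom u.
  rewrite e (bigD1_seq v) ?fset_uniq //= eqxx scale1r big1 ?addr0 // => u /negbTE ->.
  by rewrite scale0r.
have /eqP := overlap sD FD GD (fsub0set F) (fsub0set G)
  (fun _ _ _ => ler0n _ _) (fun v vG _ => w0 v vG) E vF vG.
by rewrite eqxx oner_eq0.
Qed.

(** Push the barycentre of [T] slightly out of [S] through [T]. As [T] is not
    contained in a facet of [sigma], the barycentre is interior to [sigma], so the
    pushed points stay in [sigma] and are covered by cells. There are finitely many
    cells and they are closed, so a cell that contains pushed points arbitrarily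
    close to [T] contains the barycentre, hence [T]. *)
Lemma opposite_cell D sigma be T S : simplicial_complex D -> full_dimensional D ->
  Defs.support D = conv_hull sigma -> coords sigma be ->
  T \in D -> #|` T| = k -> S \in faces k D -> T `<=` S ->
  (forall v, v \in sigma -> exists2 u, u \in T & pairing (be v) (hom u) != 0) ->
  exists G, [/\ G \in faces k D, T `<=` G & G != S].
Proof.
move=> sD fD supp co TD cT /facesP[SD cS] TS nb.
have [DF _ _] := sD.
have T0 : (0 < #|` T|)%N by rewrite cardfs_gt0; have [] := DF _ TD.
have [z0 hz0] : exists z, \sum_(u <- T) (#|` T|%:R)^-1 *: hom u = hom z.
  exists (\sum_(u <- T) (#|` T|%:R)^-1 *: u); apply/sum_hom1; split=> //.
  rewrite big_const_seq count_predT iter_addr_0 -[size _]/(#|` T|).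
  by rewrite -[_ *+ _]mulr_natr mulVf // pnatr_eq0 -lt0n.
have i0 : 0 < (#|` T|%:R)^-1 :> R by rewrite invr_gt0 ltr0n.
have [|q qT SE] := fset_extend1 TS; first by rewrite cS cT.
pose z e := z0 + e *: (z0 - q).
have zE c e : pairing c (hom (z e)) =
    pairing c (hom z0) + e * (pairing c (hom z0) - pairing c (hom q)).
  by rewrite /z hom_line linearD /= linearZ /= linearB.
have near0_sigma : near0 (fun e => conv_hull sigma (z e)).
  have [e e0 he] : near0 (fun e => forall v, v \in sigma ->
      0 < pairing (be v) (hom z0) + e * (pairing (be v) (hom z0) - pairing (be v) (hom q))).
    apply: near0_all => v vs; apply: near0_affine_gt0.
    rewrite -hz0 pairing_sum -mulr_sumr; apply: mulr_gt0 => //.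
    have uge u : u \in T -> 0 <= pairing (be v) (hom u).
      move=> uT; have : Defs.support D u by exists T => //; apply: conv_hull_vertex.
      by rewrite supp => /(conv_hull_coords _ co); apply.
    have [u uT un] := nb v vs.
    rewrite (bigD1_seq u) ?fset_uniq //= ltr_wpDr //.
      by rewrite big_seq_cond; apply: sumr_ge0 => w /andP[wT _]; apply: uge.
    by rewrite lt_def un uge.
  exists e => // x x0 xe; apply/(conv_hull_coords _ co) => v vs.
  by rewrite zE ltW // he.
have near0_cells : near0 (fun e => forall G, G \in faces k D ->
    conv_hull G (z e) -> T `<=` G).
  apply: near0_all => G /facesP[GD cG].
  have [bG coG] := bary_coords (DF _ GD).2 cG.
  have [h|] := pselect (conv_hull G z0).
    exists 1; rewrite ?ltr01 // => x _ _ _.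
    have /conv_hullE[w [w0 e]] := h.
    apply/fsubsetP => v vT; apply/contraT => vG.
    have E : \sum_(u <- T) (#|` T|%:R)^-1 *: hom u = \sum_(u <- G) w u *: hom u.
      by rewrite hz0 e.
    have e' := overlap sD TD GD (fsub0set T) (fsub0set G)
      (fun _ _ _ => ltW i0) (fun v vG _ => w0 v vG) E vT vG.
    by move: i0; rewrite e' ltxx.
  move/(conv_hull_coords _ coG)/existsNP => [v /not_implyP[vG /negP]].
  rewrite -ltNge => /(@near0_affine_lt0 _ _
    (pairing (bG v) (hom z0) - pairing (bG v) (hom q))) [e e0 he].
  exists e => // x x0 xe /(conv_hull_coords _ coG)/(_ v vG).
  by rewrite zE leNgt he.
have [e e0 he] := near0_and near0_sigma near0_cells.
have [] := he (e / 2); first by rewrite divr_gt0 // ltr0n.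
  by rewrite ltr_pdivrMr ?ltr0n // mulr2n mulrDr mulr1 ltrDl.
have e20 : 0 < e / 2 by rewrite divr_gt0 // ltr0n.
rewrite -supp => -[F FD Fz] cells.
have [G Gc FG] := fD.2 F FD.
have Gz := conv_hull_sub FG Fz.
exists G; split=> //; first exact: cells.
apply/eqP => GS; have [bS coS] := bary_coords (DF _ SD).2 cS.
have qS : q \in S by rewrite SE !inE eqxx.
move: Gz; rewrite GS => /(conv_hull_coords _ coS) /(_ q qS).
have -> : pairing (bS q) (hom (z (e / 2))) = - (e / 2).
  rewrite zE -hz0 pairing_sum big_seq big1 => [|u uT].
    by rewrite coS.2 // eqxx /= mulr1n; ring.
  rewrite coS.2 ?(fsubsetP TS u uT) //; have [qu|_] := eqVneq q u; last by rewrite mulr0.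
  by rewrite qu uT in qT.
by rewrite oppr_ge0 leNgt e20.
Qed.

End Convex.

(** * Telescoping around a ridge *)

Section Star.
Variables (R : realType) (k : nat).
Local Notation point := 'rV[R]_k.
Local Notation simplex := {fset 'rV[R]_k}.
Local Notation complex := {fset {fset 'rV[R]_k}}.
Implicit Types (p q r : point) (S T : simplex).

Variables (sigma : simplex) (be : point -> 'rV[R]_k.+1) (p1 p2 : point).
Hypothesis co : coords sigma be.
Hypothesis p1s : p1 \in sigma.
Hypothesis p2s : p2 \in sigma.
Hypothesis p12 : p1 != p2.
Hypothesis card_sigma : #|` sigma| = k.+1.
Variable D : complex.
Hypothesis D_complex : simplicial_complex D.
Hypothesis D_full : full_dimensional D.
Hypothesis D_support : Defs.support D = conv_hull sigma.

Local Notation gamma := (ridge sigma p1 p2).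
Local Notation lam1 := (lam1 be p1).
Local Notation lam2 := (lam2 be p2).
Local Notation det := (det2 be p1 p2).

Let span := co.1.
Let dual := co.2.
Let lam1_ridge0 v : v \in gamma -> lam1 v = 0.
Proof. by move=> vg; case: (lam_ridge dual p1s p2s vg). Qed.
Let lam2_ridge0 v : v \in gamma -> lam2 v = 0.
Proof. by move=> vg; case: (lam_ridge dual p1s p2s vg). Qed.

Lemma det2_anti p q : det q p = - det p q.
Proof. by rewrite /det2; ring. Qed.

Lemma det2_off p q : det p q != 0 -> [/\ p \notin gamma, q \notin gamma & p != q].
Proof.
move=> d0; split; apply: contraNN d0.
- by move=> pg; rewrite /det2 (lam1_ridge0 pg) (lam2_ridge0 pg) !mul0r subrr.
- by move=> qg; rewrite /det2 (lam1_ridge0 qg) (lam2_ridge0 qg) !mulr0 subrr.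
- by move=> /eqP ->; rewrite /det2; apply/eqP; ring.
Qed.

(** Two different cells on the same side of a facet would overlap. *)
Lemma same_side p q q' : p |` (q |` gamma) \in D -> p |` (q' |` gamma) \in D ->
  0 < det p q * det p q' -> q = q'.
Proof.
move=> c c' dd; apply/eqP/contraT => qq'.
have dq : det p q != 0 by apply: contraTneq dd => ->; rewrite mul0r ltxx.
have dq' : det p q' != 0 by apply: contraTneq dd => ->; rewrite mulr0 ltxx.
have [pg qg pq] := det2_off dq; have [_ q'g pq'] := det2_off dq'.
(* Cramer's rule: q' = e p + a q in the plane, with a positive. *)
pose a := det p q' / det p q; pose e := det q' q / det p q.
have a0 : 0 < a.
  have -> : a = (det p q * det p q') / (det p q ^+ 2) by rewrite /a; field.
  by rewrite divr_gt0 // lt_def sqrf_eq0 dq sqr_ge0.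
(* The term |e| p is added on both sides to keep all weights nonnegative. *)
have e0 : 0 <= `|e| + e by have := ler_norm (- e); rewrite normrN; lra.
have n0 := normr_ge0 e.
have sub x y : gamma `<=` x |` (y |` gamma) by rewrite fsubsetU // fsubsetU1 orbT.
have := @wedge_overlap _ _ _ _ _ _ span p1s p2s p12 D (p |` (q' |` gamma)) (p |` (q |` gamma))
  (two_weights p `|e| q' 1) (two_weights p (`|e| + e) q a) D_complex c' c (sub _ _) (sub _ _).
have w0 v : 0 <= two_weights p `|e| q' 1 v by apply: two_weights_ge0.
have w'0 v : 0 <= two_weights p (`|e| + e) q a v by apply: two_weights_ge0 => //; apply: ltW.
move=> /(_ (fun v _ _ => w0 v) (fun v _ _ => w'0 v)).
rewrite !(sum_two_weights2 _ _ lam1_ridge0) // !(sum_two_weights2 _ _ lam2_ridge0) //.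
have E1 : `|e| * lam1 p + 1 * lam1 q' = (`|e| + e) * lam1 p + a * lam1 q.
  suff -> : lam1 q' = e * lam1 p + a * lam1 q by ring.
  by rewrite /e /a; move: dq; rewrite /det2 => dq; field.
have E2 : `|e| * lam2 p + 1 * lam2 q' = (`|e| + e) * lam2 p + a * lam2 q.
  suff -> : lam2 q' = e * lam2 p + a * lam2 q by ring.
  by rewrite /e /a; move: dq; rewrite /det2 => dq; field.
move=> /(_ E1 E2 q'); rewrite !in_fset1U eqxx orbT => /(_ isT).
rewrite !negb_or [q' == q]eq_sym qq' q'g [q' == p]eq_sym pq' => /(_ isT).
by rewrite /two_weights eqxx eq_sym (negbTE pq') => /eqP; rewrite oner_eq0.
Qed.

Lemma vertex_ge0 S v u : S \in D -> v \in S -> u \in sigma ->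
  0 <= pairing (be u) (hom v).
Proof.
move=> SD vS us; have : Defs.support D v by exists S => //; apply: conv_hull_vertex.
by rewrite D_support => /(conv_hull_coords _ co); apply.
Qed.

Lemma ridge_in S q : S \in D -> q |` gamma `<=` S -> q |` gamma \in D.
Proof.
have [_ sub _] := D_complex; move=> SD qS; apply: sub SD qS _.
by apply/fset0Pn; exists q; rewrite !inE eqxx.
Qed.

Lemma card_facet q : q \notin gamma -> #|` q |` gamma| = k.
Proof.
by move=> qg; have := card_ridge p1s p2s p12; rewrite cardfsU1 qg card_sigma => -[].
Qed.

(** [opposite_cell] in the star of the ridge: a facet through the ridge other
    than [tau1] and [tau2] lies in no facet of [sigma], since its projection to the
    plane is not on the boundary of the quadrant. *)
Lemma opposite_vertex p q : p != p1 -> p != p2 ->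
  p1 |` gamma \in D -> p2 |` gamma \in D ->
  p |` (q |` gamma) \in faces k D -> det p q != 0 ->
  exists q', p |` (q' |` gamma) \in faces k D /\ det p q * det p q' < 0.
Proof.
move=> np1 np2 t1 t2 cS dq; have [pg qg pq] := det2_off dq.
have [SD cardS] := facesP _ _ _ cS.
have pS : p |` gamma `<=` p |` (q |` gamma) by rewrite fsetUS // fsubsetU1.
have TD := ridge_in SD pS.
have wt1 v : 0 <= two_weights p 1 p 0 v by apply: two_weights_ge0.
have pT : p \in p |` gamma by rewrite !inE eqxx.
have ov u c : u |` gamma \in D -> u \notin gamma -> p != u -> 0 <= c ->
    lam1 p = c * lam1 u -> lam2 p = c * lam2 u -> False.
  move=> uD ug pu c0 e1 e2.
  have wt2 v : 0 <= two_weights u c u 0 v by apply: two_weights_ge0.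
  have := @wedge_overlap _ _ _ _ _ _ span p1s p2s p12 D (p |` gamma) (u |` gamma)
    (two_weights p 1 p 0) (two_weights u c u 0) D_complex TD uD (fsubsetU1 _ _) (fsubsetU1 _ _)
    (fun v _ _ => wt1 v) (fun v _ _ => wt2 v).
  rewrite !(sum_two_weights1 _ _ _ lam1_ridge0) //.
  rewrite !(sum_two_weights1 _ _ _ lam2_ridge0) // !mul1r.
  move=> /(_ e1 e2 p pT); rewrite in_fset1U negb_or pu pg => /(_ isT).
  by rewrite /two_weights eqxx => /eqP; rewrite oner_eq0.
have [|G [/facesP[GD cG] TG GS]] := @opposite_cell _ _ D sigma be (p |` gamma) _
    D_complex D_full D_support co TD (card_facet pg) cS pS.
  move=> v vs; have [vg|vg] := boolP (v \in gamma).
    by exists v; rewrite ?in_fset1U ?vg ?orbT // dual // eqxx oner_eq0.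
  exists p => //; move: vs; rewrite {1}(sigmaE p1s p2s p12) !in_fset1U (negbTE vg) orbF.
  have p1g : p1 \notin gamma := p1_ridge _ _ _.
  have p2g : p2 \notin gamma := p2_ridge _ _ _.
  case/orP=> /eqP ->; apply/eqP => h.
    apply: (ov p2 (lam2 p)) => //; first exact: vertex_ge0 TD pT p2s.
      by rewrite (lam_p2 dual p1s p2s p12).1 mulr0.
    by rewrite (lam_p2 dual p1s p2s p12).2 mulr1.
  apply: (ov p1 (lam1 p)) => //; first exact: vertex_ge0 TD pT p1s.
    by rewrite (lam_p1 dual p1s p2s p12).1 mulr1.
  by rewrite (lam_p1 dual p1s p2s p12).2 mulr0.
have [|q' q'T GE] := fset_extend1 TG; first by rewrite cG card_facet.
rewrite fsetUCA in GE; exists q'; rewrite -GE; split; first exact/facesP.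
move: q'T; rewrite in_fset1U negb_or => /andP[q'p q'g].
have dq' : det p q' != 0.
  apply: (det2_neq0 span p1s p2s p12) => //; last by rewrite eq_sym.
  by have [H _ _] := D_complex; rewrite -GE; apply: (H _ GD).2.
rewrite ltNge le_eqVlt eq_sym mulf_eq0 (negbTE dq) (negbTE dq') /=.
apply/negP => dd; rewrite GE in GD GS.
by rewrite (same_side SD GD dd) eqxx in GS.
Qed.

Section SignedSum.
Variables (V : lmodType R) (J : V -> Prop) (g : simplex -> V).
Hypothesis J0 : J 0.
Hypothesis JD : forall x y, J x -> J y -> J (x + y).
Hypothesis JN : forall x, J x -> J (- x).
Hypothesis Jg : forall S1 S2 q, S1 \in faces k D -> S2 \in faces k D ->
  q \notin gamma -> q |` gamma `<=` S1 -> q |` gamma `<=` S2 -> J (g S1 - g S2).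

Let vs : seq point := undup (flatten [seq enum_fset F | F <- enum_fset D]).
Let G S := if S \in faces k D then g S else 0.
Let pos p := \sum_(q <- vs | 0 < det p q) G (p |` (q |` gamma)).
Let neg p := \sum_(q <- vs | det p q < 0) G (p |` (q |` gamma)).

Let vsP S v : S \in D -> v \in S -> v \in vs.
Proof.
move=> SD vS; rewrite mem_undup; apply/flattenP; exists (enum_fset S) => //.
exact: map_f.
Qed.

Let posE p q : p |` (q |` gamma) \in faces k D -> 0 < det p q ->
  pos p = g (p |` (q |` gamma)).
Proof.
move=> cS d; have [SD _] := facesP _ _ _ cS.
rewrite /pos big_mkcond (bigD1_seq q) ?undup_uniq //=; last first.
  by apply: vsP SD _; rewrite !inE eqxx orbT.
rewrite d /G cS big1 ?addr0 // => r rq; case: ifP => // dr.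
case: ifP => // /facesP[rD _].
by rewrite (same_side rD SD) ?eqxx ?mulr_gt0 // in rq.
Qed.

Let negE p q : p |` (q |` gamma) \in faces k D -> det p q < 0 ->
  neg p = g (p |` (q |` gamma)).
Proof.
move=> cS d; have [SD _] := facesP _ _ _ cS.
rewrite /neg big_mkcond (bigD1_seq q) ?undup_uniq //=; last first.
  by apply: vsP SD _; rewrite !inE eqxx orbT.
rewrite d /G cS big1 ?addr0 // => r rq; case: ifP => // dr.
case: ifP => // /facesP[rD _].
by rewrite (same_side rD SD) ?eqxx ?nmulr_rgt0 // in rq.
Qed.

Let pos0 p : (forall q, p |` (q |` gamma) \in faces k D -> det p q <= 0) -> pos p = 0.
Proof.
move=> h; rewrite /pos big1 // => q d; rewrite /G; case: ifP => // /h.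
by rewrite leNgt d.
Qed.

Let neg0 p : (forall q, p |` (q |` gamma) \in faces k D -> 0 <= det p q) -> neg p = 0.
Proof.
move=> h; rewrite /neg big1 // => q d; rewrite /G; case: ifP => // /h.
by rewrite leNgt d.
Qed.

Let signed_sum0 : \sum_(p <- vs) (pos p - neg p) = 0.
Proof.
pose f p q := Num.sg (det p q) *: G (p |` (q |` gamma)).
have -> : \sum_(p <- vs) (pos p - neg p) = \sum_(p <- vs) \sum_(q <- vs) f p q.
  apply: eq_bigr => p _; rewrite /pos /neg big_mkcond [X in _ - X]big_mkcond /=.
  rewrite -sumrB; apply: eq_bigr => q _; rewrite /f.
  have [d|d|->] := ltgtP (det p q) 0.
  - by rewrite ltr0_sg // scaleN1r sub0r.
  - by rewrite gtr0_sg // scale1r subr0.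
  - by rewrite sgr0 scale0r subr0.
set s := \sum_(p <- vs) _.
have : s = - s.
  rewrite {1}/s exchange_big /= /s -sumrN; apply: eq_bigr => p _.
  rewrite -sumrN; apply: eq_bigr => q _.
  by rewrite /f det2_anti sgrN scaleNr fsetUCA.
move=> /eqP; rewrite -addr_eq0 -mulr2n -scaler_nat scaler_eq0 pnatr_eq0 /=.
by move/eqP.
Qed.

(** Grouped by [p], the signed sum contributes [g s1] for [p1], where only the
    positive side is occupied, [- g s2] for [p2], where only the negative side is,
    and for any other facet the difference of [g] between its two cells. [J] stands
    for a submodule containing all the jumps. *)
Lemma ridge_telescope s1 s2 : s1 \in faces k D -> s2 \in faces k D ->
  p1 |` gamma `<=` s1 -> p2 |` gamma `<=` s2 -> J (g s1 - g s2).
Proof.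
move=> c1 c2 t1 t2; have [s1D k1] := facesP _ _ _ c1; have [s2D k2] := facesP _ _ _ c2.
have p1g : p1 \notin gamma := p1_ridge _ _ _.
have p2g : p2 \notin gamma := p2_ridge _ _ _.
have T1 := ridge_in s1D t1; have T2 := ridge_in s2D t2.
have [e11 e12] := lam_p1 dual p1s p2s p12; have [e21 e22] := lam_p2 dual p1s p2s p12.
have det1 q : det p1 q = lam2 q by rewrite /det2 e11 e12; ring.
have det2' q : det p2 q = - lam1 q by rewrite /det2 e21 e22; ring.
have H : forall F, F \in D -> aff_indep F by case: D_complex => h _ _ F /h[].
have [|q1 q1T s1E] := fset_extend1 t1; first by rewrite k1 card_facet.
have [|q2 q2T s2E] := fset_extend1 t2; first by rewrite k2 card_facet.
rewrite fsetUCA in s1E; rewrite fsetUCA in s2E.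
have det1n q : p1 |` (q |` gamma) \in faces k D -> 0 <= det p1 q.
  move=> /facesP[qD _]; rewrite det1; apply: vertex_ge0 qD _ p2s.
  by rewrite !inE eqxx orbT.
have det2n q : p2 |` (q |` gamma) \in faces k D -> det p2 q <= 0.
  move=> /facesP[qD _]; rewrite det2' oppr_le0; apply: vertex_ge0 qD _ p1s.
  by rewrite !inE eqxx orbT.
have off p q : p |` (q |` gamma) \in faces k D -> p \notin gamma ->
    q \notin p |` gamma -> det p q != 0.
  move=> /facesP[qD _] pg; rewrite in_fset1U negb_or => /andP[qp qg].
  apply: (det2_neq0 span p1s p2s p12) => //; last by rewrite eq_sym.
  exact: H.
have row1 : pos p1 - neg p1 = g s1.
  rewrite (neg0 det1n) subr0 s1E (@posE _ q1) -?s1E //.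
  by rewrite lt_def det1n -?s1E // off -?s1E.
have row2 : pos p2 - neg p2 = - g s2.
  rewrite (pos0 det2n) sub0r s2E (@negE _ q2) -?s2E //.
  by rewrite lt_def det2n -?s2E // eq_sym off -?s2E.
have rowJ p : p != p1 -> p != p2 -> J (pos p - neg p).
  move=> np1 np2.
  have [[q [cq dq]]|none] := pselect (exists q,
      p |` (q |` gamma) \in faces k D /\ det p q != 0); last first.
    have z q : p |` (q |` gamma) \in faces k D -> det p q = 0.
      by move=> cq; apply/eqP/contraT => dq; case: none; exists q.
    by rewrite pos0 ?neg0 ?subrr // => q /z ->.
  have [q' [cq' dd]] := opposite_vertex np1 np2 T1 T2 cq dq.
  have [pg _ _] := det2_off dq.
  have sub r : p |` gamma `<=` p |` (r |` gamma) by rewrite fsetUS // fsubsetU1.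
  have [dn|dp|d0] := ltgtP (det p q) 0.
  - rewrite (negE cq dn) (posE cq'); last by rewrite -(nmulr_rlt0 _ dn).
    exact: (Jg cq' cq pg (sub _) (sub _)).
  - rewrite (posE cq dp) (negE cq'); last by rewrite -(pmulr_rlt0 _ dp).
    exact: (Jg cq cq' pg (sub _) (sub _)).
  - by rewrite d0 eqxx in dq.
have := signed_sum0.
have v1 : p1 \in vs by apply: (vsP s1D); rewrite (fsubsetP t1) // !inE eqxx.
have v2 : p2 \in vs by apply: (vsP s2D); rewrite (fsubsetP t2) // !inE eqxx.
rewrite (bigD1_seq p1) ?undup_uniq //= row1 -big_filter (bigD1_seq p2) /=.
- rewrite row2 addrA => /eqP; rewrite addr_eq0 => /eqP ->; apply: JN.
  rewrite big_seq_cond; apply: big_ind => // p /andP[].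
  by rewrite mem_filter => /andP[np1 _] np2; apply: rowJ.
- by rewrite mem_filter v2 eq_sym p12.
- by rewrite filter_uniq ?undup_uniq.
Qed.
End SignedSum.
End Star.

(** * Facet forms and the spline conditions *)

Section LinSpan.
Variables (A : nzRingType) (M : lmodType A).
Implicit Types (B : set M).

Lemma lin_span0 B : lin_span B 0.
Proof. by exists [::], (fun=> 0); rewrite big_nil. Qed.

Lemma lin_span_mem B x : B x -> lin_span B x.
Proof.
move=> Bx; exists [:: x], (fun=> 1); split=> //.
  by move=> y; rewrite inE => /eqP ->.
by rewrite big_seq1 scale1r.
Qed.

Lemma lin_spanZ B a x : lin_span B x -> lin_span B (a *: x).
Proof.
move=> [s [c [us sB ->]]]; exists s, (fun y => a * c y); split=> //.
by rewrite scaler_sumr; apply: eq_bigr => y _; rewrite scalerA.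
Qed.

Lemma lin_spanD B x y : lin_span B x -> lin_span B y -> lin_span B (x + y).
Proof.
move=> [s [c [us sB ->]]] [s' [c' [us' sB' ->]]].
pose t := undup (s ++ s').
have st : {subset s <= t} by move=> z zs; rewrite mem_undup mem_cat zs.
have st' : {subset s' <= t} by move=> z zs; rewrite mem_undup mem_cat zs orbT.
rewrite (sum_widen _ st us (undup_uniq _)) (sum_widen _ st' us' (undup_uniq _)).
rewrite -big_split /=.
exists t, (fun b => (if b \in s then c b else 0) + (if b \in s' then c' b else 0)).
split; first exact: undup_uniq.
  by move=> b; rewrite mem_undup mem_cat => /orP[/sB|/sB'].
by apply: eq_bigr => b _; rewrite scalerDl.
Qed.
End LinSpan.

Lemma ideal_gen1 (A : comNzRingType) (x p : A) :
  ideal_gen [set x]%classic p <-> exists h, p = h * x.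
Proof.
split=> [[s [a [us sx ->]]]|[h ->]].
  exists (\sum_(b <- s) a b); rewrite mulr_suml big_seq [RHS]big_seq.
  by apply: eq_bigr => b /sx ->.
by apply: (@lin_spanZ A A^o _ h); apply: lin_span_mem.
Qed.

Section Forms.
Variables (R : realType) (k : nat).
Local Notation point := 'rV[R]_k.
Local Notation simplex := {fset 'rV[R]_k}.
Local Notation complex := {fset {fset 'rV[R]_k}}.
Local Notation poly := {mpoly R[k.+1]}.
Implicit Types (x v p q : point) (F G S T : simplex) (D : complex) (c : 'rV[R]_k.+1).

Lemma facet_formP T (l : poly) : facet_form T l <->
  exists c, l = linform c /\ forall x, pairing c (hom x) = 0 <-> aff_span T x.
Proof.
split=> [[a0 [a [-> h]]]|[c [-> h]]].
  exists (\row_i oapp (fun j => a 0 j) a0 (unlift ord0 i)); split.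
    rewrite linformE big_ord_recl mxE unlift_none; congr (_ + _).
    by apply: eq_bigr => j _; rewrite mxE liftK.
  move=> x; rewrite -h pairing_hom mxE unlift_none.
  by under eq_bigr do rewrite mxE liftK.
exists (c 0 ord0), (\row_j c 0 (lift ord0 j)); split.
  rewrite linformE big_ord_recl; congr (_ + _).
  by apply: eq_bigr => j _; rewrite mxE.
by move=> x; rewrite -h pairing_hom; under eq_bigr do rewrite mxE.
Qed.

Lemma aff_spanE T x : aff_span T x <-> exists w, \sum_(v <- T) w v *: hom v = hom x.
Proof.
by split=> [[w [h1 h2]]|[w /sum_hom1[h1 h2]]]; exists w => //; apply/sum_hom1.
Qed.

Definition defines T c := forall x, pairing c (hom x) = 0 <-> aff_span T x.

Lemma defines_vertex T v c : aff_indep (v |` T) -> v \notin T -> defines T c ->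
  (forall u, u \in T -> pairing c (hom u) = 0) /\ pairing c (hom v) != 0.
Proof.
move=> ai vT dc; split=> [u uT|].
  apply/dc/aff_spanE; exists (fun x => (x == u)%:R).
  rewrite (bigD1_seq u) ?fset_uniq //= eqxx scale1r big1 ?addr0 // => x /negbTE ->.
  by rewrite scale0r.
apply/eqP => /dc /aff_spanE[w e].
have E : \sum_(x <- v |` T) (if x == v then -1 else w x) *: hom x = 0.
  rewrite big_fsetU1 //= eqxx scaleN1r -e addrC; apply/eqP; rewrite subr_eq0; apply/eqP.
  rewrite big_seq [RHS]big_seq; apply: eq_bigr => u uT.
  by case: eqP uT => // ->; rewrite (negbTE vT).
have /eqP := aff_indep_hom ai E (fset1U1 v T).
by rewrite eqxx oppr_eq0 oner_eq0.
Qed.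

Lemma defines_coord G T v be : coords G be -> G = v |` T -> v \notin T ->
  defines T (be v).
Proof.
move=> [span dual] GE vT x; have vG : v \in G by rewrite GE fset1U1.
have dT u : u \in T -> pairing (be v) (hom u) = 0.
  move=> uT; rewrite dual //; last by rewrite GE fset1Ur.
  by case: eqP uT => // <-; rewrite (negbTE vT).
split=> [h|/aff_spanE[w <-]].
  apply/aff_spanE; exists (fun u => pairing (be u) (hom x)).
  by rewrite [RHS]span GE big_fsetU1 //= h scale0r add0r.
by rewrite pairing_sum big_seq big1 // => u uT; rewrite dT // mulr0.
Qed.

(** Both functionals vanish on [T], which spans a hyperplane of the homogenized
    space, so each is a multiple of the coordinate at the vertex opposite to [T]. *)
Lemma defines_unique G T v c c' : aff_indep G -> #|` G| = k.+1 ->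
  G = v |` T -> v \notin T -> defines T c -> defines T c' ->
  exists2 e, e != 0 & c' = e *: c.
Proof.
move=> ai cG GE vT d d'; have [be co] := bary_coords ai cG.
rewrite GE in ai.
have key c0 : defines T c0 -> c0 = pairing c0 (hom v) *: be v.
  move=> d0; have [z _] := defines_vertex ai vT d0.
  have eq X : pairing c0 X = pairing c0 (hom v) * pairing (be v) X.
    rewrite {1}[X]co.1 GE big_fsetU1 //= linearD linearZ /= pairing_sum.
    by rewrite big_seq big1 ?addr0 1?mulrC // => u uT; rewrite z // mulr0.
  apply/rowP => i; have := eq (delta_mx 0 i).
  have pd b : pairing b (delta_mx 0 i) = b 0 i.
    rewrite /pairing (bigD1 i) //= mxE !eqxx mulr1 big1 ?addr0 // => j ji.
    by rewrite mxE (negbTE ji) andbF mulr0.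
  by rewrite !pd mxE.
have [_ n] := defines_vertex ai vT d; have [_ n'] := defines_vertex ai vT d'.
exists (pairing c' (hom v) / pairing c (hom v)); first by rewrite mulf_neq0 ?invr_eq0.
by rewrite {1}(key _ d') {2}(key _ d) scalerA divfK.
Qed.

Lemma dvd_linformZ (p : poly) c e N : e != 0 ->
  (exists h, p = h * linform c ^+ N) -> exists h, p = h * linform (e *: c) ^+ N.
Proof.
move=> e0 [h ->]; exists ((e ^+ N)^-1 *: h).
rewrite linearZ /= exprZn -scalerAl -scalerAr scalerA mulVf ?scale1r //.
exact: expf_neq0.
Qed.

Section InComplex.
Variable D : complex.
Hypothesis D_complex : simplicial_complex D.

Lemma cell_facet S T : S \in faces k D -> #|` T| = k -> T `<=` S ->
  exists v, [/\ aff_indep (v |` T), v \notin T & S = v |` T].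
Proof.
move=> /facesP[SD cS] cT TS; have [H _ _] := D_complex.
have [|v vT SE] := fset_extend1 TS; first by rewrite cS cT.
by exists v; rewrite -SE; split=> //; apply: (H _ SD).2.
Qed.

Lemma defines_exists S T : S \in faces k D -> #|` T| = k -> T `<=` S ->
  exists c, defines T c.
Proof.
move=> cS cT TS; have [v [ai vT SE]] := cell_facet cS cT TS.
rewrite -SE in ai; have [be co] := bary_coords ai (proj2 (facesP _ _ _ cS)).
by exists (be v); apply: defines_coord co _ vT.
Qed.

Lemma cell_defines S T c v : S \in faces k D -> #|` T| = k -> T `<=` S ->
  defines T c -> v \in S -> pairing c (hom v) = 0 <-> v \in T.
Proof.
move=> cS cT TS d vS; have [u [ai uT SE]] := cell_facet cS cT TS.
have [z n] := defines_vertex ai uT d.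
split=> [h|/z //]; move: vS; rewrite SE in_fset1U => /predU1P[vu|//].
by rewrite -vu h eqxx in n.
Qed.

(** The spline condition at a facet may be tested on any one of its forms. *)
Lemma dvd_defines S T c c' N (p : poly) : S \in faces k D -> #|` T| = k -> T `<=` S ->
  defines T c -> defines T c' ->
  (exists h, p = h * linform c ^+ N) -> exists h, p = h * linform c' ^+ N.
Proof.
move=> cS cT TS d d'; have [v [ai vT SE]] := cell_facet cS cT TS.
rewrite -SE in ai; have [_ cardS] := facesP _ _ _ cS.
have [e e0 ->] := defines_unique ai cardS SE vT d d'.
exact: dvd_linformZ.
Qed.

(** Extension by zero to all simplices, so that tuples on different complexes can
    be compared without transporting membership proofs. *)
Definition extend (f : {ffun faces k D -> poly^o}) S : poly := oapp f 0 (insub S).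

Lemma extendE f (s : faces k D) : extend f (val s) = f s.
Proof. by rewrite /extend valK. Qed.

Definition is_spline N (h : simplex -> poly) := forall S1 S2 T c,
  S1 \in faces k D -> S2 \in faces k D -> T \in D -> #|` T| = k ->
  T `<=` S1 -> T `<=` S2 -> defines T c ->
  exists p : poly, h S1 - h S2 = p * linform c ^+ N.

(** A facet with two different cells is automatically interior, and a condition
    between a cell and itself is void. *)
Lemma splinesP r f : splines r D f <-> is_spline r.+1 (extend f).
Proof.
split=> [h S1 S2 T c c1 c2 TD cT T1 T2 d|h S1 S2 T l Tint cT T1 T2 /facet_formP[c [-> d]]].
  have [<-|ne] := eqVneq S1 S2; first by exists 0; rewrite subrr mul0r.
  apply/ideal_gen1; rewrite -[S1]/(val [` c1]) -[S2]/(val [` c2]) !extendE.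
  apply: (h _ _ T) => //; last by apply/facet_formP; exists c.
  rewrite in_fsetD TD andbT; apply/negP; rewrite !inE TD /=.
  move=> /existsP[T' /and3P[/eqP cT' TT' /eqP card1]].
  have TE : T = val T'.
    by apply/eqP; rewrite eqEfcard TT' cT cT' leqnn.
  move/eqP/cardfs1P: card1 => [G GE].
  have : S1 \in cells_at D (val T') by rewrite !inE /= -TE T1 andbT; move: c1; rewrite !inE.
  have : S2 \in cells_at D (val T') by rewrite !inE /= -TE T2 andbT; move: c2; rewrite !inE.
  by rewrite GE !inE => /eqP e2 /eqP e1; rewrite e1 e2 eqxx in ne.
apply/ideal_gen1; rewrite -!extendE; apply: (h _ _ T) => //.
- exact: valP.
- exact: valP.
- by move: Tint; rewrite in_fsetD => /andP[].
Qed.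

End InComplex.
End Forms.

(** * Cutting the star of a ridge *)

Section Cut.
Variables (R : realType) (k : nat).
Local Notation point := 'rV[R]_k.
Local Notation simplex := {fset 'rV[R]_k}.
Local Notation complex := {fset {fset 'rV[R]_k}}.
Implicit Types (p q : point) (S T s : simplex).
Variables (D : complex) (sigma : simplex) (p1 p2 : point).
Hypothesis D_complex : simplicial_complex D.
Hypothesis sigma_cell : sigma \in faces k D.
Hypothesis p1s : p1 \in sigma.
Hypothesis p2s : p2 \in sigma.
Hypothesis p12 : p1 != p2.
Local Notation gamma := (ridge sigma p1 p2).
Local Notation tau1 := (p1 |` gamma).
Local Notation tau2 := (p2 |` gamma).

(** Seen along [gamma], the facet [T] and the cell [sigma] separate the other cells
    around [gamma] into a part next to [tau1], where [b] is true, and a part next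
    to [tau2]. If [T] is [tau1] or [tau2], one part is empty, so the condition at
    that facet is waived. *)
Definition cut T (b : simplex -> bool) : Prop := [/\
  forall s s' q, s \in faces k D -> s != sigma -> s' \in faces k D -> s' != sigma ->
    q |` gamma `<=` s -> q |` gamma `<=` s' -> q \notin gamma ->
    q |` gamma != T -> b s = b s',
  forall s, s \in faces k D -> s != sigma -> tau1 `<=` s -> T != tau1 -> b s = true
& forall s, s \in faces k D -> s != sigma -> tau2 `<=` s -> T != tau2 -> b s = false].

Let sigmaD : sigma \in D. Proof. by case/facesP: sigma_cell. Qed.
Let card_sigma : #|` sigma| = k.+1. Proof. by case/facesP: sigma_cell. Qed.
Let wedge_cut be T Pa Pb : coords sigma be ->
  Pa < 0 \/ Pb < 0 -> T != tau1 -> T != tau2 ->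
  (forall q q', q \notin gamma -> q' \notin gamma -> q != q' ->
    q |` (q' |` gamma) \in D -> q |` gamma != T -> q' |` gamma != T ->
    forall x y c : R, 0 <= x -> 0 <= y -> 0 < c ->
    x * lam1 be p1 q + y * lam1 be p1 q' = c * Pa ->
    x * lam2 be p2 q + y * lam2 be p2 q' = c * Pb -> False) ->
  exists b, cut T b.
Proof.
move=> co Pout T1 T2 Pav.
have [b [b0 b1 b2]] := wedge_indicator co.1 co.2 p1s p2s p12 D_complex sigmaD Pout T1 T2 Pav.
exists b; split.
- move=> s s' q /facesP[sD cs] ns /facesP[s'D cs'] ns' qs qs' qg qT.
  by apply: (b0 _ _ q); rewrite ?card_sigma.
- by move=> s /facesP[sD cs] ns t1 _; apply: b1; rewrite ?card_sigma.
- by move=> s /facesP[sD cs] ns t1 _; apply: b2; rewrite ?card_sigma.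
Qed.

(** The ray through the facet [T] avoids all cells not containing [T], because
    distinct simplices of a complex do not overlap. *)
Lemma facet_cut T : T \in D -> #|` T| = k -> gamma `<=` T -> exists b, cut T b.
Proof.
move=> TD cT gT.
have [->|T1] := eqVneq T tau1.
  by exists (fun=> false); split=> // s _ _ _; rewrite eqxx.
have [->|T2] := eqVneq T tau2.
  by exists (fun=> true); split=> // s _ _ _; rewrite eqxx.
have [DF _ _] := D_complex.
have [be co] := bary_coords (DF _ sigmaD).2 card_sigma.
have lam1_ridge0 v : v \in gamma -> lam1 be p1 v = 0.
  by move=> vg; case: (lam_ridge co.2 p1s p2s vg).
have lam2_ridge0 v : v \in gamma -> lam2 be p2 v = 0.
  by move=> vg; case: (lam_ridge co.2 p1s p2s vg).
have p1g : p1 \notin gamma := p1_ridge _ _ _.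
have p2g : p2 \notin gamma := p2_ridge _ _ _.
have [|p pg TE] := fset_extend1 gT.
  by have := card_ridge p1s p2s p12; rewrite card_sigma cT => -[].
have pT : p \in T by rewrite TE fset1U1.
have TD' : p |` gamma \in D by rewrite -TE.
have ov G q q' (x y c : R) : G = q |` (q' |` gamma) -> G \in D ->
    q \notin gamma -> q' \notin gamma -> q != q' -> p != q -> p != q' ->
    0 <= x -> 0 <= y -> 0 < c ->
    x * lam1 be p1 q + y * lam1 be p1 q' = c * lam1 be p1 p ->
    x * lam2 be p2 q + y * lam2 be p2 q' = c * lam2 be p2 p -> False.
  move=> GE GD qg q'g qq' pq pq' x0 y0 c0 e1 e2; rewrite GE in GD.
  have w0 v : 0 <= two_weights p c p 0 v by apply: two_weights_ge0 => //; apply: ltW.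
  have w'0 v : 0 <= two_weights q x q' y v by apply: two_weights_ge0.
  have gG : gamma `<=` q |` (q' |` gamma) by rewrite fsubsetU // fsubsetU1 orbT.
  have := @wedge_overlap _ _ _ _ _ _ co.1 p1s p2s p12 D _ _
    (two_weights p c p 0) (two_weights q x q' y) D_complex TD' GD (fsubsetU1 _ _) gG
    (fun v _ _ => w0 v) (fun v _ _ => w'0 v).
  rewrite (sum_two_weights1 _ _ _ lam1_ridge0) // (sum_two_weights1 _ _ _ lam2_ridge0) //.
  rewrite (sum_two_weights2 _ _ lam1_ridge0) // (sum_two_weights2 _ _ lam2_ridge0) //.
  move=> /(_ (esym e1) (esym e2) p); rewrite fset1U1 => /(_ isT).
  rewrite !in_fset1U !negb_or pq pq' pg => /(_ isT).
  by rewrite /two_weights eqxx => h; rewrite h ltxx in c0.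
have ne q : q |` gamma != T -> p != q by apply: contraNneq => <-; rewrite TE.
apply: (@wedge_cut be T (lam1 be p1 p) (lam2 be p2 p)) => //.
  apply: contrapT => /not_orP[/negP h1 /negP h2].
  rewrite -leNgt in h1; rewrite -leNgt in h2.
  have [e11 e12] := lam_p1 co.2 p1s p2s p12; have [e21 e22] := lam_p2 co.2 p1s p2s p12.
  apply: (ov sigma p1 p2 (lam1 be p1 p) (lam2 be p2 p) 1) => //.
  - exact: sigmaE.
  - by apply: ne; rewrite eq_sym.
  - by apply: ne; rewrite eq_sym.
  - by rewrite e11 e21; ring.
  - by rewrite e12 e22; ring.
move=> q q' qg q'g qq' qD qT q'T x y c x0 y0 c0.
by apply: (ov _ q q' x y c) => //; apply: ne.
Qed.

(** In dimension one the cells around the empty ridge form a line, which has a gap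
    at infinity: the homogenized points lie in a half-plane, so the direction
    opposite to the homogenizing axis meets no cell. *)
Lemma cut_fset0 : gamma = fset0 -> exists b, cut fset0 b.
Proof.
move=> g0; have [DF _ _] := D_complex.
have [be co] := bary_coords (DF _ sigmaD).2 card_sigma.
have lam1_ridge0 v : v \in gamma -> lam1 be p1 v = 0 by rewrite g0.
have ne q : fset0 != q |` gamma.
  by apply/eqP => e; have := fset1U1 q gamma; rewrite -e.
(* The homogenized vector opposite to the homogenizing axis. *)
pose X : 'rV[R]_k.+1 := - delta_mx 0 ord0.
have X0 : X 0 ord0 = -1 by rewrite !mxE !eqxx.
have noker Y : pairing (be p1) Y = 0 -> pairing (be p2) Y = 0 -> Y = 0.
  by move=> h1 h2; rewrite (lam_kernel co.1 p1s p2s p12 h1 h2) g0 big_nil.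
apply: (@wedge_cut be fset0 (pairing (be p1) X) (pairing (be p2) X)) => //.
  have := congr1 (fun Y : 'rV_k.+1 => Y 0 ord0) (co.1 X).
  rewrite (sigmaE p1s p2s p12) g0 fsetU0 big_fsetU1 ?in_fset1 // big_seq_fset1.
  rewrite X0 !mxE !unlift_none /= !mulr1 => h.
  apply: contrapT => /not_orP[/negP h1 /negP h2]; rewrite -leNgt in h1; rewrite -leNgt in h2.
  by have := addr_ge0 h1 h2; rewrite -h oppr_ge0 ler10.
move=> q q' _ _ _ _ _ _ x y c x0 y0 c0 e1 e2.
have H : x *: hom q + y *: hom q' - c *: X = 0.
  by apply: noker; rewrite linearB linearD !linearZ /=; apply/eqP;
    rewrite subr_eq0; apply/eqP.
have := congr1 (fun Y : 'rV_k.+1 => Y 0 ord0) H.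
rewrite !mxE unlift_none /= ?eqxx /= ?mulr1n !mulr1 mulrN mulr1 opprK => /eqP.
by rewrite gt_eqF // ltr_wpDl // addr_ge0.
Qed.
End Cut.

(** * Split subdivisions around a ridge *)

Section Split.
Variables (R : realType) (k r : nat).
Local Notation point := 'rV[R]_k.
Local Notation simplex := {fset 'rV[R]_k}.
Local Notation complex := {fset {fset 'rV[R]_k}}.
Local Notation poly := {mpoly R[k.+1]}.
Implicit Types (p q : point) (S T s : simplex) (c : 'rV[R]_k.+1).
Variables (D D2 D1 : complex) (sigma : simplex).
Hypothesis D_complex : simplicial_complex D.
Hypothesis D_full : full_dimensional D.
Hypothesis D1_split : split_subdivision r D sigma D2 D1.

Lemma sigma_cell : sigma \in faces k D.
Proof. by case: D1_split => -[]. Qed.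

Lemma D2_complex : simplicial_complex D2.
Proof. by case: D1_split => -[_ []]. Qed.

Lemma D2_full : full_dimensional D2.
Proof. by case: D1_split => -[_ []]. Qed.

Lemma D2_support : Defs.support D2 = conv_hull sigma.
Proof. by case: D1_split => -[_ []]. Qed.

Lemma D1E : D1 = replace_cell D sigma D2.
Proof. by case: D1_split => -[]. Qed.

Lemma D2_sub T : T \in D2 -> T \in D1.
Proof. by rewrite D1E in_fsetU => ->; rewrite orbT. Qed.

Lemma D1P T : T \in D1 <->
  (T \in D /\ exists G, [/\ G \in faces k D, G != sigma & T `<=` G]) \/ T \in D2.
Proof.
rewrite D1E in_fsetU !inE /=; split=> [/orP[/andP[TD /existsP[G /andP[Gs TG]]]|]|].
- by left; split=> //; exists (val G); split=> //; apply: valP.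
- by right.
- move=> [[TD [G [cG Gs TG]]]|->]; last by rewrite orbT.
  by rewrite TD; apply/orP; left; apply/existsP; exists [` cG]; rewrite Gs.
Qed.

Lemma D1_cellP S : S \in faces k D1 <->
  (S \in faces k D /\ S != sigma) \/ S \in faces k D2.
Proof.
split=> [/facesP[/D1P[[SD [G [/facesP[GD cG] Gs SG]]]|SD2] cS]|].
- have SE : S = G by apply/eqP; rewrite eqEfcard SG cS cG leqnn.
  by left; rewrite SE; split=> //; apply/facesP.
- by right; apply/facesP.
- move=> [[cS Ss]|/facesP[SD cS]]; apply/facesP; last by split=> //; apply: D2_sub.
  have [SD cardS] := facesP _ _ _ cS.
  by split=> //; apply/D1P; left; split=> //; exists S; split.
Qed.

(** [D2] covers exactly [sigma], so a face of both complexes lies in [sigma] and is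
    one of its faces. *)
Lemma sub_sigma T : T \in D -> T \in D2 -> T `<=` sigma.
Proof.
have [sD _] := facesP _ _ _ sigma_cell.
move=> TD TD2; apply: (complex_conv_sub D_complex TD sD) => v vT.
by rewrite -D2_support; exists T => //; apply: conv_hull_vertex.
Qed.

Lemma cell_notin_D2 S : S \in faces k D -> S != sigma -> S \notin D2.
Proof.
move=> /facesP[SD cS] Ss; apply: contraNN Ss => SD2.
have [_ cs] := facesP _ _ _ sigma_cell.
by rewrite eqEfcard (sub_sigma SD SD2) cS cs leqnn.
Qed.

(** Such a facet is interior in [D], so it is not subdivided, and it remains a
    boundary facet of [D2]. *)
Lemma shared_facet T S : T \in D -> #|` T| = k -> T `<=` sigma ->
  S \in faces k D -> S != sigma -> T `<=` S ->
  T \in D2 /\ #|` cells_at D2 T| = 1%N.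
Proof.
move=> TD cT Ts cS Ss TS.
have [DF _ _] := D_complex.
have Tint : T \in interior_faces D.
  rewrite in_fsetD TD andbT; apply/negP; rewrite !inE TD /=.
  move=> /existsP[T' /and3P[/eqP cT' TT' /eqP card1]].
  have TE : T = val T' by apply/eqP; rewrite eqEfcard TT' cT cT' leqnn.
  move/eqP/cardfs1P: card1 => [G GE].
  have : S \in cells_at D (val T') by rewrite !inE /= -TE TS andbT; move: cS; rewrite !inE.
  have : sigma \in cells_at D (val T').
    by rewrite !inE /= -TE Ts andbT; move: sigma_cell; rewrite !inE.
  by rewrite GE !inE => /eqP e2 /eqP e1; rewrite e1 e2 eqxx in Ss.
have [_ cs] := facesP _ _ _ sigma_cell.
have T0 := (DF _ TD).1.
have Tb : T \in boundary (simplex_complex sigma).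
  have TS' : T \in simplex_complex sigma by rewrite !inE T0 fpowersetE.
  rewrite !inE T0 fpowersetE Ts /=; apply/existsP; exists [` TS'] => /=.
  rewrite cT eqxx fsubset_refl /=; apply/cardfs1P; exists sigma.
  apply/fsetP => G; rewrite !inE fpowersetE; apply/idP/eqP => [|->].
    move=> /andP[/andP[/andP[_ Gs] /eqP cG] _].
    by apply/eqP; rewrite eqEfcard Gs cG cs leqnn.
  rewrite fsubset_refl cs eqxx Ts !andbT /= -cardfs_gt0 cs //.
have : T \in boundary D2.
  by case: D1_split => -[_ _ <- //].
rewrite !inE => /andP[TD2 /existsP[T' /and3P[/eqP cT' TT' /eqP card1]]].
have -> : T = val T' by apply/eqP; rewrite eqEfcard TT' cT cT' leqnn.
by split; [apply: valP|].
Qed.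

Lemma D2_over T : T \in D2 -> exists2 S, S \in faces k D2 & T `<=` S.
Proof. by move=> TD2; have [_] := D2_full; apply. Qed.

Local Notation N := r.+1.
Local Notation dvd c p := (exists h : poly, p = h * linform c ^+ N).

Section Bridge.
Variables (p1 p2 : point) (g : simplex -> poly) (S1 S2 s1 s2 : simplex).
Hypothesis p1s : p1 \in sigma.
Hypothesis p2s : p2 \in sigma.
Hypothesis p12 : p1 != p2.
Local Notation gamma := (ridge sigma p1 p2).
Local Notation tau1 := (p1 |` gamma).
Local Notation tau2 := (p2 |` gamma).
Hypothesis S1_cell : S1 \in faces k D.
Hypothesis S1_sigma : S1 != sigma.
Hypothesis tau1_S1 : tau1 `<=` S1.
Hypothesis S2_cell : S2 \in faces k D.
Hypothesis S2_sigma : S2 != sigma.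
Hypothesis tau2_S2 : tau2 `<=` S2.
Hypothesis g_spline : is_spline D2 N g.
Hypothesis s1_cell : s1 \in faces k D2.
Hypothesis tau1_s1 : tau1 `<=` s1.
Hypothesis s2_cell : s2 \in faces k D2.
Hypothesis tau2_s2 : tau2 `<=` s2.

(** Values on the cells around [gamma] other than [sigma] that interpolate between
    those of [g] at [tau1] and at [tau2]. *)
Definition bridge (w : simplex -> poly) : Prop := [/\
  forall s s' q c, s \in faces k D -> s != sigma -> s' \in faces k D -> s' != sigma ->
    q |` gamma `<=` s -> q |` gamma `<=` s' -> q \notin gamma ->
    defines (q |` gamma) c -> dvd c (w s - w s'),
  forall s c, s \in faces k D -> s != sigma -> tau1 `<=` s -> defines tau1 c ->
    dvd c (w s - g s1)
& forall s c, s \in faces k D -> s != sigma -> tau2 `<=` s -> defines tau2 c ->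
    dvd c (w s - g s2)].

Let card_sigma : #|` sigma| = k.+1. Proof. by case/facesP: sigma_cell. Qed.

Let card_gamma : k = #|` gamma|.+1.
Proof. by have := card_ridge p1s p2s p12; rewrite card_sigma => -[]. Qed.

Let card_tau q : q \notin gamma -> #|` q |` gamma| = k.
Proof. by move=> qg; rewrite cardfsU1 qg [RHS]card_gamma. Qed.

Let gamma_sigma : gamma `<=` sigma.
Proof. by rewrite {2}(sigmaE p1s p2s p12) fsubsetU // fsubsetU1 orbT. Qed.

Let tau1_sigma : tau1 `<=` sigma. Proof. by rewrite fsubUset fsub1set p1s gamma_sigma. Qed.
Let tau2_sigma : tau2 `<=` sigma. Proof. by rewrite fsubUset fsub1set p2s gamma_sigma. Qed.

Let facet_in E q S : simplicial_complex E -> S \in E -> q |` gamma `<=` S ->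
  q |` gamma \in E.
Proof.
move=> [_ sub _] SE qS; apply: sub SE qS _.
by apply/fset0Pn; exists q; rewrite fset1U1.
Qed.

Let tau1D : tau1 \in D.
Proof. by case/facesP: S1_cell => SD _; apply: facet_in D_complex SD tau1_S1. Qed.
Let tau2D : tau2 \in D.
Proof. by case/facesP: S2_cell => SD _; apply: facet_in D_complex SD tau2_S2. Qed.

Let facet_sigma T : #|` T| = k -> gamma `<=` T -> T `<=` sigma -> T = tau1 \/ T = tau2.
Proof.
move=> cT gT Ts; have [|q qg TE] := fset_extend1 gT; first by rewrite cT.
have : q \in sigma by rewrite (fsubsetP Ts) // TE fset1U1.
rewrite {1}(sigmaE p1s p2s p12) !in_fset1U (negbTE qg) orbF.
by case/orP=> /eqP e; rewrite TE e; [left|right].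
Qed.

(** If only one cell of [D] lies on [T], the jump at [T] is unconstrained, and the
    interpolation may switch there from [g s1] to [g s2]. *)
Let bridge_of_gap T b : cut D sigma p1 p2 T b -> T != tau1 -> T != tau2 ->
  (forall s s' q, s \in faces k D -> s' \in faces k D -> T = q |` gamma ->
     T `<=` s -> T `<=` s' -> s = s') ->
  exists w, bridge w.
Proof.
move=> [b0 b1 b2] T1 T2 gap; exists (fun s => if b s then g s1 else g s2); split.
- move=> s s' q c cs ns cs' ns' qs qs' qg _; exists 0; rewrite mul0r.
  have [e|qT] := eqVneq (q |` gamma) T.
    by rewrite (gap s s' q) ?subrr // -e.
  by rewrite (b0 s s' q) // subrr.
- by move=> s c cs ns t1 _; exists 0; rewrite b1 // subrr mul0r.
- by move=> s c cs ns t2 _; exists 0; rewrite b2 // subrr mul0r.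
Qed.

(** Each term of [g s1 - g s2] is a multiple of the [N]-th power of the form of one
    facet, so it may be switched on at that facet by a cut. *)
Let bridge_of_ideal : face_ideal r D gamma (g s1 - g s2) -> exists w, bridge w.
Proof.
move=> [sq [a [usq sqP e]]].
have /choice[Tb hTb] : forall x : poly, exists Tb : simplex * (simplex -> bool),
    x \in sq -> cut D sigma p1 p2 Tb.1 Tb.2 /\
      forall c, defines Tb.1 c -> dvd c x.
  move=> x; have [xs|] := boolP (x \in sq); last by exists (fset0, fun=> false).
  have [T [l [TD cT gT /facet_formP[c [-> d]] ->]]] := sqP x xs.
  have [b hb] := facet_cut D_complex sigma_cell p1s p2s p12 TD cT gT.
  exists (T, b) => _; split=> // c' d'.
  have [G cG TG] := D_full.2 T TD.
  by apply: (dvd_defines D_complex cG cT TG d d'); exists 1; rewrite mul1r.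
exists (fun s => g s2 + \sum_(x <- sq) (if (Tb x).2 s then a x * x else 0)).
have dvd_sum c (F : poly -> poly) : (forall x, x \in sq -> dvd c (F x)) ->
    dvd c (\sum_(x <- sq) F x).
  move=> h; rewrite big_seq; apply: (big_ind (fun y : poly => dvd c y)) => //.
    by exists 0; rewrite mul0r.
  by move=> x y [u ->] [v ->]; exists (u + v); rewrite mulrDl.
have dvdM c x y : dvd c y -> dvd c (x * y).
  by move=> [u ->]; exists (x * u); rewrite mulrA.
have dvd0 c : dvd c (0 : poly) by exists 0; rewrite mul0r.
split.
- move=> s s' q c cs ns cs' ns' qs qs' qg d.
  rewrite opprD addrACA subrr add0r -sumrB; apply: dvd_sum => x xs.
  have [[b0 _ _] dx] := hTb x xs.
  have [E|ne] := eqVneq (q |` gamma) (Tb x).1.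
    rewrite -E in dx; have := dx c d; case: ifP => _; case: ifP => _ h.
    + by rewrite subrr.
    + by rewrite subr0; apply: dvdM.
    + by rewrite sub0r -mulNr; apply: dvdM.
    + by rewrite subrr.
  by rewrite (b0 s s' q) // subrr.
- move=> s c cs ns t1 d.
  have -> : g s1 = g s2 + \sum_(x <- sq) a x * x.
    by rewrite -[X in _ = _ + X]e addrC subrK.
  rewrite opprD addrACA subrr add0r -sumrB; apply: dvd_sum => x xs.
  have [[_ b1 _] dx] := hTb x xs.
  have [E|ne] := eqVneq (Tb x).1 tau1.
    rewrite E in dx; have := dx c d; case: ifP => _ h; first by rewrite subrr.
    by rewrite sub0r -mulNr; apply: dvdM.
  by rewrite b1 // subrr.
- move=> s c cs ns t2 d.
  rewrite addrAC subrr add0r; apply: dvd_sum => x xs.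
  have [[_ _ b2] dx] := hTb x xs.
  have [E|ne] := eqVneq (Tb x).1 tau2.
    by rewrite E in dx; have := dx c d; case: ifP => _ h //; apply: dvdM.
  by rewrite b2.
Qed.

Let ridge_ideal : face_ideal r D1 gamma (g s1 - g s2).
Proof.
have [DF _ _] := D_complex.
have [be co] := bary_coords (DF _ (facesP _ _ _ sigma_cell).1).2 card_sigma.
apply: (ridge_telescope co p1s p2s p12 card_sigma D2_complex D2_full D2_support (V := poly)
  (J := fun x => face_ideal r D1 gamma x)) s1_cell s2_cell tau1_s1 tau2_s2.
- exact: lin_span0.
- by move=> x y; apply: lin_spanD.
- move=> x hx; have -> : - x = (-1 : poly) *: (x : poly^o) by rewrite scaleN1r.
  exact: lin_spanZ.
- move=> G G' q cG cG' qg qG qG'.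
  have qD2 : q |` gamma \in D2 by apply: (facet_in D2_complex _ qG); case/facesP: cG.
  have [c d] := defines_exists D2_complex cG (card_tau qg) qG.
  have [h ->] := g_spline cG cG' qD2 (card_tau qg) qG qG' d.
  apply: (@lin_spanZ _ poly^o _ h); apply: lin_span_mem.
  exists (q |` gamma), (linform c); split=> //.
  + exact: D2_sub.
  + exact: card_tau.
  + exact: fsubsetU1.
  + by apply/facet_formP; exists c.
Qed.

(** If [gamma] is interior in [D1], the split condition moves [g s1 - g s2] into the
    ideal of [gamma] in [D]. If not, some facet of [D1] through [gamma] lies in only
    one cell. It is not [tau1] or [tau2], which have a cell on either side, nor
    another facet of [D2], because of [opposite_vertex]; so it is a facet of [D]
    not contained in [sigma], and it gives a gap. *)
Lemma bridge_exists : exists w, bridge w.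
Proof.
have p1g : p1 \notin gamma := p1_ridge _ _ _.
have p2g : p2 \notin gamma := p2_ridge _ _ _.
have [g0|gn0] := eqVneq gamma fset0.
  have [b hb] := cut_fset0 D_complex sigma_cell p1s p2s p12 g0.
  have ne q : fset0 != q |` gamma.
    by apply/eqP => e; have := fset1U1 q gamma; rewrite -e.
  by apply: (bridge_of_gap hb) => // s s' q _ _ /eqP; rewrite (negbTE (ne q)).
have [[tau1D2 c1] [tau2D2 c2]] := (shared_facet tau1D (card_tau p1g) tau1_sigma
  S1_cell S1_sigma tau1_S1, shared_facet tau2D (card_tau p2g) tau2_sigma
  S2_cell S2_sigma tau2_S2).
have gD2 : gamma \in D2.
  by have [_ sub _] := D2_complex; apply: sub tau1D2 (fsubsetU1 _ _) gn0.
have gbd : gamma \in boundary D2.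
  rewrite !inE gD2 /=; apply/existsP; exists [` tau1D2] => /=.
  by rewrite card_tau // eqxx fsubsetU1 c1.
have [gb1|gb1] := boolP (gamma \in boundary D1); last first.
  apply: bridge_of_ideal; have [_ H] := D1_split.
  by rewrite -(H _ gbd gb1); apply: ridge_ideal.
move: gb1; rewrite !inE => /andP[gD1 /existsP[[T TD1] /= /and3P[/eqP cT gT cards]]].
have lone G G' : G \in faces k D1 -> G' \in faces k D1 -> T `<=` G -> T `<=` G' -> G = G'.
  case/cardfs1P: cards => G0 G0E cG cG' TG TG'.
  have : G \in cells_at D1 T by rewrite !inE /= TG andbT; move: cG; rewrite !inE.
  have : G' \in cells_at D1 T by rewrite !inE /= TG' andbT; move: cG'; rewrite !inE.
  by rewrite G0E !inE => /eqP -> /eqP ->.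
have inD1 G : G \in faces k D -> G != sigma -> G \in faces k D1.
  by move=> cG Gs; apply/D1_cellP; left.
have inD1' G : G \in faces k D2 -> G \in faces k D1.
  by move=> cG; apply/D1_cellP; right.
have nT1 : T != tau1.
  apply: contraNneq (cell_notin_D2 S1_cell S1_sigma) => TE.
  have -> : S1 = s1.
    by apply: lone; rewrite ?TE //; [apply: inD1|apply: inD1'].
  by case/facesP: s1_cell.
have nT2 : T != tau2.
  apply: contraNneq (cell_notin_D2 S2_cell S2_sigma) => TE.
  have -> : S2 = s2.
    by apply: lone; rewrite ?TE //; [apply: inD1|apply: inD1'].
  by case/facesP: s2_cell.
have Ts : ~~ (T `<=` sigma).
  apply/negP => Ts; case: (facet_sigma cT gT Ts) => e.
    by rewrite e eqxx in nT1.
  by rewrite e eqxx in nT2.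
have [[TD _]|TD2] := (D1P _).1 TD1.
  have [b hb] := facet_cut D_complex sigma_cell p1s p2s p12 TD cT gT.
  apply: (bridge_of_gap hb nT1 nT2) => s s' q cs cs' _ Tss Tss'.
  by apply: lone => //; apply: inD1 => //; apply: contraNneq Ts => <-.
exfalso.
have [DF _ _] := D_complex; have [D2F _ _] := D2_complex.
have [be co] := bary_coords (DF _ (facesP _ _ _ sigma_cell).1).2 card_sigma.
have [|p pg TE] := fset_extend1 gT; first by rewrite cT.
have [S cS TS] := D2_over TD2; have [SD2 cardS] := facesP _ _ _ cS.
have [|q qT SE] := fset_extend1 TS; first by rewrite cT.
move: qT; rewrite TE in_fset1U negb_or => /andP[qp qg].
rewrite TE fsetUCA in SE.
have dq : det2 be p1 p2 p q != 0.
  apply: (det2_neq0 co.1 p1s p2s p12) => //; last by rewrite eq_sym.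
  by rewrite -SE; apply: (D2F _ SD2).2.
have [q' [cq' dd]] : exists q', p |` (q' |` gamma) \in faces k D2 /\
    det2 be p1 p2 p q * det2 be p1 p2 p q' < 0.
  apply: (opposite_vertex co p1s p2s p12 card_sigma D2_complex D2_full D2_support) => //.
  - by apply/eqP => e; rewrite TE e eqxx in nT1.
  - by apply/eqP => e; rewrite TE e eqxx in nT2.
  - by rewrite -SE.
have dq' : det2 be p1 p2 p q' != 0 by apply: contraTneq dd => ->; rewrite mulr0 ltxx.
have [_ q'g pq'] := det2_off co p1s p2s dq'.
have : S = p |` (q' |` gamma).
  apply: lone; [exact: inD1'|exact: inD1'| |]; rewrite TE ?SE.
    by rewrite fsetUS // fsubsetU1.
  by rewrite fsetUS // fsubsetU1.
move=> /fsetP /(_ q'); rewrite SE !in_fset1U eqxx orbT (negbTE q'g).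
rewrite [q' == p]eq_sym (negbTE pq') /= orbF => /eqP qq'.
by move: dd; rewrite qq' ltNge -expr2 sqr_ge0.
Qed.

End Bridge.

End Split.

(** * Solving the jump conditions *)

Section Facets.
Variables (R : realType) (k : nat) (D : {fset {fset 'rV[R]_k}}).
Hypothesis D_complex : simplicial_complex D.
Hypothesis D_full : full_dimensional D.

Definition facets := [fset T in D | #|` T| == k].

Definition incident (T : facets) : pred (faces k D) := fun S => val T `<=` val S.

Lemma facetsP (T : {fset 'rV[R]_k}) : reflect (T \in D /\ #|` T| = k) (T \in facets).
Proof. by rewrite !inE /=; apply: (iffP andP) => -[? /eqP]. Qed.

Lemma facet_forms : exists c : facets -> 'rV[R]_k.+1, forall T, defines (val T) (c T).
Proof.
have key (T : facets) : exists c, defines (val T) c.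
  have [TD cT] := facetsP _ (valP T); have [G cG TG] := D_full.2 _ TD.
  exact (defines_exists D_complex cG cT TG).
by have [c hc] := fin_all_exists key; exists c.
Qed.

Variable c : facets -> 'rV[R]_k.+1.
Hypothesis c_defines : forall T, defines (val T) (c T).

Lemma facet_forms_neq0 T : c T != 0.
Proof.
have [TD cT] := facetsP _ (valP T); have [G cG TG] := D_full.2 _ TD.
have [v [ai vT GE]] := cell_facet D_complex cG cT TG.
have [_] := defines_vertex ai vT (c_defines T); apply: contraNneq => ->.
by rewrite /pairing big1 // => i _; rewrite mxE mul0r.
Qed.

Lemma splines_incident r f : splines r D f <-> spline incident c r.+1 f.
Proof.
rewrite splinesP //; split=> [h T S1 S2 T1 T2|h S1 S2 T c' cS1 cS2 TD cT T1 T2 d].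
  have [TD cT] := facetsP _ (valP T); rewrite /ev -!extendE.
  apply: (h _ _ (val T)) => //; exact: valP.
have TF : T \in facets by apply/facetsP.
apply: (dvd_defines D_complex cS1 cT T1 (c_defines [` TF]) d).
have := h [` TF] [` cS1] [` cS2] T1 T2.
by rewrite /ev -!extendE.
Qed.
End Facets.

Section Local.
Variables (R : realType) (k r : nat).
Local Notation point := 'rV[R]_k.
Local Notation simplex := {fset 'rV[R]_k}.
Local Notation complex := {fset {fset 'rV[R]_k}}.
Local Notation poly := {mpoly R[k.+1]}.
Implicit Types (p q : point) (S s : simplex).
Variables (D D2 D1 : complex) (sigma : simplex).
Hypothesis D_complex : simplicial_complex D.
Hypothesis D_full : full_dimensional D.
Hypothesis D1_split : split_subdivision r D sigma D2 D1.
Variable c : facets D -> 'rV[R]_k.+1.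
Hypothesis c_defines : forall T, defines (val T) (c T).
Variable g : simplex -> poly.
Hypothesis g_spline : is_spline D2 r.+1 g.
Implicit Types (T : facets D).

(** The value of [g] at the facet [T] of [sigma], well defined modulo the [N]-th power
    of its form; any cell of [D2] on [T] may serve, as [g] is a spline. *)
Definition inner T : poly :=
  if [pick s : faces k D2 | val T `<=` val s] is Some s then g (val s) else 0.

Lemma innerE T : val T \in D2 ->
  exists s, [/\ s \in faces k D2, val T `<=` s & inner T = g s].
Proof.
move=> TD2; rewrite /inner; case: pickP => [s Ts|none].
  by exists (val s); split=> //; apply: valP.
have [S cS TS] := D2_over D1_split TD2.
by have := none [` cS]; rewrite TS.
Qed.

Definition sigma_jump (S : faces k D) T : poly := if val S == sigma then inner T else 0.

Local Notation fdvd := (facet_dvd c r.+1).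
Local Notation jumps1 := (jumps (@incident R k D) c r.+1 1 sigma_jump).

(** Only differences with the value on [sigma] matter, so that value is taken to
    be 0. *)
Lemma jumps_outside (W : simplex -> poly) T :
  (forall S S', S \in faces k D -> S != sigma -> S' \in faces k D -> S' != sigma ->
     val T `<=` S -> val T `<=` S' -> fdvd T (W S - W S')) ->
  (forall S, S \in faces k D -> S != sigma -> val T `<=` S -> val T `<=` sigma ->
     fdvd T (W S - inner T)) ->
  jumps1 T [ffun S => if val S == sigma then 0 else W (val S)].
Proof.
move=> h1 h2 S1 S2 i1 i2; rewrite /ev !ffunE /sigma_jump !mul1r.
have [e1|n1] := eqVneq (val S1) sigma; have [e2|n2] := eqVneq (val S2) sigma.
- by rewrite subrr; apply: facet_dvd0.
- rewrite add0r addr0 -opprB; apply: facet_dvdN.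
  by apply: h2 => //; [apply: valP|rewrite -e1].
- rewrite add0r addr0.
  by apply: h2 => //; [apply: valP|rewrite -e2].
- by rewrite !addr0; apply: h1 => //; apply: valP.
Qed.

(** Facets of one simplex have independent forms, so at most two facets of [sigma]
    belong to [U]. If there are two, every other form in [U] is a combination of
    theirs and vanishes on the ridge in which they meet; hence a facet in [U] of a
    cell containing the ridge contains the ridge itself, and the cells containing
    the ridge can be treated separately from the others. *)
Lemma local_jumps (U : pred (facets D)) :
  (forall T1 T2 T3, U T1 -> U T2 -> U T3 -> ~ form_free3 (c T1) (c T2) (c T3)) ->
  exists u, forall T, U T -> jumps1 T u.
Proof.
move=> dep.
have sig := sigma_cell D1_split; have [sigD card_sigma] := facesP _ _ _ sig.
pose active T := U T /\ exists S, [/\ val T `<=` sigma, S \in faces k D, S != sigma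
  & val T `<=` S].
have [[T1 [T2 [[U1 [S1 [T1s cS1 nS1 TS1]]] [U2 [S2 [T2s cS2 nS2 TS2]]] T12]]]|few]
  := pselect (exists T1 T2, [/\ active T1, active T2 & T1 != T2]); last first.
  have [[T0 a0]|none] := pselect (exists T, active T).
    exists [ffun S => if val S == sigma then 0 else inner T0] => T UT.
    apply: (@jumps_outside (fun=> inner T0)) => [S S' _ _ _ _ _ _|S cS nS TS Ts].
      by rewrite subrr; apply: facet_dvd0.
    have -> : T = T0.
      apply/eqP/contraT => ne; case: few; exists T, T0; split=> //.
      by split=> //; exists S.
    by rewrite subrr; apply: facet_dvd0.
  exists [ffun S => if val S == sigma then 0 else 0] => T UT.
  apply: (@jumps_outside (fun=> 0)) => [S S' _ _ _ _ _ _|S cS nS TS Ts].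
    by rewrite subrr; apply: facet_dvd0.
  by case: none; exists T; split=> //; exists S.
have [T1D cT1] := facetsP _ _ (valP T1); have [T2D cT2] := facetsP _ _ (valP T2).
have [p2 [ai1 p2T1 sE1]] := cell_facet D_complex sig cT1 T1s.
have [p1 [ai2 p1T2 sE2]] := cell_facet D_complex sig cT2 T2s.
have p1s : p1 \in sigma by rewrite sE2 fset1U1.
have p2s : p2 \in sigma by rewrite sE1 fset1U1.
have p12 : p1 != p2.
  apply/eqP => e; move: T12; rewrite -val_eqE /=.
  by rewrite -(fsetU1K p2T1) -sE1 -e sE2 (fsetU1K p1T2) eqxx.
pose gamma := ridge sigma p1 p2.
have p1g : p1 \notin gamma := p1_ridge _ _ _.
have p2g : p2 \notin gamma := p2_ridge _ _ _.
have card_gamma : k = #|` gamma|.+1.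
  by have := card_ridge p1s p2s p12; rewrite card_sigma => -[].
have gs : gamma `<=` sigma by apply/fsubsetP => v; rewrite !inE => /and3P[].
have gT1 : gamma `<=` val T1.
  apply/fsubsetP => v; rewrite !in_fsetD1 => /and3P[v2 v1 vs].
  by move: vs; rewrite sE1 in_fset1U (negbTE v2).
have gT2 : gamma `<=` val T2.
  apply/fsubsetP => v; rewrite !in_fsetD1 => /and3P[v2 v1 vs].
  by move: vs; rewrite sE2 in_fset1U (negbTE v1).
have T1E : val T1 = p1 |` gamma.
  apply/eqP; rewrite eq_sym eqEfcard fsubUset fsub1set gT1 andbT.
  have -> : #|` p1 |` gamma| = k by rewrite cardfsU1 p1g [RHS]card_gamma.
  rewrite cT1 leqnn andbT.
  by move: p1s; rewrite sE1 in_fset1U (negbTE p12).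
have T2E : val T2 = p2 |` gamma.
  apply/eqP; rewrite eq_sym eqEfcard fsubUset fsub1set gT2 andbT.
  have -> : #|` p2 |` gamma| = k by rewrite cardfsU1 p2g [RHS]card_gamma.
  rewrite cT2 leqnn andbT.
  by move: p2s; rewrite sE2 in_fset1U eq_sym (negbTE p12).
have over T S : U T -> S \in faces k D -> val T `<=` S -> gamma `<=` S -> gamma `<=` val T.
  move=> UT cS TS gS; have [TD cT] := facetsP _ _ (valP T).
  apply/fsubsetP => v vg; apply/(cell_defines D_complex cS cT TS (c_defines T)).
    exact: (fsubsetP gS).
  have /existsNP[x1 /existsNP[x2 /existsNP[x3 /not_implyP[e ne]]]] := dep _ _ _ U1 U2 UT.
  have ev y : x1 * pairing (c T1) (hom y) + x2 * pairing (c T2) (hom y)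
      + x3 * pairing (c T) (hom y) = 0.
    rewrite ![pairing (c _) (hom y)]pairingC -!linearZ -!linearD /= e.
    by rewrite linear0.
  have z1 y : y \in sigma -> pairing (c T1) (hom y) = 0 <-> y \in val T1.
    by move=> ys; exact (cell_defines D_complex sig cT1 T1s (c_defines T1) ys).
  have z2 y : y \in sigma -> pairing (c T2) (hom y) = 0 <-> y \in val T2.
    by move=> ys; exact (cell_defines D_complex sig cT2 T2s (c_defines T2) ys).
  (* Otherwise the forms of T1 and T2 would be proportional. *)
  have x3n : x3 != 0.
    apply/eqP => x30; apply: ne; split=> //.
      have := ev p2; rewrite x30 mul0r addr0 (z2 p2 p2s).2 ?T2E ?fset1U1 // mulr0 addr0.
      by move/eqP; rewrite mulf_eq0 => /orP[/eqP //|/eqP /(z1 _ p2s)]; rewrite (negbTE p2T1).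
    have := ev p1; rewrite x30 mul0r addr0 (z1 p1 p1s).2 ?T1E ?fset1U1 // mulr0 add0r.
    by move/eqP; rewrite mulf_eq0 => /orP[/eqP //|/eqP /(z2 _ p1s)]; rewrite (negbTE p1T2).
  have vs : v \in sigma by rewrite (fsubsetP gs).
  have := ev v; rewrite (z1 v vs).2 ?(fsubsetP gT1) // (z2 v vs).2 ?(fsubsetP gT2) //.
  by rewrite !mulr0 !add0r => /eqP; rewrite mulf_eq0 (negbTE x3n) => /eqP.
have [T1D2 _] := shared_facet D_complex D1_split T1D cT1 T1s cS1 nS1 TS1.
have [T2D2 _] := shared_facet D_complex D1_split T2D cT2 T2s cS2 nS2 TS2.
have [s1 [cs1 Ts1 g1]] := innerE T1D2.
have [s2 [cs2 Ts2 g2]] := innerE T2D2.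
rewrite T1E in TS1 Ts1; rewrite T2E in TS2 Ts2.
have [w [w0 w1 w2]] := bridge_exists D_complex D_full D1_split p1s p2s p12
  cS1 nS1 TS1 cS2 nS2 TS2 g_spline cs1 Ts1 cs2 Ts2.
exists [ffun S => if val S == sigma then 0 else if gamma `<=` val S then w (val S) else 0].
move=> T UT; have [TD cT] := facetsP _ _ (valP T).
apply: (@jumps_outside (fun S => if gamma `<=` S then w S else 0)).
  move=> S S' cS nS cS' nS' TS TS'.
  have [gT|gT] := boolP (gamma `<=` val T); last first.
    rewrite !ifF ?subrr; first exact: facet_dvd0.
      by apply/negP => /(over T S' UT cS' TS'); apply/negP.
    by apply/negP => /(over T S UT cS TS); apply/negP.
  rewrite !(fsubset_trans gT) //.
  have [|q qg TE] := fset_extend1 gT; first by rewrite cT.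
  by apply: (w0 S S' q) => //; rewrite -?TE.
move=> S cS nS TS Ts.
have gT := over T sigma UT sig Ts gs.
rewrite (fsubset_trans gT) //.
have [|q qg TE] := fset_extend1 gT; first by rewrite cT.
have : q \in sigma by rewrite (fsubsetP Ts) // TE fset1U1.
rewrite {1}(sigmaE p1s p2s p12) !in_fset1U (negbTE qg) orbF.
case/orP=> /eqP e; rewrite e in TE.
  have TT : T = T1 by apply: val_inj; rewrite /= TE T1E.
  by rewrite TT g1; apply: w1 => //; rewrite -T1E -?TT.
have TT : T = T2 by apply: val_inj; rewrite /= TE T2E.
by rewrite TT g2; apply: w2 => //; rewrite -T2E -?TT.
Qed.

Lemma outer_exists m (b : 'I_m -> {ffun faces k D -> poly^o}) :
  free_family (splines r D) b -> exists u, forall T, jumps1 T u.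
Proof.
move=> [b1 b2].
apply: (gluing (b := b) (facet_forms_neq0 D_complex D_full c_defines));
  last exact: local_jumps.
by split=> // f; rewrite -b2 (splines_incident D_complex c_defines).
Qed.
End Local.

(** * Spline modules and extensions of free modules *)

(** In a short exact sequence with free ends, the image of a basis of the kernel
    and lifts of a basis of the quotient form a basis. *)
Lemma free_family_extension (A : nzRingType) (M' M M'' : lmodType A)
    (N' : M' -> Prop) (N : M -> Prop) (N'' : M'' -> Prop)
    (psi : {linear M' -> M}) (phi : {linear M -> M''})
    m' (b' : 'I_m' -> M') m'' (b'' : 'I_m'' -> M'') :
  free_family N' b' -> free_family N'' b'' ->
  (forall m (a : 'I_m -> A) (x : 'I_m -> M), (forall i, N (x i)) -> N (\sum_i a i *: x i)) ->
  (forall x, N' x -> N (psi x)) -> (forall x, N' x -> phi (psi x) = 0) ->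
  (forall x, N' x -> psi x = 0 -> x = 0) ->
  (forall x, N x -> N'' (phi x)) ->
  (forall x, N x -> phi x = 0 -> exists2 y, N' y & psi y = x) ->
  (forall y, N'' y -> exists2 x, N x & phi x = y) ->
  exists m (b : 'I_m -> M), free_family N b.
Proof.
move=> [free' span'] [free'' span''] Nsub psiN phipsi psi0 phiN ker surj.
have N'b i : N' (b' i).
  apply/span'; exists (fun j => (j == i)%:R); rewrite (bigD1 i) //= eqxx scale1r.
  by rewrite big1 ?addr0 // => j /negbTE ->; rewrite scale0r.
have N''b i : N'' (b'' i).
  apply/span''; exists (fun j => (j == i)%:R); rewrite (bigD1 i) //= eqxx scale1r.
  by rewrite big1 ?addr0 // => j /negbTE ->; rewrite scale0r.
have /fin_all_exists[l hl] : forall i, exists x, N x /\ phi x = b'' i.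
  by move=> i; have [x Nx e] := surj _ (N''b i); exists x.
pose b (i : 'I_(m'' + m')) := match split i with inl j => l j | inr j => psi (b' j) end.
have bl j : b (lshift m' j) = l j by rewrite /b (unsplitK (inl j)).
have br j : b (rshift m'' j) = psi (b' j) by rewrite /b (unsplitK (inr j)).
have Nb i : N (b i) by rewrite /b; case: split => j; [apply: (hl j).1|apply: psiN].
have sumb (a : 'I_(m'' + m') -> A) : \sum_i a i *: b i =
    \sum_j a (lshift m' j) *: l j + psi (\sum_j a (rshift m'' j) *: b' j).
  rewrite big_split_ord /=; congr (_ + _); first by under eq_bigr do rewrite bl.
  by rewrite linear_sum /=; apply: eq_bigr => j _; rewrite br linearZ.
have phil (a : 'I_m'' -> A) : phi (\sum_j a j *: l j) = \sum_j a j *: b'' j.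
  by rewrite linear_sum /=; apply: eq_bigr => j _; rewrite linearZ /= (hl j).2.
have N'sum (a : 'I_m' -> A) : N' (\sum_j a j *: b' j) by apply/span'; exists a.
exists (m'' + m')%N, b; split=> [a e|x].
  have e'' : \sum_j a (lshift m' j) *: b'' j = 0.
    by have := congr1 phi e; rewrite sumb linearD /= phil phipsi // addr0 linear0.
  have z'' := free'' _ e''.
  have z' : forall j, a (rshift m'' j) = 0.
    apply: (free' (fun j => a (rshift m'' j))); apply: psi0 (N'sum _) _.
    by move: e; rewrite sumb big1 ?add0r // => j _; rewrite z'' scale0r.
  by move=> i; rewrite -[i]splitK; case: split => j /=.
split=> [Nx|[a ->]]; last exact: Nsub.
have [a'' e''] := (span'' _).1 (phiN _ Nx).
pose y := x - \sum_j a'' j *: l j.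
have Ny : N y.
  pose xs (i : 'I_2) := if i == 0 then x else \sum_j a'' j *: l j.
  have := Nsub _ (fun i : 'I_2 => if i == 0 then 1 else -1) xs.
  rewrite !big_ord_recl big_ord0 /= scale1r addr0 scaleN1r; apply.
  by move=> i; rewrite /xs; case: ifP => // _; apply: Nsub => j; apply: (hl j).1.
have y0 : phi y = 0 by rewrite linearB /= phil -e'' subrr.
have [z N'z zy] := ker y Ny y0; have [a' e'] := (span' _).1 N'z.
exists (fun i => match split i with inl j => a'' j | inr j => a' j end).
rewrite sumb; under eq_bigr do rewrite (unsplitK (inl _)).
under [X in psi X]eq_bigr do rewrite (unsplitK (inr _)).
by rewrite -e' zy /y addrC subrK.
Qed.

Section SplineModule.
Variables (F : fieldType) (n : nat) (X Phi : finType) (inc : Phi -> pred X).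
Variables (c : Phi -> 'rV[F]_n) (N : nat).
Hypothesis c_neq0 : forall T, c T != 0.
Local Notation poly := {mpoly F[n]}.
Local Notation tuples := {ffun X -> poly^o}.
Local Notation spline := (spline inc c N).

Lemma spline_sum m (a : 'I_m -> poly) (f : 'I_m -> tuples) :
  (forall i, spline (f i)) -> spline (\sum_i a i *: f i).
Proof.
move=> h T S1 S2 i1 i2; rewrite !ev_sum -sumrB.
apply: (big_ind (facet_dvd c N T)) => [||i _].
- exact: facet_dvd0.
- exact: facet_dvdD.
- by rewrite -mulrBr; apply: facet_dvdM; apply: h.
Qed.

Lemma spline_hcomp d (f : tuples) : spline f -> spline (hcomp d f).
Proof.
move=> h T S1 S2 i1 i2; rewrite !ev_hcomp -linearB /=.
have [p ->] := h T S1 S2 i1 i2; rewrite (@pihomogM _ _ d N).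
  by exists (comp_above d N p).
by have := dhomogMn N (linform_homog (c T)); rewrite mul1n.
Qed.

Definition const_tuple : tuples := [ffun=> 1].

Lemma ev_const S : ev const_tuple S = 1. Proof. by rewrite /ev ffunE. Qed.

(** A nonzero multiplier that turns every tuple into a spline. *)
Definition all_forms : poly := \prod_T linform (c T) ^+ N.

Lemma all_forms_neq0 : all_forms != 0.
Proof. by apply/prodf_neq0 => T _; rewrite expf_neq0 // linform_eq0. Qed.

Lemma spline_all_forms (f : tuples) : spline (all_forms *: f).
Proof.
move=> T S1 S2 _ _; rewrite !evZ -mulrBr mulrC; apply: facet_dvdM.
by exists (\prod_(T' | T' != T) linform (c T') ^+ N); rewrite /all_forms (bigD1 T) //= mulrC.
Qed.

(** The multiples by [all_forms] of the standard basis show that a basis of the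
    spline module is finite. *)
Lemma spline_family (P : set tuples) : (forall f, P f <-> spline f) ->
  free_submodule P -> exists m (b : 'I_m -> tuples), free_family P b.
Proof.
move=> PE; pose w (j : 'I_#|X|) : X := enum_val j.
pose e (j : 'I_#|X|) : tuples := [ffun S => (S == w j)%:R].
apply: (@free_submodule_family _ _ P #|X| (fun j => all_forms *: e j) all_forms).
- exact: all_forms_neq0.
- by move=> j; apply/PE; apply: spline_all_forms.
move=> x _; exists (fun j => ev x (w j)); apply: ev_inj => S.
rewrite ev_sum evZ (bigD1 (enum_rank S)) //= big1 => [|j js].
  by rewrite /w enum_rankK evZ /ev ffunE /w enum_rankK eqxx addr0 mulr1 mulrC.
rewrite evZ /ev [e j S]ffunE; case: eqP => [SE|]; last by rewrite !mulr0.
by rewrite SE /w enum_valK eqxx in js.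
Qed.

(** Subtracting from a spline its value at [s0] is a projection onto the splines
    that vanish there, so these form a graded projective module. *)
Lemma spline_vanishing_free (P : set tuples) m (b : 'I_m -> tuples) (s0 : X) :
  (forall f, P f <-> spline f) -> free_family P b ->
  exists m' (b' : 'I_m' -> tuples), free_family (fun f => P f /\ ev f s0 = 0) b'.
Proof.
move=> PE [bfree bspan].
pose ka i f := match pselect (exists a : 'I_m -> poly, f = \sum_i a i *: b i) with
  | left h => projT1 (cid h) i | right _ => 0 end.
have kaE f : P f -> f = \sum_i ka i f *: b i.
  move=> /bspan h; rewrite {1}/ka /=; under eq_bigr do rewrite /ka.
  by case: pselect => [h'|[]//]; apply: (projT2 (cid h')).
have Pb i : P (b i).
  apply/bspan; exists (fun j => (j == i)%:R); rewrite (bigD1 i) //= eqxx scale1r.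
  by rewrite big1 ?addr0 // => j /negbTE ->; rewrite scale0r.
have Psum k (a : 'I_k -> poly) (f : 'I_k -> tuples) : (forall i, P (f i)) ->
    P (\sum_i a i *: f i).
  by move=> h; apply/PE; apply: spline_sum => i; apply/PE.
apply: (@graded_projective_free _ _ _ (fun f => P f /\ ev f s0 = 0) m
  (fun i => b i - ev (b i) s0 *: const_tuple) ka).
- move=> k a f h; split; first by apply: Psum => i; apply: (h i).1.
  by rewrite ev_sum big1 // => i _; rewrite (h i).2 mulr0.
- move=> f d [Pf f0]; split; first by apply/PE; apply: spline_hcomp; apply/PE.
  by rewrite ev_hcomp f0 pihomog0.
- move=> i; split; last by rewrite evD evN evZ ev_const mulr1 subrr.
  apply/PE => T S1 S2 i1 i2; rewrite !evD !evN !evZ !ev_const opprD addrACA subrr addr0.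
  by apply: ((PE _).1 (Pb i)).
split=> [f [Pf f0]|l k a f h].
  apply: ev_inj => S; rewrite ev_sum.
  transitivity (ev f S - ev f s0); first by rewrite f0 subr0.
  rewrite {1 2}(kaE f Pf) !ev_sum -sumrB; apply: eq_bigr => i _.
  by rewrite evD evN evZ ev_const mulr1 mulrBr.
have Pf i : P (f i) by case: (h i).
have := kaE _ (Psum k a f Pf) => e.
apply: subr0_eq; apply: (bfree (fun l => ka l (\sum_i a i *: f i) - \sum_i a i * ka l (f i))).
under eq_bigr do rewrite scalerBl scaler_suml.
rewrite sumrB -e exchange_big /= -sumrB big1 // => i _.
rewrite {1}(kaE _ (Pf i)) scaler_sumr -sumrB big1 // => j _.
by rewrite scalerA subrr.
Qed.
End SplineModule.

(** * Restriction to the subdivided cell *)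

Section Extend.
Variables (R : realType) (k : nat).
Local Notation complex := {fset {fset 'rV[R]_k}}.
Local Notation simplex := {fset 'rV[R]_k}.
Local Notation poly := {mpoly R[k.+1]}.
Local Notation tuples D := {ffun faces k D -> poly^o}.

Lemma extend_linear (D : complex) (a : poly) (f g : tuples D) S :
  extend (a *: f + g) S = a * extend f S + extend g S.
Proof.
rewrite /extend; case: insub => [s|] /=; last by rewrite mulr0 addr0.
by rewrite !ffunE.
Qed.

Lemma extend_mk (D : complex) (h : simplex -> poly) S : S \in faces k D ->
  extend ([ffun s => h (val s)] : tuples D) S = h S.
Proof. by move=> cS; rewrite -[S]/(val [` cS]) extendE ffunE. Qed.

Definition restrict (D D' : complex) (f : tuples D) : tuples D' :=
  [ffun s => extend f (val s)].

Lemma restrict_is_linear D D' : linear (@restrict D D').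
Proof. by move=> a f g; apply/ffunP => s; rewrite !ffunE extend_linear. Qed.
HB.instance Definition _ D D' := GRing.isLinear.Build poly (tuples D) (tuples D') _
  (@restrict D D') (@restrict_is_linear D D').

Definition zero_on (E : complex) (D D' : complex) (f : tuples D) : tuples D' :=
  [ffun s => if val s \in E then 0 else extend f (val s)].

Lemma zero_on_is_linear E D D' : linear (@zero_on E D D').
Proof.
move=> a f g; apply/ffunP => s; rewrite !ffunE extend_linear.
by case: ifP => // _; rewrite scaler0 addr0.
Qed.
Lemma extend_zero_on E D D' (f : tuples D) S : S \in faces k D' ->
  extend (zero_on E D' f) S = if S \in E then 0 else extend f S.
Proof. exact: (extend_mk (fun S => if S \in E then 0 else extend f S)). Qed.

HB.instance Definition _ E D D' := GRing.isLinear.Build poly (tuples D) (tuples D') _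
  (@zero_on E D D') (@zero_on_is_linear E D D').

End Extend.

Section Main.
Variables (R : realType) (k r : nat).
Local Notation complex := {fset {fset 'rV[R]_k}}.
Local Notation simplex := {fset 'rV[R]_k}.
Local Notation poly := {mpoly R[k.+1]}.
Local Notation tuples D := {ffun faces k D -> poly^o}.
Variables (D D2 D1 : complex) (sigma : simplex).
Hypothesis D_complex : simplicial_complex D.
Hypothesis D_full : full_dimensional D.
Hypothesis D1_split : split_subdivision r D sigma D2 D1.
Local Notation dvd c p := (exists h : poly, p = h * linform c ^+ r.+1).

Let D1_complex : simplicial_complex D1.
Proof. by case: D1_split => -[]. Qed.

Lemma dvdB c (p q : poly) : dvd c p -> dvd c q -> dvd c (p - q).
Proof. by move=> [h ->] [h' ->]; exists (h - h'); rewrite mulrBl. Qed.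

(** The three kinds of pairs of cells of [D1]: both in [D2], both outside, or one on
    each side of a facet shared by [sigma] and a neighbour. *)
Lemma is_spline_glue (h : simplex -> poly) :
  is_spline D2 r.+1 h ->
  (forall S S' T c, S \in faces k D -> S != sigma -> S' \in faces k D -> S' != sigma ->
     T \in D -> #|` T| = k -> T `<=` S -> T `<=` S' -> defines T c ->
     dvd c (h S - h S')) ->
  (forall S S' T c, S \in faces k D -> S != sigma -> S' \in faces k D2 ->
     T \in D -> T \in D2 -> #|` T| = k -> T `<=` S -> T `<=` sigma -> T `<=` S' ->
     defines T c -> dvd c (h S - h S')) ->
  is_spline D1 r.+1 h.
Proof.
move=> h2 hD hmix S S' T c cS cS' TD1 cT TS TS' d.
have T0 : T != fset0 by have [H _ _] := D1_complex; exact: (H _ TD1).1.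
have inD G : G \in faces k D -> T `<=` G -> T \in D.
  by move=> /facesP[GD _] TG; have [_ sub _] := D_complex; exact: sub GD TG T0.
have inD2 G : G \in faces k D2 -> T `<=` G -> T \in D2.
  by move=> /facesP[GD _] TG; have [_ sub _] := D2_complex D1_split; exact: sub GD TG T0.
have ts : T \in D -> T \in D2 -> T `<=` sigma := @sub_sigma _ _ _ _ _ _ _ D_complex D1_split T.
have [[cSD nS]|cS2] := (D1_cellP D1_split _).1 cS;
  have [[cSD' nS']|cS2'] := (D1_cellP D1_split _).1 cS'.
- exact: (hD S S' T c cSD nS cSD' nS' (inD _ cSD TS) cT TS TS' d).
- have [TD TD2] := (inD _ cSD TS, inD2 _ cS2' TS').
  exact: (hmix S S' T c cSD nS cS2' TD TD2 cT TS (ts TD TD2) TS' d).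
- have [TD TD2] := (inD _ cSD' TS', inD2 _ cS2 TS).
  have [p e] := hmix S' S T c cSD' nS' cS2 TD TD2 cT TS' (ts TD TD2) TS d.
  by exists (- p); rewrite mulNr -e opprB.
- exact: (h2 S S' T c cS2 cS2' (inD2 _ cS2 TS) cT TS TS' d).
Qed.

Lemma is_spline_eq E (h h' : simplex -> poly) :
  (forall S, S \in faces k E -> h S = h' S) -> is_spline E r.+1 h -> is_spline E r.+1 h'.
Proof. by move=> e H S S' T c cS cS'; rewrite -!e //; apply: H. Qed.

Lemma cell_D1 S : S \in faces k D -> S != sigma -> S \in faces k D1.
Proof. by move=> cS nS; apply/(D1_cellP D1_split); left. Qed.

Lemma cell2_D1 S : S \in faces k D2 -> S \in faces k D1.
Proof. by move=> cS; apply/(D1_cellP D1_split); right. Qed.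

Lemma D1_full : full_dimensional D1.
Proof.
split=> [|T /(D1P D1_split)[[TD [G [cG nG TG]]]|TD2]].
- have [/fset0Pn[T TD2] _] := D2_full D1_split.
  by apply/fset0Pn; exists T; apply: (D2_sub D1_split).
- by exists G => //; apply: cell_D1.
- by have [S cS TS] := D2_over D1_split TD2; exists S => //; apply: cell2_D1.
Qed.

Lemma cell2_D2 S : S \in faces k D2 -> S \in D2.
Proof. by case/facesP. Qed.

Lemma inner_spline (f : tuples D1) : splines r D1 f -> splines r D2 (restrict D2 f).
Proof.
move=> /splinesP H; apply/splinesP.
apply: (@is_spline_eq _ (extend f)) => [S cS|]; first by rewrite extend_mk.
move=> S S' T c cS cS' TD2 cT TS TS' d.
by apply: (H S S' T c) => //; [apply: cell2_D1|apply: cell2_D1|apply: (D2_sub D1_split)].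
Qed.

(** The solution [u] of the jump problem is normalized by subtracting its value on
    [sigma]. *)
Lemma inner_surjective m (b : 'I_m -> tuples D) (g : tuples D2) :
  free_family (splines r D) b -> splines r D2 g ->
  exists2 f : tuples D1, splines r D1 f & restrict D2 f = g.
Proof.
move=> bfree /splinesP sg.
have [c dc] := facet_forms D_complex D_full.
have [u hu] := outer_exists D_complex D_full D1_split dc sg bfree.
pose h S := if S \in D2 then extend g S else extend u S - extend u sigma.
exists [ffun s => h (val s)]; last first.
  apply/ffunP => s; rewrite ffunE extend_mk; last by apply: cell2_D1; apply: valP.
  by rewrite /h cell2_D2 ?extendE //; apply: valP.
apply/splinesP.
apply: (@is_spline_eq _ h) => [S cS|]; first by rewrite extend_mk.
have sig := sigma_cell D1_split.
have jump S S' T c' : forall (cS : S \in faces k D) (cS' : S' \in faces k D)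
    (TF : T \in facets D), T `<=` S -> T `<=` S' -> defines T c' ->
    dvd c' (extend u S + sigma_jump D2 sigma (extend g) [` cS] [` TF] -
            (extend u S' + sigma_jump D2 sigma (extend g) [` cS'] [` TF])).
  move=> cS cS' TF TS TS' d; have [TD cT] := facetsP _ _ TF.
  apply: (dvd_defines D_complex cS cT TS (dc [` TF]) d).
  have := hu [` TF] [` cS] [` cS'] TS TS'.
  by rewrite /ev -!extendE !mul1r.
apply: is_spline_glue.
- apply: (@is_spline_eq _ (extend g)) => [S cS|//].
  by rewrite /h cell2_D2.
- move=> S S' T c' cS nS cS' nS' TD cT TS TS' d.
  rewrite /h (negbTE (cell_notin_D2 D_complex D1_split cS nS)).
  rewrite (negbTE (cell_notin_D2 D_complex D1_split cS' nS')).
  have TF : T \in facets D by apply/facetsP.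
  have := jump S S' T c' cS cS' TF TS TS' d.
  rewrite /sigma_jump /= (negbTE nS) (negbTE nS') !addr0.
  by rewrite opprB addrA subrK.
- move=> S S' T c' cS nS cS' TD TD2 cT TS Ts TS' d.
  rewrite /h (negbTE (cell_notin_D2 D_complex D1_split cS nS)) cell2_D2 //.
  have TF : T \in facets D by apply/facetsP.
  have := jump S sigma T c' cS sig TF TS Ts d.
  rewrite /sigma_jump /= (negbTE nS) eqxx addr0.
  have [s [cs Tss ->]] := innerE D1_split (extend g) (T := [` TF]) TD2.
  move=> j; have j2 := sg S' s T c' cS' cs TD2 cT TS' Tss d.
  by have [p e] := dvdB j j2; exists p; rewrite -e; ring.
Qed.

Lemma zero_on_spline (f : tuples D) : splines r D f -> extend f sigma = 0 ->
  splines r D1 (zero_on D2 D1 f).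
Proof.
move=> /splinesP H f0; apply/splinesP.
pose h S := if S \in D2 then 0 else extend f S.
apply: (@is_spline_eq _ h) => [S cS|]; first by rewrite extend_zero_on.
have sig := sigma_cell D1_split.
apply: is_spline_glue.
- by move=> S S' T c cS cS' _ _ _ _ _; exists 0; rewrite /h !cell2_D2 // subrr mul0r.
- move=> S S' T c cS nS cS' nS' TD cT TS TS' d.
  rewrite /h (negbTE (cell_notin_D2 D_complex D1_split cS nS)).
  rewrite (negbTE (cell_notin_D2 D_complex D1_split cS' nS')).
  exact: (H S S' T c).
- move=> S S' T c cS nS cS' TD TD2 cT TS Ts TS' d.
  rewrite /h (negbTE (cell_notin_D2 D_complex D1_split cS nS)) cell2_D2 //.
  by have := H S sigma T c cS sig TD cT TS Ts d; rewrite f0.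
Qed.

(** A spline of [D1] that vanishes on [D2] is zero modulo the powers of the forms of
    the facets that [sigma] shares with its neighbours, so setting it to zero on
    [sigma] gives a spline of [D]. *)
Lemma restrict_kernel (f : tuples D1) : splines r D1 f -> restrict D2 f = 0 ->
  exists2 g : tuples D, splines r D g /\ extend g sigma = 0 & zero_on D2 D1 g = f.
Proof.
move=> /splinesP H f0.
have sig := sigma_cell D1_split.
have f2 S : S \in faces k D2 -> extend f S = 0.
  by move=> cS; have := congr1 (fun u : tuples D2 => u [` cS]) f0; rewrite !ffunE.
pose h S := if S == sigma then 0 else extend f S.
exists [ffun s => h (val s)]; last first.
  apply/ffunP => s; rewrite ffunE; case: ifPn => [sD2|sD2].
    by rewrite -extendE f2 //; apply/facesP; split=> //; case/facesP: (valP s).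
  have [[cs ns]|/cell2_D2] := (D1_cellP D1_split _).1 (valP s); last by rewrite (negbTE sD2).
  by rewrite extend_mk // /h (negbTE ns) extendE.
split; last by rewrite extend_mk // /h eqxx.
apply/splinesP.
apply: (@is_spline_eq _ h) => [S cS|]; first by rewrite extend_mk.
have half S T c : S \in faces k D -> S != sigma -> T \in D -> #|` T| = k ->
    T `<=` S -> T `<=` sigma -> defines T c -> dvd c (extend f S).
  move=> cS nS TD cT TS Ts d.
  have [TD2 _] := shared_facet D_complex D1_split TD cT Ts cS nS TS.
  have [s cs Tss] := D2_over D1_split TD2.
  have := H S s T c (cell_D1 cS nS) (cell2_D1 cs) (D2_sub D1_split TD2) cT TS Tss d.
  by rewrite (f2 s cs) subr0.
move=> S S' T c cS cS' TD cT TS TS' d; rewrite /h.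
have [e|nS] := eqVneq S sigma; have [e'|nS'] := eqVneq S' sigma.
- by exists 0; rewrite subrr mul0r.
- rewrite e in TS; have [p ->] := half S' T c cS' nS' TD cT TS' TS d.
  by exists (- p); rewrite sub0r mulNr.
- by rewrite e' in TS'; rewrite subr0; exact: (half S T c cS nS TD cT TS TS' d).
- have TD1 : T \in D1.
    apply/(D1P D1_split); left; split=> //; exists S; split=> //.
  exact: (H S S' T c (cell_D1 cS nS) (cell_D1 cS' nS') TD1 cT TS TS' d).
Qed.

End Main.

Theorem theorem2p9 (R : realType) (k r : nat)
    (Delta Delta' Delta'' : {fset {fset 'rV[R]_k}}) (sigma : {fset 'rV[R]_k}) :
  simplicial_complex Delta ->
  full_dimensional Delta ->
  split_subdivision r Delta sigma Delta'' Delta' ->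
  free_submodule (splines r Delta) ->
  free_submodule (splines r Delta'') ->
  free_submodule (splines r Delta').
Proof.
move=> sD fD split freeD freeD2.
have sD1 : simplicial_complex Delta' by case: split => -[].
have [sD2 fD2] := (D2_complex split, D2_full split).
have fD1 := D1_full split.
have sig := sigma_cell split.
have [c dc] := facet_forms sD fD; have [c2 dc2] := facet_forms sD2 fD2.
have [m [b bfree]] := spline_family (facet_forms_neq0 sD fD dc)
  (splines_incident sD dc r) freeD.
have [m2 [b2 b2free]] := spline_family (facet_forms_neq0 sD2 fD2 dc2)
  (splines_incident sD2 dc2 r) freeD2.
have [m' [b' b'free]] := spline_vanishing_free [` sig]
  (splines_incident sD dc r) bfree.
have extend_sigma f : extend f sigma = ev f [` sig] by rewrite -[sigma]/(val [` sig]) extendE.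
have [m1 [b1 b1free]] : exists m1 (b1 : 'I_m1 -> {ffun faces k Delta' -> {mpoly R[k.+1]}^o}),
    free_family (splines r Delta') b1; last exact: free_family_submodule b1free.
have := @free_family_extension _ _ _ _ _ (splines r Delta') _
  (zero_on Delta'' Delta') (restrict Delta'') _ _ _ _ b'free b2free.
apply.
- have [c1 dc1] := facet_forms sD1 fD1.
  move=> n a x Nx; apply/(splines_incident sD1 dc1 r); apply: spline_sum => i.
  exact/(splines_incident sD1 dc1 r).
- move=> f [Sf f0]; apply: (zero_on_spline sD split Sf); rewrite extend_sigma //.
- move=> f _; apply/ffunP => s; rewrite ffunE extend_zero_on; last first.
    exact: cell2_D1 split _ (valP s).
  by rewrite (@cell2_D2 _ _ Delta'' _ (valP s)) ffunE.
- move=> f [_ f0] e; apply/ffunP => s; rewrite ffunE.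
  have [ss|ns] := eqVneq (val s) sigma.
    by rewrite -extendE ss extend_sigma.
  have cs := valP s; have cs1 := cell_D1 split cs ns.
  have := congr1 (fun u : {ffun faces k Delta' -> _} => u [` cs1]) e.
  by rewrite !ffunE /= (negbTE (cell_notin_D2 sD split cs ns)) extendE.
- by move=> f Sf; exact (inner_spline split Sf).
- move=> f Sf /(restrict_kernel sD split Sf)[g [Sg g0] gf]; exists g => //.
  by split=> //; rewrite -extend_sigma.
- by move=> g Sg; exact (inner_surjective sD fD split bfree Sg).
Qed.
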